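(* Let $\boldsymbol{\gamma}=(\gamma_j)_{j\ge1}$ be a sequence of non-negative real numbers with $\gamma_1\ge\gamma_2\ge\cdots$, defining product weights $\gamma_{\mathfrak{u}}=\prod_{j\in\mathfrak{u}}\gamma_j$. Assume that there is a $0\le\delta<1/2$ such that $$\limsup_{j\to\infty} j\gamma_j<\frac{\delta}{3}.$$ Then there is a constant $c_{\boldsymbol{\gamma},\delta}>0$, which depends only on $\boldsymbol{\gamma}$ and $\delta$ but not on $s$, such that for every prime power $q$, all $1\le s\le q$ and every set $\mathcal{P}_s$ of explicit inversive points of size $q$ in dimension $s$, $$D^*_{q,\boldsymbol{\gamma}}(\mathcal{P}_s)\le\frac{c_{\boldsymbol{\gamma},\delta}}{q^{1/2-\delta}}.$$ If $\limsup_{j\to\infty}j\gamma_j=0$, then this result holds for all $\delta>0$.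
   Context: Notation: $[s]=\{1,\dots,s\}$. $\mathbb{F}_q$ is the finite field with $q=p^k$ elements ($p$ prime, $k\ge1$), and $\{\beta_1,\dots,\beta_k\}$ is a fixed (arbitrary) ordered basis of $\mathbb{F}_q$ over $\mathbb{F}_p$. Digital point set. Given $\boldsymbol{z}_0,\dots,\boldsymbol{z}_{N-1}\in\mathbb{F}_q^s$, write $\boldsymbol{z}_n=\boldsymbol{c}_n^{(1)}\beta_1+\cdots+\boldsymbol{c}_n^{(k)}\beta_k$ with $\boldsymbol{c}_n^{(j)}\in\mathbb{F}_p^s$, identify $\mathbb{F}_p$ with $\{0,1,\dots,p-1\}$, and put $\boldsymbol{x}_n=\sum_{j=1}^k\boldsymbol{c}_n^{(j)}p^{-j}\in[0,1)^s$. The derived point set is $\mathcal{P}_s=\{\boldsymbol{x}_0,\dots,\boldsymbol{x}_{N-1}\}$ (points counted with multiplicity). For $z\in\mathbb{F}_q$ put $\overline{z}=z^{-1}$ if $z\neq0$ and $\overline{0}=0$. Let $S=\{v_1,\dots,v_s\}\subseteq\mathbb{F}_q$ be any subset of cardinality $s$, $1\le s\le q$. The set of explicit inversive points of size $q$ is the digital point set derived from the $N=q$ vectors $(\overline{u+v_1},\dots,\overline{u+v_s})$, $u\in\mathbb{F}_q$. Weighted star discrepancy. For an $N$-element point set $\mathcal{P}_s$ in $[0,1)^s$ and $\boldsymbol{\alpha}\in[0,1]^s$, let $\Delta_{\mathcal{P}_s}(\boldsymbol{\alpha})=\frac{|\mathcal{P}_s\cap[\boldsymbol{0},\boldsymbol{\alpha})|}{N}-\prod_{i=1}^s\alpha_i$.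 Then $$D^*_{N,\boldsymbol{\gamma}}(\mathcal{P}_s)=\max_{\emptyset\ne\mathfrak{u}\subseteq[s]}\gamma_{\mathfrak{u}}\sup_{\boldsymbol{\alpha}\in[0,1]^s}|\Delta_{\mathcal{P}_s}((\boldsymbol{\alpha}_{\mathfrak{u}},\boldsymbol{1}))|,$$ where $(\boldsymbol{\alpha}_{\mathfrak{u}},\boldsymbol{1})$ has $j$th coordinate $\alpha_j$ if $j\in\mathfrak{u}$ and $1$ if $j\notin\mathfrak{u}$. *)

(* Defs.v *)
From mathcomp Require Import all_boot all_order all_algebra all_field.
From mathcomp Require Import all_classical all_reals all_analysis.

Set Implicit Arguments.
Unset Strict Implicit.
Unset Printing Implicit Defensive.

Import Order.TTheory GRing.Theory Num.Theory.
Import numFieldNormedType.Exports.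
Local Open Scope classical_set_scope.
Local Open Scope ring_scope.

Section StarDiscrepancy.
Variables (R : realType) (s : nat).

Definition unit_cube : set 'rV[R]_s :=
  [set alpha | forall i, 0 <= alpha 0 i <= 1].

(* A point set with multiplicities is a finite family x : I -> 'rV[R]_s. *)
Definition local_discrepancy (I : finType) (x : I -> 'rV[R]_s)
    (alpha : 'rV[R]_s) : R :=
  #|[pred n | [forall i, 0 <= x n 0 i < alpha 0 i]]|%:R / #|I|%:R
  - \prod_i alpha 0 i.

Definition pad1 (u : {set 'I_s}) (alpha : 'rV[R]_s) : 'rV[R]_s :=
  \row_j (if j \in u then alpha 0 j else 1).

(* Weights are numbered from 1: the coordinate i : 'I_s is the (i+1)-st one. *)
Definition product_weight (gamma : nat -> R) (u : {set 'I_s}) : R :=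
  \prod_(j in u) gamma j.+1.

(* The sets of reals below are nonempty and bounded by 1. The neutral element 0
   of the maximum is harmless, since all terms are nonnegative when gamma is. *)
Definition weighted_star_discrepancy (gamma : nat -> R)
    (I : finType) (x : I -> 'rV[R]_s) : R :=
  \big[Num.max/0]_(u : {set 'I_s} | u != finset.set0)
    (product_weight gamma u *
     sup [set `|local_discrepancy x (pad1 u alpha)| | alpha in unit_cube]).

End StarDiscrepancy.

Section DigitalPoints.
Variables (R : realType) (p k : nat) (F : finFieldType).
Variable charF : p \in [pchar F].

(* pPrimeCharType charF is F viewed as a vector space over 'F_p; the j-th
   coordinate of z in the basis beta is read as an integer in {0, ..., p-1}. *)
Definition digit (beta : k.-tuple (pPrimeCharType charF)) (j : 'I_k) (z : F) : nat :=
  coord beta j (z : pPrimeCharType charF).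

(* As j : 'I_k starts at 0, the digit of index j has weight p^-(j+1). *)
Definition digital_point_set (beta : k.-tuple (pPrimeCharType charF)) (s : nat)
    (I : finType) (z : I -> 'rV[F]_s) (n : I) : 'rV[R]_s :=
  \row_i \sum_(j < k) (digit beta j (z n 0 i))%:R / p%:R ^+ j.+1.

(* The inverse of a field is total, with 0^-1 = 0. *)
Definition inversive_vector (s : nat) (v : 'I_s -> F) (u : F) : 'rV[F]_s :=
  \row_i (u + v i)^-1.

Definition explicit_inversive_points
    (beta : k.-tuple (pPrimeCharType charF)) (s : nat) (v : 'I_s -> F) : F -> 'rV[R]_s :=
  digital_point_set beta (inversive_vector v).

End DigitalPoints.

(* v enumerates an s-element subset of F; the order matters, as it assigns the
   weights to the coordinates. *)
Definition inversive_discrepancy_bound (R : realType) (gamma : nat -> R)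
    (delta c : R) : Prop :=
  forall (p k : nat) (F : finFieldType) (charF : p \in [pchar F])
    (beta : k.-tuple (pPrimeCharType charF)) (s : nat) (v : 'I_s -> F),
    prime p -> (0 < k)%N -> #|F| = (p ^ k)%N ->
    basis_of fullv beta ->
    (1 <= s <= p ^ k)%N -> injective v ->
    weighted_star_discrepancy gamma
      (explicit_inversive_points R beta v)
    <= c / (p ^ k)%:R `^ (1 / 2 - delta).

(* Main.v *)
Require Import Defs.
From HB Require Import structures.
From mathcomp Require Import all_boot all_order all_algebra all_solvable.
From mathcomp Require Import all_field.
From mathcomp Require Import complex ring lra zify.
From mathcomp Require Import all_classical all_reals all_analysis.
Set Implicit Arguments.
Unset Strict Implicit.
Unset Printing Implicit Defensive.
Import Order.TTheory GRing.Theory Num.Theory.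
Import numFieldNormedType.Exports.
Local Open Scope ring_scope.

(* The local discrepancy of a projection to m coordinates is expanded in additive
   characters of F, |F| = q. The one-dimensional Fourier coefficients of the
   intervals sum to at most 3 q ln q, so everything rests on the bound O(m sqrt q)
   for the sums of psi (\sum_i h_i / (u + v_i)), and the weights absorb the factor
   (3 ln q)^m because gamma_j <= theta / j with 3 theta < delta.

   The character sum bound is Weil's. After a Moebius map the rational function
   is f = e X + \sum_y a_y / (X - y) with e <> 0. The L-series of psi (c f) is a
   polynomial of degree at most 2 #|poles|, because a multiplicative character on
   monic polynomials averages to 0 in large degrees; so the sums over the
   extensions of degree r are power sums of its inverse roots. That these roots
   have modulus at most sqrt q follows from Stepanov's method in Bombieri's form:
   the number of points x of the extension of degree 2 n with Tr f x = b is at most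
   q^(2 n - 1) + O(q^n), since a function on the curve Y^q - Y = f with controlled
   poles vanishes at all of them. Extension fields are replaced throughout by the
   irreducible polynomials of F[X]. *)

(** * Power sums *)

(** Stepanov's method yields only upper bounds, with an unspecified constant in the error, only in
    even degrees 2 n (where q^n is the square root of the size of the extension), and it controls
    only the sum over all the nontrivial characters psi (c f). None of this hurts. The numbers of
    points of trace b, taken over all b, add up to q^(2 n) minus a bounded number of poles, so upper
    bounds for every b imply a lower bound for each. The moduli of the inverse roots depend only on
    the growth rate of their power sums: constants disappear, the roots may be squared, and those of
    all psi (c f) with c <> 0 may be pooled in one list. The condition e <> 0 gives f a simple pole
    at infinity, where Y^q - Y = f is totally ramified; pole orders there separate the monomials in
    x and Y. In the Fourier expansion the coordinates outside the projection carry only the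
    frequency 0, so the bound depends on m and not on s. The weights rest on Y^n / n! <= e^Y with Y
    proportional to ln q, which is again free of s. *)

Section PowerSums.
Variable C : numClosedFieldType.
Hypothesis archiC : forall x y : C, 1 < x -> 0 <= y -> exists n, y < x ^+ n.

(** Only the growth rate matters: an element larger than [rho], once isolated by a fixed combination
    of consecutive power sums, would outgrow every multiple of [rho ^+ n]. So [K] may be any
    constant. *)
Lemma power_sum_bound (s : seq C) (K rho : C) : 0 < rho ->
  (forall n, (0 < n)%N -> `|\sum_(a <- s) a ^+ n| <= K * rho ^+ n) ->
  forall a, a \in s -> `|a| <= rho.
Proof.
move=> rho_gt0 bnd a as_.
(* V kills all the other elements of s, so that a ^+ n is a fixed combination of
   the power sums of exponents n, n + 1, ... *)
pose V := \prod_(b <- undup s | b != a) ('X - b%:P).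
have Va : V.[a] != 0.
  rewrite horner_prod prodf_seq_neq0; apply/allP => b _; apply/implyP => ba.
  by rewrite !hornerE subr_eq0 eq_sym.
have Vb b : b \in s -> b != a -> V.[b] = 0.
  move=> bs ba; apply/eqP; rewrite horner_prod prodf_seq_eq0; apply/hasP.
  by exists b; rewrite ?mem_undup // ba !hornerE subrr eqxx.
have key n : \sum_(k < size V) V`_k * (\sum_(b <- s) b ^+ (n + k))
    = (a ^+ n * V.[a]) *+ count_mem a s.
  under eq_bigr do rewrite mulr_sumr.
  rewrite exchange_big /=.
  transitivity (\sum_(b <- s) (if b == a then a ^+ n * V.[a] else 0)).
    rewrite big_seq [RHS]big_seq; apply: eq_bigr => b bs.
    transitivity (b ^+ n * V.[b]).
      rewrite (horner_coef V) mulr_sumr; apply: eq_bigr => k _.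
      by rewrite exprD mulrCA.
    by case: eqP => [->//|/eqP ba]; rewrite Vb ?mulr0.
  by rewrite -big_mkcond big_const_seq iter_addr_0.
have cnt_gt0 : (0 < count_mem a s)%N by rewrite -has_count has_pred1.
pose K' := \sum_(k < size V) `|V`_k| * (K * rho ^+ k).
have bnd2 n : (0 < n)%N -> `|a| ^+ n * `|V.[a]| <= K' * rho ^+ n.
  move=> n_gt0; apply: (@le_trans _ _ `|(a ^+ n * V.[a]) *+ count_mem a s|).
    rewrite normrMn normrM normrX -[leLHS]mulr1n.
    by apply: ler_wpMn2l => //; rewrite mulr_ge0 ?exprn_ge0.
  rewrite -key; apply: le_trans (ler_norm_sum _ _ _) _.
  rewrite mulr_suml; apply: ler_sum => k _.
  rewrite normrM -mulrA ler_wpM2l //.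
  by apply: le_trans (bnd _ _) _; rewrite ?addn_gt0 ?n_gt0 // exprD mulrAC mulrA.
rewrite real_leNgt ?normr_real ?gtr0_real //; apply/negP => lt_rho.
have x1 : 1 < `|a| / rho by rewrite ltr_pdivlMr ?mul1r.
have Va0 : 0 < `|V.[a]| by rewrite normr_gt0.
have K0 : 0 <= K by rewrite -(pmulr_lge0 _ rho_gt0) -[rho]expr1 (le_trans _ (bnd _ _)).
have K'0 : 0 <= K' / `|V.[a]|.
  rewrite divr_ge0 // sumr_ge0 // => k _; rewrite !mulr_ge0 ?exprn_ge0 // ltW //.
have [n hn] := archiC x1 K'0.
have := bnd2 n.+1 isT; rewrite -ler_pdivlMr // -mulrA mulrC -mulrA.
rewrite mulrC -ler_pdivrMr ?exprn_gt0 // => h.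
have h2 : (`|a| / rho) ^+ n.+1 <= K' / `|V.[a]|.
  by rewrite expr_div_n mulrC [leRHS]mulrC [X in X <= _]mulrC.
have h3 : (`|a| / rho) ^+ n <= (`|a| / rho) ^+ n.+1.
  by rewrite exprS ler_peMl ?exprn_ge0 ?(ltW x1) // (ltW (lt_trans ltr01 x1)).
by have := lt_le_trans hn (le_trans h3 h2); rewrite ltxx.
Qed.

(** Newton's identities, the coefficient form of X L' = - (\sum_r p_r X^r) L. A new factor 1 - w X
    adds the series w X / (1 - w X) of the powers of w, whose denominator it cancels ([tel]). *)
Lemma newton_prod (s : seq C) (n : nat) :
  let L : {poly C} := \prod_(w <- s) (1 - w *: 'X) in
  n%:R * L`_n = - \sum_(r < n) (\sum_(w <- s) w ^+ r.+1) * L`_(n - r.+1).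
Proof.
elim: s n => [|w s IHs] n /=.
  rewrite !big_nil big1 ?oppr0; last by move=> r _; rewrite big_nil mul0r.
  by rewrite coef1; case: n => [|n]; rewrite ?mul0r ?mulr0.
rewrite !big_cons; set L := \prod_(j <- s) _ in IHs *.
have cL m : ((1 - w *: 'X) * L)`_m.+1 = L`_m.+1 - w * L`_m.
  by rewrite mulrBl mul1r -scalerAl coefB coefZ coefXM.
have cL0 : ((1 - w *: 'X) * L)`_0 = L`_0.
  by rewrite mulrBl mul1r -scalerAl coefB coefZ coefXM /= mulr0 subr0.
have split : \sum_(r < n) (\sum_(j <- w :: s) j ^+ r.+1) * ((1 - w *: 'X) * L)`_(n - r.+1)
  = \sum_(r < n) w ^+ r.+1 * ((1 - w *: 'X) * L)`_(n - r.+1) +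
    \sum_(r < n) (\sum_(j <- s) j ^+ r.+1) * ((1 - w *: 'X) * L)`_(n - r.+1).
  by rewrite -big_split /=; apply: eq_bigr => r _; rewrite big_cons mulrDl.
rewrite split.
case: n {split} => [|n]; first by rewrite !big_ord0 mul0r addr0 oppr0.
have tel : \sum_(r < n.+1) w ^+ r.+1 * ((1 - w *: 'X) * L)`_(n.+1 - r.+1) = w * L`_n.
  elim: n => [|n IHn]; first by rewrite big_ord1 subnn cL0 expr1.
  rewrite big_ord_recl subSS subn0 cL expr1 mulrBr /bump /=.
  have -> : \sum_(i < n.+1) w ^+ (1 + i).+1 * ((1 - w *: 'X) * L)`_(n.+2 - (1 + i).+1)
      = w * \sum_(i < n.+1) w ^+ i.+1 * ((1 - w *: 'X) * L)`_(n.+1 - i.+1).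
    rewrite mulr_sumr; apply: eq_bigr => i _.
    by rewrite add1n exprS mulrA !subSS.
  by rewrite IHn subrK.
rewrite opprD tel cL mulrBr.
have -> : \sum_(r < n.+1) (\sum_(j <- s) j ^+ r.+1) * ((1 - w *: 'X) * L)`_(n.+1 - r.+1)
  = \sum_(r < n.+1) (\sum_(j <- s) j ^+ r.+1) * L`_(n.+1 - r.+1)
    - w * \sum_(r < n) (\sum_(j <- s) j ^+ r.+1) * L`_(n - r.+1).
  rewrite big_ord_recr [in RHS]big_ord_recr /= subnn cL0.
  have -> : \sum_(i < n) (\sum_(j <- s) j ^+ i.+1) * ((1 - w *: 'X) * L)`_(n.+1 - i.+1)
    = \sum_(i < n) (\sum_(j <- s) j ^+ i.+1) * L`_(n.+1 - i.+1)
      - w * \sum_(r < n) (\sum_(j <- s) j ^+ r.+1) * L`_(n - r.+1).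
    rewrite mulr_sumr -sumrB; apply: eq_bigr => i _.
    rewrite subSS; have -> : (n - i = (n - i.+1).+1)%N by rewrite subnSK.
    by rewrite cL mulrBr mulrCA.
  by rewrite addrAC.
have := IHs n.+1; have := IHs n; cbv zeta => E2 E1.
set x := \sum_(r < n) _ in E2 *; set y := \sum_(r < n.+1) _ in E1 *.
rewrite E1 mulrCA -natr1 mulrDl mul1r E2; ring.
Qed.

(** As [lam 0 = 1], the recursion determines [v] from [lam], without division by n. The negated
    power sums of the inverse roots of \sum_n lam_n X^n satisfy the same recursion, so they are
    [v]. *)
Lemma newton_roots (N : nat) (lam v : nat -> C) : lam 0%N = 1 ->
  (forall n, (N < n)%N -> lam n = 0) ->
  (forall n, n%:R * lam n = \sum_(r < n) v r.+1 * lam (n - r.+1)%N) ->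
  {s : seq C | (size s <= N)%N & forall r, v r.+1 = - \sum_(w <- s) w ^+ r.+1}.
Proof.
move=> lam0 lamN rec.
pose p := \poly_(i < N.+1) lam i.
have p0 : p`_0 = 1 by rewrite coef_poly.
have pn i : p`_i = lam i.
  by rewrite coef_poly ltnS; case: leqP => // /lamN ->.
have [t tP] := closed_field_poly_normal p.
have t0 z : z \in t -> z != 0.
  move=> zt; apply/negP => /eqP z0; have := p0.
  rewrite -horner_coef0 tP hornerZ horner_prod.
  rewrite (big_rem z) //= hornerXsubC z0 subrr mul0r mulr0 => /esym/eqP.
  by rewrite oner_eq0.
have pE : p = \prod_(w <- map (fun z => z^-1) t) (1 - w *: 'X).
  have e1 : \prod_(z <- t) ('X - z%:P) =
      (\prod_(z <- t) (- z)) *: \prod_(w <- map (fun z => z^-1) t) (1 - w *: 'X) :> {poly C}.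
    rewrite big_map; elim: t {tP} t0 => [|z t IH] t0; first by rewrite !big_nil scale1r.
    rewrite !big_cons IH; last by move=> x xt; apply: t0; rewrite inE xt orbT.
    have z0 : z != 0 by apply: t0; rewrite inE eqxx.
    have -> : 'X - z%:P = (- z) *: (1 - z^-1 *: 'X).
      by rewrite scalerBr scalerA mulNr divff // !scaleNr scale1r opprK addrC -mul_polyC mulr1.
    by rewrite -scalerAl -scalerAr scalerA.
  rewrite {1}tP e1 scalerA.
  have := congr1 (fun u : {poly C} => u`_0) tP; rewrite p0 e1 /= !coefZ.
  have -> : (\prod_(w <- map (fun z => z^-1) t) (1 - w *: 'X))`_0 = 1 :> C.
    rewrite -horner_coef0 horner_prod big1 // => w _.
    by rewrite hornerD hornerN hornerZ hornerX mulr0 subr0 hornerE.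
  by rewrite mulr1 => <-; rewrite scale1r.
exists (map (fun z => z^-1) t).
  rewrite size_map.
  have sp : (size p <= N.+1)%N by apply: size_poly.
  have lp : lead_coef p != 0.
    rewrite lead_coef_eq0; apply/negP => /eqP p00; move: p0; rewrite p00 coef0 => /esym/eqP.
    by rewrite oner_eq0.
  move: sp; rewrite tP size_scale // size_prod_XsubC; done.
move=> r; elim/ltn_ind: r => r IH.
have := rec r.+1; rewrite -pn pE newton_prod -pE.
rewrite big_ord_recr [in X in _ = X -> _]big_ord_recr /= subnn p0 lam0 !mulr1 opprD.
have -> : \sum_(i < r) v i.+1 * lam (r.+1 - i.+1)%N
    = - \sum_(i < r) (\sum_(w <- [seq z^-1 | z <- t]) w ^+ i.+1) * p`_(r.+1 - i.+1).
  by rewrite -sumrN; apply: eq_bigr => i _; rewrite -mulNr -IH // pn.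
by move/addrI => ->.
Qed.
End PowerSums.

(** * The L-series of a character of monic polynomials *)

Section MonicPolynomials.
Variable F : finFieldType.
Implicit Types (P Q W : {poly F}) (d k n r : nat).

Definition monics n : seq {poly F} :=
  [seq 'X^n + polyn p | p : {poly_n F}].

Lemma mem_monics n P : (P \in monics n) = (P \is monic) && (size P == n.+1).
Proof.
apply/mapP/andP => [[p _ ->]|[mP /eqP sP]].
  have sp : (size (polyn p) < size ('X^n : {poly F}))%N.
    by rewrite size_polyXn ltnS size_npoly.
  by rewrite monicE lead_coefDl // lead_coefXn size_polyDl // size_polyXn !eqxx.
have sp : P - 'X^n \is a poly_of_size n.
  apply/leq_sizeP => j; rewrite leq_eqVlt => /orP[/eqP <-|lt_nj].
    by rewrite coefB coefXn eqxx -[n]/(n.+1.-1) -sP -lead_coefE (eqP mP) subrr.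
  by rewrite coefB coefXn gtn_eqF // subr0 nth_default // sP.
by exists (NPoly sp); rewrite ?mem_enum //= addrC subrK.
Qed.

Lemma monics_uniq n : uniq (monics n).
Proof.
by rewrite map_inj_uniq ?enum_uniq // => p q /addrI /val_inj.
Qed.

Lemma monics0 : monics 0 = [:: 1].
Proof.
apply: perm_small_eq => //; apply: uniq_perm => //; first exact: monics_uniq.
move=> P; rewrite mem_monics !inE.
apply/andP/eqP => [[mP /eqP sP]|->]; last by rewrite monic1 size_poly1.
have PE := size1_polyC (eq_leq sP).
by move: mP; rewrite PE monicE lead_coefC => /eqP ->.
Qed.

Lemma monics_mul n m P Q : P \in monics n -> Q \in monics m -> P * Q \in monics (n + m).
Proof.
rewrite !mem_monics => /andP[mP /eqP sP] /andP[mQ /eqP sQ].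
by rewrite monicMl // mQ size_Mmonic ?monic_neq0 // sP sQ addSn /= addnS eqxx.
Qed.

Lemma monics_exp d k P : P \in monics d -> P ^+ k \in monics (d * k).
Proof.
move=> Pd; elim: k => [|k IH]; first by rewrite muln0 monics0 inE.
by rewrite exprS mulnS monics_mul.
Qed.

Lemma dvdp_monics n r W P : W \in monics r -> P \in monics n -> W %| P ->
  (r <= n)%N && (P %/ W \in monics (n - r)).
Proof.
rewrite !mem_monics => /andP[mW /eqP sW] /andP[mP /eqP sP] WP.
have PE : P = P %/ W * W by rewrite divpK.
have mQ : P %/ W \is monic by move: mP; rewrite {1}PE monicMr.
have := sP; rewrite {1}PE size_Mmonic ?monic_neq0 // sW addnS /=.
have := monic_neq0 mQ; rewrite -size_poly_gt0; case: (size (P %/ W)) => // s _.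
rewrite addSn => -[<-]; rewrite leq_addl /= mQ /= addnK eqxx //.
Qed.

Lemma monics_dvd n r W : W \in monics r -> (r <= n)%N ->
  perm_eq [seq P <- monics n | W %| P] [seq W * Q | Q <- monics (n - r)].
Proof.
move=> Wr rn; have W0 : W != 0.
  by move: Wr; rewrite mem_monics => /andP[/monic_neq0].
apply: uniq_perm; first by rewrite filter_uniq // monics_uniq.
  rewrite map_inj_uniq ?monics_uniq // => P Q; exact: mulfI.
move=> P; rewrite mem_filter; apply/andP/mapP => [[WP Pn]|[Q Qn ->]].
  have /andP[_ Q] := dvdp_monics Wr Pn WP.
  by exists (P %/ W) => //; rewrite mulrC divpK.
by rewrite dvdp_mulr // -[X in monics X](subnKC rn) monics_mul.
Qed.

Definition irrs d := [seq P <- monics d | irreducibleb P].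

Lemma mem_irrs d P : P \in irrs d -> irreducible_poly P /\ P \in monics d.
Proof. by rewrite mem_filter => /andP[/irreducibleP]. Qed.

Lemma irrs_uniq d : uniq (irrs d).
Proof. by rewrite filter_uniq // monics_uniq. Qed.

Lemma irrs_gt0 d P : P \in irrs d -> (0 < d)%N.
Proof.
by move=> /mem_irrs[[s _]]; rewrite mem_monics => /andP[_ /eqP sP]; rewrite sP in s.
Qed.

Lemma irrs_size d P : P \in irrs d -> size P = d.+1.
Proof. by move=> /mem_irrs[_]; rewrite mem_monics => /andP[_ /eqP]. Qed.

Lemma irrs_monic d P : P \in irrs d -> P \is monic.
Proof. by move=> /mem_irrs[_]; rewrite mem_monics => /andP[]. Qed.

Lemma exists_irr n P : P \in monics n.+1 ->
  exists d W, W \in irrs d /\ W %| P.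
Proof.
elim/ltn_ind: n P => n IH P Pn.
case: (boolP (irreducibleb P)) => [iP|niP].
  by exists n.+1, P; rewrite mem_filter iP Pn.
move: (Pn); rewrite mem_monics => /andP[mP /eqP sP].
have [q [q1 qP nqP]] : exists q : {poly F}, [/\ size q != 1%N, q %| P & ~~ (q %= P)].
  apply: contrapT => no; case/negP: niP; apply/irreducibleP; split; first by rewrite sP.
  by move=> q q1 qP; apply: contrapT => nq; apply: no; exists q; split=> //; apply/negP.
have P0 := monic_neq0 mP.
have q0 : q != 0 by apply: contraTneq qP => ->; rewrite dvd0p.
have lq : (lead_coef q)^-1 != 0 by rewrite invr_eq0 lead_coef_eq0.
have sq : (1 < size q < n.+2)%N.
  rewrite ltn_neqAle eq_sym q1 size_poly_gt0 q0 /= -sP ltn_neqAle dvdp_leq // andbT.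
  by rewrite dvdp_size_eqp.
case/andP: sq => s1 s2; case e : (size q) => [|[|m]]; rewrite e // in s1 s2.
have [||d [W [Wd Wq]]] := IH m _ ((lead_coef q)^-1 *: q); first by [].
  rewrite mem_monics monicE lead_coefZ mulVf ?lead_coef_eq0 // eqxx /=.
  by rewrite size_scale // e.
exists d, W; split=> //; apply: dvdp_trans qP.
by rewrite dvdpZr in Wq.
Qed.

Lemma irrs_coprime d e P Q : P \in irrs d -> Q \in irrs e -> P != Q -> coprimep P Q.
Proof.
move=> Pd Qe; apply: contraNT; have [iP _] := mem_irrs Pd; have [iQ _] := mem_irrs Qe.
rewrite irreducible_poly_coprime // negbK => PQ.
have : P %= Q by apply: iQ.2 PQ; rewrite (irrs_size Pd) eqSS -lt0n (irrs_gt0 Pd).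
by rewrite eqp_monic // ?(irrs_monic Pd) ?(irrs_monic Qe).
Qed.

(* The analogue for monic polynomials of log n = \sum_(d | n) Lambda d. *)
Lemma deg_prime_powers N n P : P \in monics n -> (n <= N)%N ->
  (\sum_(1 <= d < N.+1) \sum_(W <- irrs d) \sum_(1 <= k < N.+1)
     d * (W ^+ k %| P)%R = n)%N.
Proof.
elim/ltn_ind: n P => n IH P Pn nN.
case: n IH Pn nN => [|n] IH Pn nN.
  rewrite big_seq big1 // => d _; rewrite big_seq big1 // => W Wd.
  rewrite big_nat big1 // => k /andP[k0 _].
  move: Pn; rewrite monics0 inE => /eqP ->.
  have := monics_exp k (mem_irrs Wd).2; rewrite mem_monics dvdp1 => /andP[_ /eqP ->].
  by rewrite eqSS muln_eq0 eqn0Ngt (irrs_gt0 Wd) eqn0Ngt k0 muln0.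
have [d0 [W0 [Wd0 WP]]] := exists_irr Pn.
have [_ Wm0] := mem_irrs Wd0.
have /andP[dn Qn] := dvdp_monics Wm0 Pn WP.
have d0_gt0 := irrs_gt0 Wd0.
set Q := P %/ W0 in Qn.
have PE : P = W0 * Q by rewrite mulrC divpK.
have IHQ := IH (n.+1 - d0)%N _ Q Qn _.
rewrite -[RHS](subnK dn) -IHQ; last 2 first.
- by rewrite ltn_subrL d0_gt0.
- by rewrite (leq_trans (leq_subr _ _)).
(* The contribution of one factor [W0], spread over the index set of the other sums so that they can
   be compared termwise. *)
have -> : d0 = (\sum_(1 <= d < N.+1) \sum_(W <- irrs d) (if (W == W0) then d0 else 0))%N.
  rewrite (big_rem d0) /=; last by rewrite mem_index_iota d0_gt0 ltnS (leq_trans dn).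
  rewrite (big_rem W0) //= eqxx big_seq big1 ?addn0; last first.
    by move=> W; rewrite rem_filter ?irrs_uniq // mem_filter /= => /andP[/negPf ->].
  rewrite big_seq big1 ?addn0 // => d; rewrite rem_filter ?iota_uniq // mem_filter /= => /andP[dd _].
  rewrite big_seq big1 // => W Wd; case: eqP => // WE; move: dd; rewrite -WE in Wd0.
  by have := irrs_size Wd; rewrite (irrs_size Wd0) => -[->]; rewrite eqxx.
rewrite -big_split /=; apply: eq_bigr => d _.
rewrite -big_split /=; apply: eq_big_seq => W Wd.
case: eqP => [WE|/eqP WW]; last first.
  rewrite addn0; apply: eq_bigr => k _.
  have cop := coprimep_expl k (irrs_coprime Wd Wd0 WW).
  by rewrite PE (Gauss_dvdpr _ cop).
have dd : d = d0.
  by have := irrs_size Wd; rewrite WE (irrs_size Wd0) => -[->].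
subst W d.
rewrite -!big_distrr /= -mulnSr; congr (_ * _)%N.
rewrite !big_add1 /=.
have -> : (\sum_(0 <= i < N) (W0 ^+ i.+1 %| P)%R = \sum_(0 <= i < N) (W0 ^+ i %| Q)%R)%N.
  by apply: eq_bigr => i _; rewrite PE exprS dvdp_mul2l // monic_neq0 // (irrs_monic Wd0).
case: N nN {IH IHQ} => [//|N] nN.
rewrite big_nat_recl // [in RHS]big_nat_recr //= expr0 dvd1p.
(* Dividing by [W0] shifts the exponents by one; the term left over at the end of the range vanishes
   for degree reasons. *)
suff -> : (W0 ^+ N.+1 %| Q) = false by rewrite addn0.
apply/negP => h; have /andP[h1 _] := dvdp_monics (monics_exp N.+1 Wm0) Qn h.
have h2 : (n.+1 <= d0 * N.+1)%N by rewrite (leq_trans nN) // leq_pmull.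
by have := leq_trans h2 h1; rewrite leqNgt ltn_subrL d0_gt0.
Qed.

Lemma sum_multiples (V : zmodType) (d n : nat) (h : nat -> V) : (0 < d)%N ->
  \sum_(1 <= r < n.+1 | (d %| r)%N) h r =
  \sum_(1 <= k < n.+1 | (d * k <= n)%N) h (d * k)%N.
Proof.
move=> d0.
transitivity (\sum_(1 <= r < n.+1) \sum_(1 <= k < n.+1) (if r == (d * k)%N then h r else 0)).
  rewrite big_mkcond /= big_nat [RHS]big_nat; apply: eq_bigr => r /andP[r0 rn].
  case: ifP => [/dvdnP[k rE]|nd]; last first.
    by rewrite big1 // => k _; case: eqP => // rE; rewrite rE dvdn_mulr in nd.
  rewrite (big_rem k) /=; last first.
    rewrite mem_index_iota; move: r0 rn; rewrite rE muln_gt0 => /andP[-> _] /=.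
    by rewrite !ltnS => /(leq_trans _); apply; rewrite leq_pmulr.
  have rE' : r = (d * k)%N by rewrite mulnC.
  rewrite -rE' eqxx big_seq big1 ?addr0 // => j.
  rewrite rem_filter ?iota_uniq // mem_filter /= => /andP[jk _].
  by rewrite rE' eqn_pmul2l // eq_sym (negPf jk).
rewrite exchange_big /= [RHS]big_mkcond /= big_nat [RHS]big_nat; apply: eq_bigr => k /andP[k0 kn].
case: ifP => [le|gt].
  rewrite (big_rem (d * k)%N) /=; last by rewrite mem_index_iota muln_gt0 d0 k0 ltnS.
  rewrite eqxx big_seq big1 ?addr0 // => j.
  by rewrite rem_filter ?iota_uniq // mem_filter /= => /andP[/negPf ->].
rewrite big_nat big1 // => r /andP[_ rn]; case: eqP => // rE.
by rewrite -rE -ltnS rn in gt.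
Qed.

Section LSeries.
Variables (C : comNzRingType) (chi : {poly F} -> C).
Hypothesis chi1 : chi 1 = 1.
Hypothesis chiM : forall P Q, P \is monic -> Q \is monic -> chi (P * Q) = chi P * chi Q.

(** The coefficient of T^n in the L-series of [chi]. *)
Definition monic_sum n := \sum_(P <- monics n) chi P.
(* The sum of Lambda P * chi P over the monic P of degree r. *)
Definition mangoldt_sum r := \sum_(1 <= d < r.+1 | (d %| r)%N)
  \sum_(W <- irrs d) d%:R * chi W ^+ (r %/ d).

Lemma monic_sum0 : monic_sum 0 = 1.
Proof. by rewrite /monic_sum monics0 big_seq1. Qed.

Lemma chiX W k : W \is monic -> chi (W ^+ k) = chi W ^+ k.
Proof.
move=> mW; elim: k => [|k IH]; first by rewrite !expr0.
by rewrite !exprS chiM ?monic_exp // IH.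
Qed.

(** The logarithmic derivative of the Euler product, without power series: the factor n, as the
    degree of each P, is distributed over the prime powers W^k dividing P, and P = W^k Q turns the
    sum over P into one over Q. *)
Lemma monic_sum_rec n : n%:R * monic_sum n = \sum_(r < n) mangoldt_sum r.+1 * monic_sum (n - r.+1).
Proof.
transitivity (\sum_(1 <= d < n.+1) \sum_(W <- irrs d) \sum_(1 <= k < n.+1 | (d * k <= n)%N)
   d%:R * chi W ^+ k * monic_sum (n - d * k)).
  rewrite /monic_sum mulr_sumr.
  transitivity (\sum_(P <- monics n) \sum_(1 <= d < n.+1) \sum_(W <- irrs d)
     \sum_(1 <= k < n.+1) (if W ^+ k %| P then d%:R * chi P else 0)).
    rewrite big_seq [RHS]big_seq; apply: eq_bigr => P Pn.
    rewrite -{1}(deg_prime_powers Pn (leqnn n)) natr_sum mulr_suml; apply: eq_bigr => d _.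
    rewrite natr_sum mulr_suml; apply: eq_bigr => W _.
    rewrite natr_sum mulr_suml; apply: eq_bigr => k _.
    by rewrite natrM; case: ifP => _; rewrite ?mulr1 ?mulr0 ?mul0r.
  rewrite exchange_big /=; apply: eq_bigr => d _.
  rewrite exchange_big /=; apply: eq_big_seq => W Wd.
  rewrite exchange_big /= [RHS]big_mkcond /=; apply: eq_bigr => k _.
  have [_ Wm] := mem_irrs Wd; have Wk := monics_exp k Wm.
  rewrite -big_mkcond /= -big_filter.
  case: ifP => [le|gt].
    rewrite (perm_big _ (monics_dvd Wk le)) big_map mulr_sumr.
    rewrite big_seq [RHS]big_seq; apply: eq_bigr => Q; rewrite mem_monics => /andP[mQ _].
    by rewrite chiM ?monic_exp ?(irrs_monic Wd) // chiX ?(irrs_monic Wd) // mulrA.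
  rewrite big_filter big_seq_cond big1 // => P /andP[Pn /(dvdp_monics Wk Pn)].
  by rewrite gt.
transitivity (\sum_(1 <= r < n.+1) mangoldt_sum r * monic_sum (n - r)); last first.
  by rewrite big_add1 /= big_mkord.
transitivity (\sum_(1 <= r < n.+1) \sum_(1 <= d < n.+1 | (d %| r)%N) 
     \sum_(W <- irrs d) d%:R * chi W ^+ (r %/ d) * monic_sum (n - r)); last first.
  rewrite big_nat [RHS]big_nat; apply: eq_bigr => r /andP[r0 rn].
  rewrite /mangoldt_sum mulr_suml (big_cat_nat (n := r.+1)) //=.
  rewrite [X in _ + X]big_nat_cond [X in _ + X]big1 ?addr0; last first.
    move=> d /andP[/andP[rd _]] /(dvdn_leq r0); by rewrite leqNgt rd.
  by apply: eq_bigr => d _; rewrite mulr_suml.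
rewrite (exchange_big_dep_nat xpredT) //=.
rewrite big_nat [RHS]big_nat; apply: eq_bigr => d /andP[d0 dn].
rewrite [RHS]exchange_big /=; apply: eq_bigr => W _.
rewrite (@sum_multiples _ d n (fun r => d%:R * chi W ^+ (r %/ d) * monic_sum (n - r))) //.
by apply: eq_bigr => k _; rewrite mulKn.
Qed.
End LSeries.
End MonicPolynomials.

(** * Frobenius powers and conjugates *)

Section FieldPowers.
Variables (F : finFieldType) (A : comNzRingType) (iota : {rmorphism F -> A}).
Local Notation q := #|F|.

Lemma pchar_card_nat i : [pchar A].-nat (q ^ i)%N.
Proof.
have [p pr_p pF] := finPcharP F.
have pA : p \in [pchar A] := rmorph_pchar iota pF.
rewrite (eq_pnat _ (pcharf_eq pA)) pnatX; apply/orP; left.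
by have := abelem_pgroup (fin_ring_pchar_abelem pF); rewrite /pgroup cardsT.
Qed.

Lemma card_field_gt1 : (1 < q)%N.
Proof. exact: finNzRing_gt1. Qed.

Lemma card_expn_gt0 i : (0 < q ^ i)%N.
Proof. by rewrite expn_gt0 (ltnW card_field_gt1). Qed.

(** Stated over any commutative ring that receives [F], since it serves in extension fields, in
    [{poly L}] and in [{poly {poly F}}]. *)
Lemma expr_cardD i (x y : A) : (x + y) ^+ (q ^ i) = x ^+ (q ^ i) + y ^+ (q ^ i).
Proof. exact: exprDn_pchar (pchar_card_nat i). Qed.

Lemma expr_cardB i (x y : A) : (x - y) ^+ (q ^ i) = x ^+ (q ^ i) - y ^+ (q ^ i).
Proof. by rewrite expr_cardD exprNn_pchar // pchar_card_nat. Qed.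

Lemma expr_card_sum i (I : Type) (s : seq I) (P : pred I) (f : I -> A) :
  (\sum_(j <- s | P j) f j) ^+ (q ^ i) = \sum_(j <- s | P j) f j ^+ (q ^ i).
Proof.
apply: (big_morph (fun x => x ^+ (q ^ i)) (expr_cardD i)).
by rewrite expr0n eqn0Ngt card_expn_gt0.
Qed.

Lemma fixed_card i (x : F) : x ^+ (q ^ i) = x.
Proof. by elim: i => [|i IH]; rewrite ?expr1 // expnS exprM expf_card. Qed.

Lemma horner_expr_card i (P : {poly F}) (x : A) :
  (map_poly iota P).[x] ^+ (q ^ i) = (map_poly iota P).[x ^+ (q ^ i)].
Proof.
rewrite !horner_coef expr_card_sum; apply: eq_bigr => j _.
by rewrite exprMn -!exprM mulnC coef_map -rmorphXn fixed_card.
Qed.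

Lemma exprM_card i j (x : A) : (x ^+ (q ^ i)) ^+ (q ^ j) = x ^+ (q ^ (i + j)).
Proof. by rewrite -exprM expnD. Qed.
End FieldPowers.

Section Conjugates.
Variables (F : finFieldType) (L : fieldType) (iota : {rmorphism F -> L}).
Local Notation q := #|F|.

Definition frob_card (x : L) : L := x ^+ q.
Lemma frob_card_nmod : nmod_morphism frob_card.
Proof.
split; first by rewrite /frob_card expr0n eqn0Ngt (ltnW (card_field_gt1 F)).
by move=> x y; rewrite /frob_card -[q]expn1 (expr_cardD iota).
Qed.
Lemma frob_card_monoid : monoid_morphism frob_card.
Proof. by split; [exact: expr1n | move=> x y; exact: exprMn]. Qed.
HB.instance Definition _ := GRing.isNmodMorphism.Build L L frob_card frob_card_nmod.
HB.instance Definition _ := GRing.isMonoidMorphism.Build L L frob_card frob_card_monoid.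

Lemma expr_card_inj i (x y : L) : x ^+ (q ^ i) = y ^+ (q ^ i) -> x = y.
Proof.
move=> /eqP; rewrite -subr_eq0 -(expr_cardB iota) expf_eq0 subr_eq0 => /andP[_ /eqP].
by [].
Qed.

(** X^q - X already splits over [F], so it has no further roots in [L]. *)
Lemma fixed_in_image (x : L) : x ^+ q = x -> exists y, x = iota y.
Proof.
move=> xq; have : ('X^q - 'X : {poly L}).[x] = 0 by rewrite hornerD hornerN hornerXn hornerX xq subrr.
have -> : 'X^q - 'X = \prod_y ('X - (iota y)%:P) :> {poly L}.
  have := congr1 (map_poly iota) (finField_genPoly F).
  rewrite rmorphB rmorph_prod /= map_polyXn map_polyX => ->.
  by apply: eq_bigr => y _; rewrite rmorphB /= map_polyX map_polyC.
rewrite horner_prod => /eqP/prodf_eq0[y _]; rewrite hornerXsubC subr_eq0 => /eqP ->.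
by exists y.
Qed.

Lemma irr_dvd d (W P : {poly F}) (z : L) : W \in irrs F d ->
  root (map_poly iota W) z -> root (map_poly iota P) z = (W %| P).
Proof.
move=> Wd rW; apply/idP/idP => [rP|/dvdpP[Q ->]]; last first.
  by rewrite rmorphM /= rootM rW orbT.
have [iW _] := mem_irrs Wd; apply: contraT; rewrite -irreducible_poly_coprime //.
rewrite -(coprimep_map iota) => /coprimep_root/(_ rW).
by rewrite (rootP rP) eqxx.
Qed.

(** The d + 1 powers z^(q^i), i <= d, are roots of [W], so two of them agree and z^(q^e) = z for
    some 0 < e <= d. The product [M] over the first e powers is fixed by Frobenius, hence comes from
    [F], and [W] divides it; so e = d and [W] is this product. *)
Lemma irr_conjugates d (W : {poly F}) (z : L) : W \in irrs F d ->
  root (map_poly iota W) z ->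
  map_poly iota W = \prod_(i < d) ('X - (z ^+ (q ^ i))%:P) /\ z ^+ (q ^ d) = z.
Proof.
move=> Wd rW; have sW := irrs_size Wd; have W0 := monic_neq0 (irrs_monic Wd).
have d0 := irrs_gt0 Wd.
pose rs := mkseq (fun i => z ^+ (q ^ i)) d.+1.
have : ~~ uniq rs.
  apply/negP => urs.
  have := @max_poly_roots _ (map_poly iota W) rs.
  rewrite map_poly_eq0 W0 => /(_ isT) h.
  have : all (root (map_poly iota W)) rs.
    apply/allP => x /mapP[i _ ->]; rewrite rootE -(horner_expr_card iota).
    by rewrite (rootP rW) expr0n eqn0Ngt (card_expn_gt0 F).
  by move/h => /(_ urs); rewrite size_mkseq size_map_poly sW ltnn.
case/(uniqPn 0) => i [j [lij]]; rewrite size_mkseq => ljd.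
rewrite !nth_mkseq ?(ltn_trans lij) // => eij.
pose e := (j - i)%N.
have e0 : (0 < e)%N by rewrite subn_gt0.
have ed : (e <= d)%N by rewrite (leq_trans (leq_subr _ _)).
have ze : z ^+ (q ^ e) = z.
  by apply: (@expr_card_inj i); rewrite (exprM_card F) subnK ?(ltnW lij).
pose M := \prod_(i < e) ('X - (z ^+ (q ^ i))%:P).
have MF : map_poly frob_card M = M.
  rewrite rmorph_prod /=.
  under eq_bigr => k _ do rewrite rmorphB /= map_polyX map_polyC /= /frob_card -[X in _ ^+ X]expn1 (exprM_card F) addn1.
  rewrite /M; case: (e) e0 ze => [//|m] _ ze.
  by rewrite big_ord_recr [RHS]big_ord_recl /= ze expr1 mulrC.
have Mc k : exists y, M`_k = iota y.
  apply: fixed_in_image; rewrite -[in RHS]MF coef_map //.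
have [c cP] := choice Mc.
pose M0 := \poly_(k < size M) c k.
have M0E : map_poly iota M0 = M.
  apply/polyP => k; rewrite coef_map coef_poly; case: ltnP => [_|h].
    by rewrite [RHS]cP.
  by rewrite raddf0 nth_default.
have sM : size M = e.+1 by rewrite size_prod_XsubC /index_enum -enumT size_enum_ord.
have mM : M \is monic by exact: monic_prod_XsubC.
have sM0 : size M0 = e.+1 by rewrite -sM -M0E size_map_poly.
have mM0 : M0 \is monic by rewrite -(map_monic iota) M0E.
have WM : W %| M0.
  rewrite -(irr_dvd _ Wd rW) M0E /M; case: (e) e0 => [//|m] _.
  by rewrite big_ord_recl /= expr1 rootM root_XsubC eqxx.
have de : d = e.
  apply/eqP; rewrite eqn_leq ed andbT.
  by have := dvdp_leq (monic_neq0 mM0) WM; rewrite sW sM0.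
have WE : W = M0.
  apply/eqP; rewrite -eqp_monic // ?(irrs_monic Wd) //.
  by rewrite -dvdp_size_eqp // sW sM0 de.
by rewrite WE M0E /M de.
Qed.

End Conjugates.

Section ProdIrr.
Variable F : finFieldType.
(** Takes the place of counting the roots of [P] in an extension field: an irreducible [W] stands
    for its [(size W).-1] conjugate roots. *)
Lemma sum_irr_degrees (s : seq {poly F}) (P : {poly F}) : P != 0 -> uniq s ->
  (forall W, W \in s -> exists2 d, W \in irrs F d & W %| P) ->
  (\sum_(W <- s) (size W).-1 <= (size P).-1)%N.
Proof.
move=> P0 us sP.
have : \prod_(W <- s) W %| P.
  elim: s us sP => [|W s IH] /=; first by rewrite big_nil dvd1p.
  move=> /andP[Ws us] sP; rewrite big_cons Gauss_dvdp.
    have [d _ ->] := sP _ (mem_head _ _); apply: IH => // V Vs.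
    by apply: sP; rewrite inE Vs orbT.
  have [d Wd _] := sP _ (mem_head _ _).
  rewrite big_seq; elim/big_rec: _ => [|V Q Vs cQ]; first exact: coprimep1.
  rewrite coprimepMr cQ andbT.
  have [e Ve _] := sP V ltac:(by rewrite inE Vs orbT).
  apply: (irrs_coprime Wd Ve); by apply: contraNneq Ws => ->.
move/(dvdp_leq P0) => le.
have -> : (\sum_(W <- s) (size W).-1 = (size (\prod_(W <- s) W)%R).-1)%N; last first.
  by rewrite -!subn1 leq_sub2r.
rewrite big_seq [in RHS]big_seq.
suff [-> _] : (size (\prod_(W <- s | W \in s) W)%R = (\sum_(W <- s | W \in s) (size W).-1).+1)%N
   /\ \prod_(W <- s | W \in s) W \is monic by [].
elim/big_rec2: _ => [|V n Q Vs [IH mQ]]; first by rewrite size_poly1 monic1.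
have [d Vd _] := sP _ Vs; have mV := irrs_monic Vd.
rewrite size_Mmonic ?monic_neq0 // IH monicMl // mQ; split=> //.
by rewrite (irrs_size Vd) addnS.
Qed.
End ProdIrr.

(** * Stepanov and Bombieri: points on an Artin-Schreier curve *)

Section Congruence.
Variable R : comNzRingType.
Implicit Types m x y z : R.

(** Equality in the quotient by the ideal of [m]; working with it avoids forming the coordinate ring
    of the curve and its fibres. *)
Definition cong m x y := exists h, x - y = m * h.

Lemma cong_refl m x : cong m x x.
Proof. by exists 0; rewrite subrr mulr0. Qed.

Lemma cong_sym m x y : cong m x y -> cong m y x.
Proof. by case=> h e; exists (- h); rewrite mulrN -e opprB. Qed.

Lemma cong_trans m y x z : cong m x y -> cong m y z -> cong m x z.
Proof. by move=> [h1 e1] [h2 e2]; exists (h1 + h2); rewrite mulrDr -e1 -e2 addrA subrK. Qed.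

Lemma congD m x1 y1 x2 y2 : cong m x1 y1 -> cong m x2 y2 -> cong m (x1 + x2) (y1 + y2).
Proof. by move=> [h1 e1] [h2 e2]; exists (h1 + h2); rewrite mulrDr -e1 -e2; ring. Qed.

Lemma congM m x1 y1 x2 y2 : cong m x1 y1 -> cong m x2 y2 -> cong m (x1 * x2) (y1 * y2).
Proof.
move=> [h1 e1] [h2 e2]; exists (h1 * x2 + y1 * h2).
have -> : m * (h1 * x2 + y1 * h2) = (m * h1) * x2 + y1 * (m * h2) by ring.
by rewrite -e1 -e2; ring.
Qed.

Lemma congX m x y k : cong m x y -> cong m (x ^+ k) (y ^+ k).
Proof.
move=> c; elim: k => [|k IH]; first by rewrite !expr0; apply: cong_refl.
by rewrite !exprS; apply: congM.
Qed.

Lemma cong_sum m (I : Type) (s : seq I) (P : pred I) (f g : I -> R) :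
  (forall i, P i -> cong m (f i) (g i)) ->
  cong m (\sum_(i <- s | P i) f i) (\sum_(i <- s | P i) g i).
Proof.
move=> c; elim/big_rec2: _ => [|i x y Pi IH]; first exact: cong_refl.
by apply: congD => //; apply: c.
Qed.
End Congruence.

Section CoefDegree.
Variable F : fieldType.
Implicit Types P Q : {poly {poly F}}.

(** A bound for the degree in the inner variable X only; the degree in the outer variable Y is
    measured by [size]. *)
Definition xdeg_le n P := forall i, (size (P`_i)%R <= n.+1)%N.

Lemma xdeg_leW n m P : (n <= m)%N -> xdeg_le n P -> xdeg_le m P.
Proof. by move=> nm c i; apply: leq_trans (c i) _. Qed.

Lemma xdeg_leD n P Q : xdeg_le n P -> xdeg_le n Q -> xdeg_le n (P + Q).
Proof.
move=> cP cQ i; rewrite coefD; apply: leq_trans (size_polyD _ _) _.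
by rewrite geq_max cP cQ.
Qed.

Lemma xdeg_le_sum n (I : Type) (s : seq I) (f : I -> {poly {poly F}}) :
  (forall i, xdeg_le n (f i)) -> xdeg_le n (\sum_(i <- s) f i).
Proof.
move=> c; elim/big_rec: _ => [|i P _ IH]; first by move=> i; rewrite coef0 size_poly0.
exact: xdeg_leD.
Qed.

Lemma xdeg_leM n m P Q : xdeg_le n P -> xdeg_le m Q -> xdeg_le (n + m) (P * Q).
Proof.
move=> cP cQ i; rewrite coefM; apply: leq_trans (size_sum _ _ _) _.
apply/bigmax_leqP => j _; apply: leq_trans (size_polyMleq _ _) _.
have := cP j; have := cQ (i - j)%N; lia.
Qed.

Lemma xdeg_le1 n : xdeg_le n 1.
Proof. by move=> i; rewrite coef1; case: eqP; rewrite ?size_poly1 ?size_poly0. Qed.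

Lemma xdeg_leX n P k : xdeg_le n P -> xdeg_le (n * k) (P ^+ k).
Proof.
move=> c; elim: k => [|k IH]; first by rewrite expr0 muln0; apply: xdeg_le1.
by rewrite exprS mulnS; apply: xdeg_leM.
Qed.

Lemma xdeg_leC n (p : {poly F}) : (size p <= n.+1)%N -> xdeg_le n p%:P.
Proof. by move=> sp i; rewrite coefC; case: eqP; rewrite ?size_poly0. Qed.

Lemma xdeg_leXn k : xdeg_le 0 'X^k.
Proof. by move=> i; rewrite coefXn; case: eqP; rewrite ?size_poly1 ?size_poly0. Qed.

Lemma size_exp_le (p : {poly F}) n k : (size p <= n.+1)%N -> (size (p ^+ k) <= (n * k).+1)%N.
Proof.
move=> sp; apply: leq_trans (size_poly_exp_leq _ _) _; rewrite ltnS leq_mul2r.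
by apply/orP; right; move: sp; lia.
Qed.
End CoefDegree.

Section Dependence.
Variable F : finFieldType.
Lemma linear_dependence (T J : finType) (w : T -> J -> F) : (#|J| < #|T|)%N ->
  exists2 c : T -> F, exists t, c t != 0 & forall j, \sum_t c t * w t j = 0.
Proof.
move=> JT; pose phi (c : {ffun T -> F}) : {ffun J -> F} := [ffun j => \sum_t c t * w t j].
have : ~~ injectiveb phi.
  apply/negP => /injectiveP inj; have := leq_card phi inj.
  by rewrite !card_ffun leq_exp2l ?(finNzRing_gt1 F) // leqNgt JT.
case/injectivePn => x [y xy exy].
exists (fun t => x t - y t).
  apply: contrapT => no; case/eqP: xy; apply/ffunP => t; apply/eqP; rewrite -subr_eq0.
  by apply: contrapT => /negP h; apply: no; exists t.
move=> j; have := congr1 (fun f : {ffun J -> F} => f j) exy; rewrite !ffunE => e.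
by under eq_bigr do rewrite mulrBl; rewrite sumrB e subrr.
Qed.
End Dependence.

Section Reduction.
Variable F : finFieldType.
Local Notation q := #|F|.
Variables (D g : {poly F}) (m : nat).
Hypotheses (sD : (size D <= m)%N) (sg : (size g <= m.+1)%N).

(* The curve Y^q - Y = g / D, denominators cleared; Y is the outer variable. *)
Definition ASpoly : {poly {poly F}} := D%:P * ('X^q - 'X) - g%:P.

Let iota : {rmorphism F -> {poly {poly F}}} := polyC \o polyC.

(** Iterating Y^q = Y + g / D gives Y^(q^n) = Y + \sum_(i < n) (g / D)^(q^i); [tau] is this sum
    times D^(q^n). *)
Lemma cong_frobenius n : exists2 tau : {poly F}, (size tau <= (m * q ^ n).+1)%N &
  cong ASpoly ((D ^+ (q ^ n))%:P * ('X^(q ^ n) - 'X)) tau%:P.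
Proof.
elim: n => [|n [tau st ct]].
  by exists 0; rewrite ?size_poly0 // expn0 !expr1 subrr mulr0; apply: cong_refl.
have q0 : (0 < q ^ n.+1)%N by apply: card_expn_gt0.
exists (tau ^+ q + D ^+ (q ^ n.+1).-1 * g).
  apply: leq_trans (size_polyD _ _) _; rewrite geq_max; apply/andP; split.
    by rewrite expnSr mulnA; apply: size_exp_le.
  apply: leq_trans (size_polyMleq _ _) _.
  have sD' : (size D <= m.-1.+1)%N by apply: leq_trans sD (leqSpred _).
  have h1 := size_exp_le (q ^ n.+1).-1 sD'.
  have h2 : (m.-1 * (q ^ n.+1).-1 + m <= m * q ^ n.+1)%N by move: q0; case: (m) (q ^ n.+1)%N => [|m'] [|u] //=; nia.
  move: (size _) (size g) h1 h2 sg => x y; set v := (m.-1 * _)%N; lia.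
have -> : (D ^+ (q ^ n.+1))%:P * ('X^(q ^ n.+1) - 'X) =
   ((D ^+ (q ^ n))%:P * ('X^(q ^ n) - 'X)) ^+ q +
   (D ^+ (q ^ n.+1).-1)%:P * (D%:P * ('X^q - 'X)).
  have e1 := expr_cardB iota 1 'X^(q ^ n) 'X; rewrite expn1 in e1.
  rewrite exprMn e1 -rmorphXn /= -!exprM -!expnSr.
  rewrite [X in _ = _ + X]mulrA -rmorphM /= -exprSr prednK //.
  by ring.
rewrite polyCD polyCM [(tau ^+ q)%:P]rmorphXn /=; apply: congD; first exact: congX.
apply: congM; first exact: cong_refl.
by exists 1; rewrite /ASpoly mulr1.
Qed.

(** The shift by [a] is adapted to points of the extension of degree 2 n where g / D has trace a:
    there the q^n-th power of Y^(q^n) - a is Y. *)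
Definition ASmono (n i j1 j2 : nat) (a : F) : {poly {poly F}} :=
  ('X^i)%:P * ('X^j1 * ('X^(q ^ n) - a%:P%:P) ^+ j2).

(** Multiplied by D^(q^n), the factor Y^(q^n) - a becomes linear in Y ([ell]), so the degree in Y
    drops to at most j1 + j2 <= 2 q - 2. A single replacement of D Y^q by D Y + g, which costs the
    last factor D, brings it below q. *)
Lemma ASmono_reduction n j1 j2 (a : F) : (j1 < q)%N -> (j2 < q)%N ->
  exists R : {poly {poly F}}, [/\ (size R <= q)%N, xdeg_le (m * q ^ n * q + m) R &
    cong ASpoly ((D ^+ (q ^ n * q).+1)%:P * ('X^j1 * ('X^(q ^ n) - a%:P%:P) ^+ j2)) R].
Proof.
move=> h1 h2; have [tau st ct] := cong_frobenius n.
set B := (q ^ n)%N in st ct *.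
have B0 : (0 < B)%N by apply: card_expn_gt0.
have sD1 : (size D <= m.+1)%N by apply: leq_trans sD _.
pose ell : {poly {poly F}} := (D ^+ B)%:P * 'X + (tau - a *: D ^+ B)%:P.
have cell : cong ASpoly ((D ^+ B)%:P * ('X^B - a%:P%:P)) ell.
  case: ct => H e; exists H; rewrite -e /ell rmorphB /= -mul_polyC rmorphM /=.
  by ring.
have dell : xdeg_le (m * B) ell.
  apply: xdeg_leD.
    rewrite -[(m * B)%N]addn0; apply: xdeg_leM; last by rewrite -['X]expr1; apply: xdeg_leXn.
    by apply: xdeg_leC; apply: size_exp_le.
  apply: xdeg_leC; apply: leq_trans (size_polyD _ _) _; rewrite geq_max st size_polyN.
  by apply: leq_trans (size_scale_leq _ _) _; apply: size_exp_le.
have sell : (size ell <= 2)%N.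
  apply: leq_trans (size_polyD _ _) _; rewrite geq_max; apply/andP; split.
    apply: leq_trans (size_polyMleq _ _) _; rewrite size_polyX addn2 /=.
    by rewrite ltnS size_polyC leq_b1.
  by apply: leq_trans (size_polyC_leq1 _) _.
(* The first factor makes the total power of D independent of [j2], hence common to all
   monomials. *)
pose P : {poly {poly F}} := (D ^+ (B * (q - j2)))%:P * ('X^j1 * ell ^+ j2).
have sP : (size P <= q + q.-1)%N.
  apply: leq_trans (size_polyMleq _ _) _.
  have s1 : (size ((D ^+ (B * (q - j2)))%:P : {poly {poly F}})%R <= 1)%N by apply: size_polyC_leq1.
  have s2 : (size ('X^j1 * ell ^+ j2)%R <= j1 + j2 + 1)%N.
    apply: leq_trans (size_polyMleq _ _) _; rewrite size_polyXn.
    have := leq_trans (size_poly_exp_leq ell j2) (_ : _ <= j2.+1)%N; move=> h.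
    have : (size (ell ^+ j2)%R <= j2.+1)%N.
      by apply: h; rewrite ltnS -[X in (_ <= X)%N]mul1n leq_mul2r; apply/orP; right; lia.
    lia.
  by move: s1 s2 h1 h2; lia.
have dP : xdeg_le (m * B * q) P.
  have -> : (m * B * q = m * (B * (q - j2)) + (0 + m * B * j2))%N.
    by rewrite add0n mulnA -mulnDr subnK // ltnW.
  apply: xdeg_leM; first by apply: xdeg_leC; apply: size_exp_le.
  by apply: xdeg_leM; [apply: xdeg_leXn | apply: xdeg_leX].
have cP : cong ASpoly ((D ^+ (B * q))%:P * ('X^j1 * ('X^B - a%:P%:P) ^+ j2)) P.
  have -> : (D ^+ (B * q))%:P * ('X^j1 * ('X^B - a%:P%:P) ^+ j2) =
     (D ^+ (B * (q - j2)))%:P * ('X^j1 * ((D ^+ B)%:P * ('X^B - a%:P%:P)) ^+ j2).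
    have -> : (B * q = B * (q - j2) + B * j2)%N by rewrite -mulnDr subnK // ltnW.
    by rewrite exprD rmorphM /= exprMn [D ^+ (B * j2)]exprM [(D ^+ B ^+ j2)%:P]rmorphXn /=; ring.
  by apply: congM; [exact: cong_refl|apply: congM; [exact: cong_refl|exact: congX]].
pose lo := take_poly q P; pose hi := drop_poly q P.
have PE : P = lo + hi * 'X^q by rewrite poly_take_drop.
have shi : (size hi <= q.-1)%N by rewrite size_drop_poly leq_subLR.
have slo : (size lo <= q)%N by apply: size_take_poly.
have dlo : xdeg_le (m * B * q) lo.
  by move=> i; rewrite coef_take_poly; case: ifP => _; rewrite ?size_poly0.
have dhi : xdeg_le (m * B * q) hi by move=> i; rewrite coef_drop_poly.
exists (D%:P * lo + (D%:P * 'X + g%:P) * hi); split.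
- apply: leq_trans (size_polyD _ _) _; rewrite geq_max; apply/andP; split.
    by rewrite mul_polyC; apply: leq_trans (size_scale_leq _ _) slo.
  apply: leq_trans (size_polyMleq _ _) _.
  have aux x y : (x <= 2)%N -> (y <= q.-1)%N -> ((x + y).-1 <= q)%N.
    by have := card_field_gt1 F; lia.
  apply: aux => //.
    apply: leq_trans (size_polyD _ _) _; rewrite geq_max; apply/andP; split.
      apply: leq_trans (size_polyMleq _ _) _; rewrite size_polyX addn2 /=.
      by rewrite ltnS size_polyC leq_b1.
    by apply: leq_trans (size_polyC_leq1 _) _.
- rewrite addnC; apply: xdeg_leD; apply: xdeg_leM => //.
    by apply: xdeg_leC.
  apply: xdeg_leD; last exact: xdeg_leC.
  rewrite -[X in xdeg_le X]addn0; apply: xdeg_leM; first exact: xdeg_leC.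
  by rewrite -['X]expr1; apply: xdeg_leXn.
- have -> : (D ^+ (B * q).+1)%:P * ('X^j1 * ('X^B - a%:P%:P) ^+ j2)
      = D%:P * ((D ^+ (B * q))%:P * ('X^j1 * ('X^B - a%:P%:P) ^+ j2)).
    by rewrite exprS rmorphM /= mulrA.
  apply: cong_trans (congM (cong_refl _ _) cP) _.
  by exists hi; rewrite /ASpoly PE; ring.
Qed.
End Reduction.

Section LeadSum.
Variable A : idomainType.
Lemma lead_sum_distinct (T : finType) (c : T -> A) (w : T -> {poly A}) (e : T -> nat) :
  injective e -> (forall t, size (w t) = (e t).+1) -> (exists t, c t != 0) ->
  exists2 t, c t != 0 & lead_coef (\sum_t (c t)%:P * w t) = c t * lead_coef (w t).
Proof.
move=> inj_e sw [t0 ct0].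
case: (arg_maxnP (P := fun t => c t != 0) e ct0) => t ct tmax.
exists t => //; rewrite (bigD1 t) //= lead_coefDl ?lead_coefM ?lead_coefC //.
rewrite mul_polyC size_scale // sw ltnS; apply: leq_trans (size_sum _ _ _) _.
apply/bigmax_leqP => i it; rewrite mul_polyC.
have [->|ci] := eqVneq (c i) 0; first by rewrite scale0r size_poly0.
rewrite size_scale // sw ltn_neqAle (inj_eq inj_e) it /=; exact: tmax.
Qed.
End LeadSum.

(** * Pole orders at infinity *)

Section Weights.
Variable F : fieldType.
Variable q : nat.
Hypothesis q0 : (0 < q)%N.

Let CC : {rmorphism F -> {poly {poly F}}} := polyC \o polyC.
Let Xh : {poly {poly F}} := 'X%:P * 'X^q.

(* The substitution x = tau z^q, Y = z: the degree in z is the pole order at the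
   totally ramified point at infinity of Y^q - Y = g / D. *)
Definition weightx : {poly F} -> {poly {poly F}} := horner_eval Xh \o map_poly CC.
HB.instance Definition _ := GRing.RMorphism.copy weightx (horner_eval Xh \o map_poly CC).
Definition weight : {poly {poly F}} -> {poly {poly F}} :=
  horner_eval 'X \o map_poly weightx.
HB.instance Definition _ := GRing.RMorphism.copy weight (horner_eval 'X \o map_poly weightx).

Lemma weightC p : weight p%:P = weightx p.
Proof. by rewrite /weight /= map_polyC /horner_eval hornerC. Qed.
Lemma weightM P Q : weight (P * Q) = weight P * weight Q.
Proof. exact: rmorphM. Qed.
Lemma weightB P Q : weight (P - Q) = weight P - weight Q.
Proof. exact: rmorphB. Qed.
Lemma weight_exp P k : weight (P ^+ k) = weight P ^+ k.
Proof. exact: rmorphXn. Qed.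
Lemma weight_sum (I : Type) (s : seq I) (f : I -> {poly {poly F}}) :
  weight (\sum_(i <- s) f i) = \sum_(i <- s) weight (f i).
Proof. exact: rmorph_sum. Qed.
Lemma weightX : weight 'X = 'X.
Proof. by rewrite /weight /= map_polyX /horner_eval hornerX. Qed.
Lemma weightxX : weightx 'X = Xh.
Proof. by rewrite /weightx /= map_polyX /horner_eval hornerX. Qed.
Lemma weightxC a : weightx a%:P = a%:P%:P.
Proof. by rewrite /weightx /= map_polyC /horner_eval hornerC. Qed.

Lemma weightx_Xn i : weightx 'X^i = ('X^i)%:P * 'X^(q * i).
Proof. by rewrite rmorphXn /= weightxX /Xh exprMn -rmorphXn exprM. Qed.

Lemma coef_weightx p k : (weightx p)`_k = 
  \sum_(i < size p) (if k == (q * i)%N then p`_i *: 'X^i else 0).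
Proof.
rewrite {1}[p](esym (coefK p)) poly_def rmorph_sum coef_sum; apply: eq_bigr => i _.
rewrite -mul_polyC rmorphM /= weightxC weightx_Xn mulrA -polyCM coefCM coefXn mul_polyC.
by case: eqP; rewrite ?mulr1 ?mulr0.
Qed.

Lemma size_weightx p : p != 0 -> size (weightx p) = (q * (size p).-1).+1 /\
  lead_coef (weightx p) = lead_coef p *: 'X^((size p).-1).
Proof.
move=> p0; have sp : (0 < size p)%N by rewrite size_poly_gt0.
have ctop : (weightx p)`_(q * (size p).-1) = lead_coef p *: 'X^((size p).-1).
  have lt : ((size p).-1 < size p)%N by rewrite prednK.
  rewrite coef_weightx (bigD1 (Ordinal lt)) //= eqxx big1 ?addr0 // => i.
  by rewrite -val_eqE /= eqn_pmul2l // eq_sym => /negPf ->.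
have s1 : (size (weightx p) <= (q * (size p).-1).+1)%N.
  apply/leq_sizeP => j hj; rewrite coef_weightx big1 // => i _.
  case: eqP => // jE; have : (q * (size p).-1 < q * i)%N by rewrite -jE.
  rewrite ltn_pmul2l //; have := ltn_ord i; lia.
have s2 : size (weightx p) = (q * (size p).-1).+1.
  apply/eqP; rewrite eqn_leq s1 /= ltnNge; apply/negP => /leq_sizeP/(_ _ (leqnn _)).
  rewrite ctop => /eqP; rewrite scaler_eq0 lead_coef_eq0 (negPf p0) /=.
  by rewrite -size_poly_eq0 size_polyXn.
by split=> //; rewrite lead_coefE s2.
Qed.
End Weights.

Section NonVanishing.
Variable F : finFieldType.
Local Notation q := #|F|.
Variables (D g : {poly F}).
Hypotheses (D0 : D != 0) (sDg : size g = (size D).+1).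

(* The terms have distinct pole orders at infinity, so the leading coefficient of
   the weight of the sum is a monomial in tau, whereas that of ASpoly vanishes
   at tau = lead_coef D / lead_coef g. *)
Lemma ASmono_nonzero n (M N : nat) (a : F) (c : 'I_(q ^ n.+1) * 'I_M -> F) :
  (exists t, c t != 0) ->
  ~ cong (ASpoly D g) ((D ^+ N)%:P * \sum_t (c t)%:P%:P *
     ASmono n.+1 (t.1 %/ q + q ^ n.+1 * (t.2 %/ q)) (t.1 %% q) (t.2 %% q) a) 0.
Proof.
move=> c0 [H]; rewrite subr0 => eH.
set B := (q ^ n.+1)%N in c c0 eH.
have q0 : (0 < q)%N := ltnW (card_field_gt1 F).
have B0 : (0 < B)%N by apply: card_expn_gt0.
have g0 : g != 0 by rewrite -size_poly_eq0 sDg.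
pose W := @weight F q.
have [sWD lWD] := size_weightx q0 D0; have [sWg lWg] := size_weightx q0 g0.
rewrite sDg /= in sWg lWg.
set d := (size D).-1 in sWD lWD.
have sDd : size D = d.+1 by rewrite prednK // size_poly_gt0.
rewrite sDd in sWg lWg.
pose tau0 := lead_coef D / lead_coef g.
have lD0 : lead_coef D != 0 by rewrite lead_coef_eq0.
have lg0 : lead_coef g != 0 by rewrite lead_coef_eq0.
have t0 : tau0 != 0 by rewrite mulf_neq0 ?invr_eq0.
have WPhi : W (ASpoly D g) = weightx q D * ('X^q - 'X) - weightx q g.
  by rewrite /W /ASpoly weightB weightM weightB weight_exp !weightX weightC weightC.
have q1 : (1 < q)%N := card_field_gt1 F.
have lPhi : lead_coef (W (ASpoly D g)) = lead_coef D *: 'X^d - lead_coef g *: 'X^(d.+1).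
  have WD0 : weightx q D != 0 by rewrite -size_poly_eq0 sWD.
  have sXX : size ('X^q - 'X : {poly {poly F}}) = q.+1.
    by rewrite size_polyDl size_polyXn // size_polyN size_polyX.
  have lXX : lead_coef ('X^q - 'X : {poly {poly F}}) = 1.
    by rewrite lead_coefDl ?lead_coefXn // size_polyN size_polyX size_polyXn.
  have XX0 : 'X^q - 'X != 0 :> {poly {poly F}} by rewrite -size_poly_eq0 sXX.
  have s1 : size (weightx q D * ('X^q - 'X)) = (q * d.+1).+1.
    by rewrite size_mul // sWD sXX addnS /= addSn mulnS addnC.
  have c1 : (weightx q D * ('X^q - 'X))`_(q * d.+1) = lead_coef D *: 'X^d.
    by rewrite -[(q * d.+1)%N]/((q * d.+1).+1.-1) -s1 -lead_coefE lead_coefM lWD lXX mulr1.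
  have c2 : (weightx q g)`_(q * d.+1) = lead_coef g *: 'X^(d.+1).
    by rewrite -[(q * d.+1)%N]/((q * d.+1).+1.-1) -sWg -lead_coefE lWg.
  have ctop : (W (ASpoly D g))`_(q * d.+1) = lead_coef D *: 'X^d - lead_coef g *: 'X^(d.+1).
    by rewrite WPhi coefB c1 c2.
  have nz : lead_coef D *: 'X^d - lead_coef g *: 'X^(d.+1) != 0 :> {poly F}.
    apply/negP => /eqP/(congr1 (fun p : {poly F} => p`_d)).
    rewrite coefB !coefZ !coefXn eqxx (ltn_eqF (ltnSn d)) mulr1 mulr0 subr0 coef0.
    by apply/eqP.
  have s2 : size (W (ASpoly D g)) = (q * d.+1).+1.
    apply/eqP; rewrite eqn_leq; apply/andP; split.
      rewrite WPhi; apply: leq_trans (size_polyD _ _) _.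
      by rewrite geq_max s1 size_polyN sWg leqnn.
    rewrite ltnNge; apply/negP => /leq_sizeP/(_ _ (leqnn _)); rewrite ctop.
    by apply/eqP.
  by rewrite lead_coefE s2.
(* The pole order at infinity of the term of index [t]: with x of order q and Y of order 1 it is q i
   + j1 + B j2, and the splitting of [t.1] and [t.2] by q collapses it to t.1 + B t.2. It is
   injective because t.1 < B. *)
pose e (t : 'I_B * 'I_M) := (t.1 + B * t.2)%N.
have einj : injective e.
  move=> [x1 x2] [y1 y2]; rewrite /e /= => exy.
  have h1 : (x1 : nat) = y1.
    have := congr1 (fun u => u %% B)%N exy.
    by rewrite ![(B * _)%N]mulnC ![(_ + _ * B)%N]addnC !modnMDl !modn_small.
  have h2 : (x2 : nat) = y2.
    by move/eqP: exy; rewrite h1 eqn_add2l eqn_pmul2l // => /eqP.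
  by congr (_, _); apply: val_inj.
pose idx (t : 'I_B * 'I_M) := (t.1 %/ q + B * (t.2 %/ q))%N.
pose w (t : 'I_B * 'I_M) := W (ASmono n.+1 (idx t) (t.1 %% q) (t.2 %% q) a).
have wE t : w t = ('X^(idx t))%:P *
   ('X^(q * idx t + t.1 %% q) * ('X^B - a%:P%:P) ^+ (t.2 %% q)).
  rewrite /w /ASmono /W weightM weightC weightM weight_exp weightX weight_exp weightB weight_exp weightX weightC.
  by rewrite weightx_Xn weightxC exprD !mulrA.
have mXB : ('X^B - a%:P%:P : {poly {poly F}}) \is monic by apply: monicXnsubC.
have sXB k : size (('X^B - a%:P%:P : {poly {poly F}}) ^+ k) = (B * k).+1.
  elim: k => [|k IH]; first by rewrite expr0 size_poly1 muln0.
  rewrite exprS size_monicM ?monic_neq0 ?monic_exp // IH size_XnsubC // mulnS addnS.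
  by rewrite addSn.
have sw t : size (w t) = (e t).+1.
  rewrite wE mul_polyC size_scale; last by rewrite -size_poly_eq0 size_polyXn.
  rewrite size_monicM ?monicXn ?monic_neq0 ?monic_exp // size_polyXn sXB addnS addSn /=.
  rewrite /e /idx [in RHS](divn_eq t.1 q) [in RHS](divn_eq t.2 q); congr (_.+1).
  by rewrite !mulnDr; ring.
have lw t : lead_coef (w t) = 'X^(idx t).
  rewrite wE lead_coefM lead_coefC lead_coef_monicM ?monicXn //.
  by rewrite (eqP (monic_exp _ mXB)) mulr1.
have cC0 : exists t, (c t)%:P != 0 by case: c0 => t ct; exists t; rewrite polyC_eq0.
have [t ct lt] := lead_sum_distinct einj sw cC0.
have WG : W (\sum_t (c t)%:P%:P * ASmono n.+1 (idx t) (t.1 %% q) (t.2 %% q) a) =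
    \sum_t ((c t)%:P)%:P * w t.
  rewrite /W weight_sum; apply: eq_bigr => u _.
  by rewrite weightM weightC weightxC.
have := congr1 (fun P => (lead_coef (W P)).[tau0]) eH.
rewrite /W !weightM weightC -/W WG !lead_coefM lt lw rmorphXn /= lead_coef_exp lWD lPhi.
rewrite !hornerM horner_exp !(hornerZ, hornerD, hornerN, hornerXn, hornerC).
have -> : lead_coef D * tau0 ^+ d - lead_coef g * tau0 ^+ d.+1 = 0.
  have -> : lead_coef D = tau0 * lead_coef g by rewrite /tau0 divfK.
  by rewrite exprS; ring.
rewrite mul0r => /eqP; apply/negP.
have ct' : c t != 0 by rewrite -polyC_eq0.
have tk k : tau0 ^+ k != 0 by rewrite expf_neq0.
by apply: mulf_neq0; [rewrite expf_neq0 // mulf_neq0|apply: mulf_neq0].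
Qed.
End NonVanishing.

(** * The fibre of the curve over one point *)

Section Pointwise.
Variables (F : finFieldType) (L : fieldType) (iota : {rmorphism F -> L}).
Local Notation q := #|F|.
Variables (D g : {poly F}) (z : L) (n : nat) (a : F).
Hypothesis D0 : (map_poly iota D).[z] != 0.
Hypothesis zQ : z ^+ (q ^ (n + n)) = z.
Let f := (map_poly iota g).[z] / (map_poly iota D).[z].
Hypothesis traceA : \sum_(i < n + n) f ^+ (q ^ i) = iota a.

Let ev : {rmorphism {poly F} -> L} := horner_eval z \o map_poly iota.
Let evY : {rmorphism {poly {poly F}} -> {poly L}} := map_poly ev.
Let h : {poly L} := 'X^q - 'X - f%:P.
Let CL : {rmorphism F -> {poly L}} := polyC \o iota.
Let CC : {rmorphism F -> {poly {poly F}}} := polyC \o polyC.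

Lemma cong_AS P Q : cong (ASpoly D g) P Q -> cong h (evY P) (evY Q).
Proof.
case=> H e; exists ((ev D)%:P * evY H).
rewrite -rmorphB e rmorphM /= mulrA; congr (_ * _).
rewrite /ASpoly rmorphB rmorphM rmorphB /= map_polyXn map_polyX !map_polyC /=.
have -> : horner_eval z (map_poly iota g) = f * horner_eval z (map_poly iota D).
  by rewrite /horner_eval /f divfK.
by rewrite polyCM /h; ring.
Qed.

(** The iteration of Y^q = Y + f at one point; at i = n + n the added constant is the trace [a]. *)
Lemma cong_Xcard i : cong h 'X^(q ^ i) ('X + (\sum_(j < i) f ^+ (q ^ j))%:P).
Proof.
elim: i => [|i [u IH]]; first by rewrite big_ord0 addr0 expr1; apply: cong_refl.
have e1 : 'X^(q ^ i.+1) - 'X^q - ((\sum_(j < i) f ^+ (q ^ j)) ^+ q)%:P = h ^+ q * u ^+ q.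
  rewrite -exprMn -IH opprD addrA -[X in _ = _ ^+ X]expn1 !(expr_cardB CL) expn1.
  by rewrite -exprM -expnSr -rmorphXn.
have e2 : (\sum_(j < i) f ^+ (q ^ j)) ^+ q + f = \sum_(j < i.+1) f ^+ (q ^ j).
  rewrite big_ord_recl expr1 addrC; congr (_ + _).
  rewrite -[X in _ ^+ X = _]expn1 (expr_card_sum iota); apply: eq_bigr => j _.
  by rewrite (exprM_card F) addn1.
exists (h ^+ q.-1 * u ^+ q + 1).
have -> : h * (h ^+ q.-1 * u ^+ q + 1) = h ^+ q * u ^+ q + h.
  by rewrite mulrDr mulrA -exprS prednK ?mulr1 // (ltnW (card_field_gt1 F)).
by rewrite -e1 -e2 /h polyCD; ring.
Qed.

Lemma cong_comp (p x y : {poly L}) : cong h x y -> cong h (p \Po x) (p \Po y).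
Proof.
move=> c; rewrite !comp_polyE; apply: cong_sum => i _; rewrite -!mul_polyC.
by apply: congM; [exact: cong_refl | exact: congX].
Qed.

(* Modulo h, r^Q is r (Y + a) for Q = q^(2 n), and h (Y - a) = h. *)
Lemma cong_of_power (r : {poly L}) : (forall k, r`_k ^+ (q ^ (n + n)) = r`_k) ->
  cong h (r ^+ (q ^ (n + n))) 0 -> cong h r 0.
Proof.
move=> rk c1.
have rE : r ^+ (q ^ (n + n)) = r \Po 'X^(q ^ (n + n)).
  rewrite comp_polyE -{1}(coefK r) poly_def (expr_card_sum CL); apply: eq_bigr => k _.
  by rewrite exprZn rk -!exprM mulnC.
have [u uE] : cong h (r \Po ('X + (iota a)%:P)) 0.
  rewrite -traceA; apply: cong_trans (cong_comp r (cong_sym (cong_Xcard _))) _.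
  by rewrite -rE.
rewrite subr0 in uE.
have := congr1 (fun p => p \Po ('X - (iota a)%:P)) uE.
rewrite -comp_polyA comp_polyD comp_polyX comp_polyC subrK comp_polyXr rmorphM /=.
have -> : h \Po ('X - (iota a)%:P) = h.
  rewrite /h !rmorphB /= comp_polyX comp_polyC comp_Xn_poly.
  have e := expr_cardB CL 1 'X (iota a)%:P; rewrite expn1 in e.
  by rewrite e -rmorphXn /= -rmorphXn expf_card; ring.
by move=> ->; exists (u \Po ('X - (iota a)%:P)); rewrite subr0.
Qed.

Lemma size_AS_fiber : size h = q.+1.
Proof.
have q1 := card_field_gt1 F.
rewrite /h -addrA size_polyDl size_polyXn //.
apply: leq_ltn_trans (size_polyD _ _) _; rewrite gtn_max !size_polyN size_polyX.
by rewrite !ltnS q1 (leq_trans (size_polyC_leq1 _)) // ltnW.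
Qed.

(** On the fibre over [z] the q^n-th power of the second sum is the first, because z^(q^(2 n)) = z
    and Y^(q^(2 n)) - a = Y; so both vanish modulo [h]. Then [R] evaluated at [z] is divisible by
    [h], of degree q in Y, while its own degree is smaller: all its coefficients vanish at [z]. *)
Lemma AS_reduction_vanishes (T : finType) (c : T -> F) (i1 i2 j1 j2 : T -> nat) (N : nat)
    (R : {poly {poly F}}) :
  cong (ASpoly D g) ((D ^+ N)%:P * \sum_t (c t)%:P%:P *
     ASmono n (q ^ n * i1 t + i2 t) (j2 t) (j1 t) 0) 0 ->
  cong (ASpoly D g) ((D ^+ N)%:P * \sum_t (c t)%:P%:P *
     ASmono n (i1 t + q ^ n * i2 t) (j1 t) (j2 t) a) R ->
  (size R <= q)%N -> forall j, (map_poly iota R`_j).[z] = 0.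
Proof.
move=> cH cG sR.
pose G := \sum_t (c t)%:P%:P * ASmono n (i1 t + q ^ n * i2 t) (j1 t) (j2 t) a.
pose H := \sum_t (c t)%:P%:P * ASmono n (q ^ n * i1 t + i2 t) (j2 t) (j1 t) 0.
have cH' : cong h (evY H) 0.
  have [u e] := cong_AS cH; rewrite -/H rmorphM rmorph0 subr0 in e.
  have dE : evY (D ^+ N)%:P = (ev (D ^+ N))%:P := map_polyC _ _.
  have d0 : ev (D ^+ N) != 0 by rewrite rmorphXn expf_neq0.
  exists ((ev (D ^+ N))^-1%:P * u); rewrite subr0 mulrCA -e dE mulrA -polyCM mulVf //.
  by rewrite mul1r.
have eX k : evY 'X^k = 'X^k by exact: map_polyXn.
have eC p : evY p%:P = (ev p)%:P by exact: map_polyC.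
have vX k : ev 'X^k = z ^+ k.
  by rewrite rmorphXn /= map_polyX /horner_eval hornerX.
have vC b : ev b%:P = iota b by rewrite /= map_polyC /horner_eval hornerC.
have eM i k1 k2 b : evY (ASmono n i k1 k2 b) =
    (z ^+ i)%:P * ('X^k1 * ('X^(q ^ n) - (iota b)%:P) ^+ k2).
  rewrite /ASmono (rmorphM evY) (rmorphM evY) eC vX eX (rmorphXn evY) (rmorphB evY).
  by rewrite eX eC vC.
have cGH : cong h (evY G ^+ (q ^ n)) (evY H).
  have eT t i k1 k2 b : evY ((c t)%:P%:P * ASmono n i k1 k2 b) =
      (iota (c t))%:P * ((z ^+ i)%:P * ('X^k1 * ('X^(q ^ n) - (iota b)%:P) ^+ k2)).
    by rewrite (rmorphM evY) eM eC vC.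
  rewrite /G /H (rmorph_sum evY) (rmorph_sum evY) (expr_card_sum CL).
  under eq_bigr do rewrite eT; under [X in cong _ _ X]eq_bigr do rewrite eT.
  apply: cong_sum => t _; rewrite exprMn; apply: congM.
    by rewrite -!rmorphXn fixed_card; apply: cong_refl.
  rewrite !exprMn; apply: congM.
    rewrite -rmorphXn /= -exprM mulnDl mulnAC -expnD exprD.
    have -> : z ^+ (q ^ (n + n) * i2 t) = z ^+ i2 t by rewrite exprM zQ.
    by rewrite -exprD [(i1 t * _)%N]mulnC; apply: cong_refl.
  rewrite mulrC; apply: congM.
    rewrite -exprM mulnC exprM; apply: congX.
    rewrite (expr_cardB CL) -exprM -expnD -!rmorphXn fixed_card /=.
    by have [u uE] := cong_Xcard (n + n); exists u; rewrite -uE traceA; ring.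
  by rewrite rmorph0 subr0 -!exprM mulnC; apply: cong_refl.
have cr : cong h (evY G) 0.
  apply: cong_of_power => [k|].
    by rewrite coef_map /= /ev /= /horner_eval horner_expr_card zQ.
  rewrite expnD exprM.
  have := congX (q ^ n) (cong_trans cGH cH').
  by rewrite expr0n eqn0Ngt (card_expn_gt0 F).
have [u uE] : cong h (evY R) 0.
  apply: cong_trans (cong_sym (cong_AS cG)) _; rewrite -/G rmorphM.
  by have := congM (cong_refl h (evY (D ^+ N)%:P)) cr; rewrite mulr0.
rewrite subr0 in uE.
have R0 : evY R = 0.
  apply/eqP; apply: contraTT sR => nz; rewrite -ltnNge.
  have : (size (evY R) <= size R)%N by apply: size_poly.
  apply: leq_trans; rewrite uE size_mul; last 2 first.
  - by rewrite -size_poly_eq0 size_AS_fiber.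
  - by apply: contraNneq nz => u0; rewrite uE u0 mulr0.
  rewrite size_AS_fiber addSn /= -[X in (X < _)%N]addn0 ltn_add2l size_poly_gt0.
  by apply: contraNneq nz => u0; rewrite uE u0 mulr0.
by move=> j; have := congr1 (fun p : {poly L} => p`_j) R0; rewrite coef_map coef0.
Qed.
End Pointwise.

(** Fewer equations than unknowns, after cancelling a factor q, with B = q u. Here c' = 2 k for k =
    m (q + 1): of the B c' additional unknowns one half, B k, covers the degree m B q + m caused by
    the reduction, and the other half covers [c'] itself. *)
Lemma stepanov_numeric (q u m : nat) (c' := (2 * m * q.+1)%N) :
  (1 < q)%N -> (0 < u)%N -> (0 < m)%N ->
  ((q * u * u.-1 + (u + c').-1 + (m * (q * u) * q + m)).+1 < q * u * (u + c'))%N.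
Proof.
move=> q1; case: u => [//|v] _ m0; rewrite addSn /=; set B := (q * v.+1)%N.
have hB : (v.+1 < B)%N by rewrite /B ltn_Pmull.
pose k := (m * q.+1)%N.
have -> : c' = (2 * k)%N by rewrite /k mulnA.
have h1 : (2 * k <= B * k)%N by rewrite leq_mul2r (leq_trans _ hB) ?orbT.
have h2 : (B * k = m * B * q + m * B)%N by rewrite /k mulnCA mulnA mulnS addnC.
have h3 : (m <= m * B)%N by rewrite leq_pmulr // (leq_trans _ hB).
rewrite mulnS mulnDr [(B * (2 * k))%N]mulnCA; move: B hB h1 h2 h3 => B; lia.
Qed.

(** * The auxiliary function and the point count *)

Section Stepanov.
Variable F : finFieldType.
Local Notation q := #|F|.
Variables (D g : {poly F}).
Hypotheses (D0 : D != 0) (sDg : size g = (size D).+1).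

(* The c are found by counting: there are B * M of them, and the reduced form of
   the first sum has fewer coefficients. The second sum is, at the points of trace
   a, the B-th root of the first one. *)
Lemma auxiliary_polynomial (n : nat) (a : F) (m := size D) (B := (q ^ n.+1)%N) (c' := (2 * m * q.+1)%N)
   (M := (q * (q ^ n + c'))%N) :
  exists (c : 'I_B * 'I_M -> F) (R : {poly {poly F}}) (N : nat),
  [/\ cong (ASpoly D g) ((D ^+ N)%:P * \sum_t (c t)%:P%:P *
     ASmono n.+1 (B * (t.1 %/ q) + t.2 %/ q) (t.2 %% q) (t.1 %% q) 0) 0,
  cong (ASpoly D g) ((D ^+ N)%:P * \sum_t (c t)%:P%:P *
     ASmono n.+1 (t.1 %/ q + B * (t.2 %/ q)) (t.1 %% q) (t.2 %% q) a) R,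
  (size R <= q)%N, R != 0 & xdeg_le (B * q ^ n + B * (c' + m * q + m)) R].
Proof.
have q1 := card_field_gt1 F.
have q0 : (0 < q)%N := ltnW q1.
have m0 : (0 < m)%N by rewrite size_poly_gt0.
have qn0 : (0 < q ^ n)%N := card_expn_gt0 F n.
have BE : B = (q * q ^ n)%N by rewrite /B expnS.
have sD : (size D <= m)%N by [].
have sg : (size g <= m.+1)%N by rewrite sDg.
have md x : (x %% q < q)%N by rewrite ltn_mod.
have [R1 R1P] := choice (fun t : 'I_B * 'I_M => ASmono_reduction sD sg n.+1 0 (md t.2) (md t.1)).
have [R2 R2P] := choice (fun t : 'I_B * 'I_M => ASmono_reduction sD sg n.+1 a (md t.1) (md t.2)).
pose N := (B * q).+1.
have congR (c : 'I_B * 'I_M -> F) (i j1 j2 : 'I_B * 'I_M -> nat) b (S : _ -> {poly {poly F}}) :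
   (forall t, cong (ASpoly D g) ((D ^+ N)%:P * ('X^(j1 t) * ('X^B - b%:P%:P) ^+ j2 t)) (S t)) ->
   cong (ASpoly D g) ((D ^+ N)%:P * \sum_t (c t)%:P%:P * ASmono n.+1 (i t) (j1 t) (j2 t) b)
     (\sum_t (c t)%:P%:P * (('X^(i t))%:P * S t)).
  move=> cS; rewrite mulr_sumr; apply: cong_sum => t _.
  have -> : (D ^+ N)%:P * ((c t)%:P%:P * ASmono n.+1 (i t) (j1 t) (j2 t) b)
     = (c t)%:P%:P * (('X^(i t))%:P * ((D ^+ N)%:P * ('X^(j1 t) * ('X^B - b%:P%:P) ^+ j2 t))).
    by rewrite /ASmono -/B; ring.
  by apply: congM; [exact: cong_refl|apply: congM; [exact: cong_refl|]].
have sizeR (c : 'I_B * 'I_M -> F) (i : 'I_B * 'I_M -> nat) (S : _ -> {poly {poly F}}) :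
   (forall t, (size (S t) <= q)%N) ->
   (size (\sum_t (c t)%:P%:P * (('X^(i t))%:P * S t))%R <= q)%N.
  move=> sS; apply: leq_trans (size_sum _ _ _) _; apply/bigmax_leqP => t _.
  rewrite !mul_polyC; apply: leq_trans (size_scale_leq _ _) _.
  by apply: leq_trans (size_scale_leq _ _) _.
have xdegR (c : 'I_B * 'I_M -> F) (i : 'I_B * 'I_M -> nat) (S : _ -> {poly {poly F}}) e :
   (forall t, xdeg_le (m * B * q + m) (S t)) -> (forall t, (i t <= e)%N) ->
   xdeg_le (e + (m * B * q + m)) (\sum_t (c t)%:P%:P * (('X^(i t))%:P * S t))%R.
  move=> dS ie; apply: xdeg_le_sum => t; rewrite -[X in xdeg_le X]add0n; apply: xdeg_leM.
    by apply: xdeg_leC; apply: size_polyC_leq1.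
  by apply: xdeg_leM => //; apply: xdeg_leC; rewrite size_polyXn ltnS.
(* Each of [t.1] and [t.2] encodes a pair of exponents, its quotient by q for X and its remainder
   for Y. Passing from [i2] to [i1] interchanges which of the two is multiplied by B, as raising to
   the B-th power does when x^(B B) = x. *)
pose i1 (t : 'I_B * 'I_M) := (B * (t.1 %/ q) + t.2 %/ q)%N.
pose i2 (t : 'I_B * 'I_M) := (t.1 %/ q + B * (t.2 %/ q))%N.
have d1 (t : 'I_B * 'I_M) : (t.1 %/ q <= (q ^ n).-1)%N.
  by rewrite -ltnS prednK // ltn_divLR // mulnC -BE.
have d2 (t : 'I_B * 'I_M) : (t.2 %/ q <= (q ^ n + c').-1)%N.
  by rewrite -ltnS prednK ?addn_gt0 ?qn0 // ltn_divLR // mulnC.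
pose e1 := (B * (q ^ n).-1 + (q ^ n + c').-1)%N.
have ie1 t : (i1 t <= e1)%N by rewrite leq_add ?leq_mul2l ?d1 ?d2 ?orbT.
pose Om := (e1 + (m * B * q + m)).+1.
have card_lt : (#|{: 'I_q * 'I_Om}| < #|{: 'I_B * 'I_M}|)%N.
  rewrite !card_prod !card_ord /M /Om /e1 -(mulnCA q) ltn_pmul2l //.
  by rewrite BE; apply: stepanov_numeric.
have [c c0 cP] := linear_dependence
   (fun t (jk : 'I_q * 'I_Om) => (('X^(i1 t))%:P * R1 t)`_(jk.1)`_(jk.2)) card_lt.
exists c, (\sum_t (c t)%:P%:P * (('X^(i2 t))%:P * R2 t)), N.
have c1 : cong (ASpoly D g) ((D ^+ N)%:P * \sum_t (c t)%:P%:P *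
     ASmono n.+1 (B * (t.1 %/ q) + t.2 %/ q) (t.2 %% q) (t.1 %% q) 0) 0.
  have z0 : \sum_t (c t)%:P%:P * (('X^(i1 t))%:P * R1 t) = 0.
    apply/polyP => j; rewrite coef0; apply/polyP => k; rewrite coef0.
    have [jq|qj] := ltnP j q; last first.
      suff -> : (\sum_t (c t)%:P%:P * (('X^(i1 t))%:P * R1 t))`_j = 0 by rewrite coef0.
      apply: nth_default; apply: leq_trans qj; apply: sizeR => t.
      by have [] := R1P t.
    have [kO|Ok] := ltnP k Om; last first.
      apply: nth_default; apply: leq_trans Ok; apply: xdegR => // t.
      by have [_ + _] := R1P t.
    transitivity (\sum_t c t * (('X^(i1 t))%:P * R1 t)`_j`_k); last first.
      exact: cP (Ordinal jq, Ordinal kO).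
    by rewrite coef_sum coef_sum; apply: eq_bigr => t _; rewrite !coefCM.
  by rewrite -[X in cong _ _ X]z0; apply: congR => t; have [_ _] := R1P t.
have c2 : cong (ASpoly D g) ((D ^+ N)%:P * \sum_t (c t)%:P%:P *
     ASmono n.+1 (t.1 %/ q + B * (t.2 %/ q)) (t.1 %% q) (t.2 %% q) a)
     (\sum_t (c t)%:P%:P * (('X^(i2 t))%:P * R2 t)).
  by apply: congR => t; have [_ _] := R2P t.
split=> //.
- by apply: sizeR => t; have [] := R2P t.
- by apply/eqP => R0; rewrite R0 in c2; apply: ASmono_nonzero c0 c2.
- pose e2 := ((q ^ n).-1 + B * (q ^ n + c').-1)%N.
  have ie2 t : (i2 t <= e2)%N by rewrite leq_add ?leq_mul2l ?d1 ?d2 ?orbT.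
  apply: (@xdeg_leW _ (e2 + (m * B * q + m))); last first.
    by apply: xdegR => // t; have [_ + _] := R2P t.
  have hB : (q ^ n <= B)%N by rewrite BE leq_pmull.
  have hB2 : (m <= B * m)%N by rewrite leq_pmull // BE muln_gt0 q0.
  have h3 : (B * (q ^ n + c').-1 + B = B * q ^ n + B * c')%N.
    by rewrite -mulnSr prednK ?addn_gt0 ?qn0 // mulnDr.
  have h4 : (m * B * q = B * (m * q))%N by rewrite mulnAC mulnC.
  by rewrite /e2 !mulnDr h4; lia.
Qed.

(** Every [W] of the list divides one fixed nonzero coefficient of [R], whose degree bounds the sum.
    With Q = q^(2 n + 2) the main term is Q / q, the expected number of points of trace a, and the
    error is O(sqrt Q). The trace condition ranges over all extensions because the one that is used
    is adjoined to [F] for each [W] separately. *)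
Theorem stepanov : exists K, forall n (a : F) (s : seq {poly F}), uniq s ->
  (forall W, W \in s -> exists2 d, W \in irrs F d & [/\ (d %| n.+1 + n.+1)%N, ~~ (W %| D) &
     forall (L : fieldExtType F) (z : L), root (map_poly (in_alg L) W) z ->
     \sum_(i < n.+1 + n.+1) ((map_poly (in_alg L) g).[z] / (map_poly (in_alg L) D).[z]) ^+ (q ^ i)
       = in_alg L a]) ->
  (\sum_(W <- s) (size W).-1 <= q ^ n.+1 * q ^ n + K * q ^ n.+1)%N.
Proof.
set m := size D; exists (2 * m * q.+1 + m * q + m)%N => n a s us sP.
have [c [R [N [c1 c2 sR R0 dR]]]] := auxiliary_polynomial n a.
have [j Rj] : exists j, R`_j != 0.
  by exists (size R).-1; rewrite -lead_coefE lead_coef_eq0.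
apply: (@leq_trans (size (R`_j)%R).-1); last first.
  have := dR j; rewrite -/m; set X := (_ * (2 * m * q.+1 + m * q + m))%N.
  have -> : ((2 * m * q.+1 + m * q + m) * q ^ n.+1 = X)%N by rewrite /X mulnC.
  by rewrite -subn1 leq_subLR add1n.
apply: sum_irr_degrees => // W Ws.
have [d Wd [dn WD tr]] := sP W Ws; exists d => //.
have [iW _] := mem_irrs Wd.
have [L dimL [z rz _]] := irredp_FAdjoin iW.
rewrite -(irr_dvd _ Wd rz); apply/rootP.
have Dz : (map_poly (in_alg L) D).[z] != 0.
  by rewrite -rootE (irr_dvd _ Wd rz).
have zQ : z ^+ (q ^ (n.+1 + n.+1)) = z.
  have [_ zd] := irr_conjugates Wd rz; case/dvdnP: dn => k ->.
  elim: k => [|k IH]; first by rewrite expr1.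
  by rewrite mulSn -(exprM_card F) zd.
exact: (AS_reduction_vanishes Dz zQ (tr L z rz) c1 c2 sR j).
Qed.
End Stepanov.

(** * Weil's bound *)

Section LogDerivative.
Variable K : fieldType.

Lemma deriv_prod_XsubC (s : seq K) (y : K) : y \notin s ->
  (\prod_(x <- s) ('X - x%:P))^`().[y] =
  (\prod_(x <- s) ('X - x%:P)).[y] * \sum_(x <- s) (y - x)^-1.
Proof.
elim: s => [|x s IH]; first by rewrite !big_nil derivC horner0 mulr0.
rewrite inE negb_or => /andP[yx ys]; rewrite !big_cons derivM derivXsubC mul1r.
rewrite hornerD !hornerM IH // hornerXsubC.
have ne : y - x != 0 by rewrite subr_eq0.
by field.
Qed.

(* The coefficient of 'X^(n - 1) in P of degree n; the factor 'X makes it 0 for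
   P = 1. *)
Definition nextcoef (P : {poly K}) := ('X * P)`_(size P).-1.

Lemma nextcoefM (P Q : {poly K}) : P \is monic -> Q \is monic ->
  nextcoef (P * Q) = nextcoef P + nextcoef Q.
Proof.
move=> mP mQ; rewrite /nextcoef size_Mmonic ?monic_neq0 //.
have sP : (0 < size P)%N by rewrite size_poly_gt0 monic_neq0.
have sQ : (0 < size Q)%N by rewrite size_poly_gt0 monic_neq0.
set n := (size P).-1; set m := (size Q).-1.
have nE : size P = n.+1 by rewrite prednK.
have mE : size Q = m.+1 by rewrite prednK.
have -> : (size P + size Q).-2 = (n + m)%N by rewrite nE mE addSn addnS.
have lP : P`_n = 1 by rewrite -(eqP mP) lead_coefE.
have lQ : Q`_m = 1 by rewrite -(eqP mQ) lead_coefE.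
rewrite mulrA coefM.
have h1 : (n < (n + m).+1)%N by rewrite ltnS leq_addr.
rewrite (bigD1 (Ordinal h1)) //= addKn lQ mulr1; congr (_ + _).
case: m mE lQ h1 => [|m] mE lQ h1.
  rewrite coefXM /= big1 // => i /eqP ne; rewrite [X in _ * X]nth_default ?mulr0 //.
  rewrite mE; have := ltn_ord i; have : (i : nat) <> n by move=> e; apply: ne; apply: val_inj.
  by move: (nat_of_ord i) => u; lia.
have h2 : (n.+1 < (n + m.+1).+1)%N by rewrite ltnS addnS ltnS leq_addr.
rewrite (bigD1 (Ordinal h2)) /=; last by rewrite -val_eqE /= neq_ltn ltnSn orbT.
have -> : (n + m.+1 - n.+1 = m)%N by rewrite addnS subSS addKn.
rewrite big1 ?addr0; first by rewrite !coefXM /= lP mul1r.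
move=> i /andP[/eqP ne1 /eqP ne2].
have i1 : (i : nat) <> n by move=> e; apply: ne1; apply: val_inj.
have i2 : (i : nat) <> n.+1 by move=> e; apply: ne2; apply: val_inj.
have [lt|gt] := leqP i n.
  rewrite [X in _ * X]nth_default ?mulr0 // mE; lia.
rewrite [X in X * _]nth_default ?mul0r //.
apply: leq_trans (size_polyMleq _ _) _; rewrite size_polyX nE; lia.
Qed.

Lemma nextcoef_prod (s : seq K) : nextcoef (\prod_(x <- s) ('X - x%:P)) = - \sum_(x <- s) x.
Proof.
elim: s => [|x s IH].
  by rewrite !big_nil /nextcoef size_poly1 coefXM oppr0.
rewrite !big_cons nextcoefM ?monicXsubC ?monic_prod_XsubC // IH opprD.
by rewrite /nextcoef size_XsubC coefXM /= coefB coefX coefC /= sub0r.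
Qed.
End LogDerivative.

(** * Rational functions in partial fractions *)

Section PartialFractions.
Variable F : finFieldType.
Local Notation q := #|F|.
Variables (e : F) (ys : seq F) (a : F -> F).
Hypothesis e0 : e != 0.

Definition pf_denom : {poly F} := \prod_(y <- ys) ('X - y%:P).
Definition pf_num : {poly F} := pf_denom * (e *: 'X) +
  \sum_(y <- ys) a y *: \prod_(x <- rem y ys) ('X - x%:P).
Definition no_pole (W : {poly F}) := all (fun y => W.[y] != 0) ys.
(* For an irreducible W with root z, this is the trace of
   e z + \sum_(y <- ys) a y / (z - y). *)
Definition pf_trace (W : {poly F}) : F :=
  - (e * nextcoef W) - \sum_(y <- ys) a y * (W^`().[y] / W.[y]).

Lemma pf_denom_neq0 : pf_denom != 0.
Proof. exact: monic_neq0 (monic_prod_XsubC _ _ _). Qed.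

Lemma size_pf_denom : size pf_denom = (size ys).+1.
Proof. by rewrite /pf_denom size_prod_XsubC. Qed.

(** The simple pole at infinity, due to e <> 0, on which the comparison of pole orders depends. *)
Lemma size_pf_num : size pf_num = (size pf_denom).+1.
Proof.
have s1 : size (pf_denom * (e *: 'X)) = (size pf_denom).+1.
  by rewrite -scalerAr size_scale // size_mulX // pf_denom_neq0.
rewrite /pf_num size_polyDl s1 // ltnS; apply: leq_trans (size_sum _ _ _) _.
elim/big_ind: _ => [//|x y hx hy|y _]; first by rewrite geq_max hx hy.
apply: leq_trans (size_scale_leq _ _) _; rewrite size_prod_XsubC size_pf_denom ltnS.
exact: size_subseq (rem_subseq _ _).
Qed.

Lemma dvd_pf_denom d W : W \in irrs F d -> (W %| pf_denom) = ~~ no_pole W.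
Proof.
move=> Wd; have [iW _] := mem_irrs Wd.
rewrite -[LHS]negbK -irreducible_poly_coprime // /pf_denom /no_pole; congr (~~ _).
elim: ys => [|y s IH] /=; first by rewrite big_nil coprimep1.
by rewrite big_cons coprimepMr IH coprimep_XsubC rootE.
Qed.

(** Sums over roots: both the next-to-leading coefficient and the logarithmic derivative turn
    products into sums. This makes [chi] below multiplicative. *)
Lemma pf_traceM P Q : P \is monic -> Q \is monic -> no_pole P -> no_pole Q ->
  pf_trace (P * Q) = pf_trace P + pf_trace Q.
Proof.
move=> mP mQ cP cQ; rewrite /pf_trace nextcoefM // mulrDr.
have -> : \sum_(y <- ys) a y * ((P * Q)^`().[y] / (P * Q).[y]) =
   \sum_(y <- ys) a y * (P^`().[y] / P.[y]) + \sum_(y <- ys) a y * (Q^`().[y] / Q.[y]).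
  rewrite -big_split /=; apply: eq_big_seq => y yys.
  have Py := allP cP y yys; have Qy := allP cQ y yys.
  by rewrite derivM hornerD !hornerM; field; rewrite ?Py ?Qy.
by ring.
Qed.

Lemma no_poleM P Q : no_pole (P * Q) = no_pole P && no_pole Q.
Proof.
by rewrite /no_pole -all_predI; apply: eq_all => y; rewrite /= hornerM mulf_eq0 negb_or.
Qed.

Section Trace.
Variables (L : fieldType) (iota : {rmorphism F -> L}).
Let f (z : L) := (map_poly iota pf_num).[z] / (map_poly iota pf_denom).[z].

Lemma pf_value z : (map_poly iota pf_denom).[z] != 0 ->
  f z = iota e * z + \sum_(y <- ys) iota (a y) / (z - iota y).
Proof.
move=> Dz; have DE : (map_poly iota pf_denom).[z] = \prod_(y <- ys) (z - iota y).
  rewrite /pf_denom rmorph_prod horner_prod; apply: eq_bigr => y _.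
  by rewrite /= map_polyXsubC hornerXsubC.
rewrite /f /pf_num rmorphD rmorphM /= hornerD hornerM mulrDl mulrAC divff // mul1r.
rewrite map_polyZ map_polyX hornerZ hornerX; congr (_ + _).
rewrite rmorph_sum horner_sum mulr_suml; apply: eq_big_seq => y yys.
rewrite /= map_polyZ hornerZ -mulrA; congr (_ * _).
have Ez : (map_poly iota pf_denom).[z] = (z - iota y) *
    (map_poly iota (\prod_(x <- rem y ys) ('X - x%:P))).[z].
  rewrite DE (big_rem y) //=; congr (_ * _).
  rewrite rmorph_prod horner_prod; apply: eq_bigr => x _.
  by rewrite /= map_polyXsubC hornerXsubC.
have : (map_poly iota pf_denom).[z] != 0 by [].
rewrite Ez mulf_eq0 negb_or => /andP[h1 h2].
by rewrite invfM mulrCA divff // mulr1.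
Qed.

(** The roots z_i of [W] are the conjugates of [z]; - [nextcoef W] is the sum of the z_i and - W'(y)
    / W(y) that of the 1 / (z_i - y). In degree d k each conjugate is met k times. *)
Lemma pf_trace_irr d W z k : W \in irrs F d -> no_pole W -> root (map_poly iota W) z ->
  \sum_(i < d * k) f z ^+ (q ^ i) = iota (pf_trace W *+ k).
Proof.
move=> Wd cW rz; have [WE zd] := irr_conjugates Wd rz.
have mW := irrs_monic Wd; have d0 := irrs_gt0 Wd.
have Dz : (map_poly iota pf_denom).[z] != 0.
  by rewrite -rootE (irr_dvd _ Wd rz) (dvd_pf_denom Wd) cW.
have fq i : f z ^+ (q ^ i) = f (z ^+ (q ^ i)).
  by rewrite /f exprMn exprVn !horner_expr_card.
have Dzi i : (map_poly iota pf_denom).[z ^+ (q ^ i)] != 0.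
  by rewrite -horner_expr_card expf_neq0.
elim: k => [|k IH]; first by rewrite muln0 big_ord0 mulr0n rmorph0.
rewrite mulnS big_split_ord /= mulrS rmorphD -IH; congr (_ + _); last first.
  by apply: eq_bigr => i _; rewrite -(exprM_card F) [f z ^+ (q ^ d)]fq zd.
pose s := [seq z ^+ (q ^ i) | i : 'I_d].
have WE' : map_poly iota W = \prod_(x <- s) ('X - x%:P) by rewrite WE big_image.
have sumE (h : L -> L) : \sum_(i < d) h (z ^+ (q ^ i)) = \sum_(x <- s) h x by rewrite big_image.
transitivity (\sum_(i < d) (iota e * z ^+ (q ^ i) +
    \sum_(y <- ys) iota (a y) / (z ^+ (q ^ i) - iota y))).
  by apply: eq_bigr => i _; rewrite fq pf_value.
rewrite (sumE (fun x => iota e * x + \sum_(y <- ys) iota (a y) / (x - iota y))).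
rewrite big_split /= -mulr_sumr exchange_big /= rmorphB rmorphN rmorphM.
have -> : iota (nextcoef W) = - \sum_(x <- s) x.
  rewrite -nextcoef_prod -WE' /nextcoef size_map_poly -coef_map rmorphM /= map_polyX //.
rewrite mulrN opprK; congr (_ + _).
rewrite rmorph_sum -sumrN; apply: eq_big_seq => y yys.
have Wy := allP cW y yys.
have ys' : iota y \notin s.
  apply: contra Wy => ys'.
  by rewrite -(fmorph_eq0 iota) -horner_map -rootE WE' root_prod_XsubC.
rewrite rmorphM fmorph_div -!horner_map /= -deriv_map WE' deriv_prod_XsubC //.
rewrite mulrAC divff; last by rewrite -WE' horner_map fmorph_eq0.
rewrite mul1r -mulrN -mulr_sumr; congr (_ * _); rewrite -sumrN; apply: eq_bigr => x _.
by rewrite -invrN opprB.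
Qed.
End Trace.
End PartialFractions.

Section CountMonics.
Variable F : finFieldType.
Lemma size_monics n : size (monics F n) = (#|F| ^ n)%N.
Proof. by rewrite size_map -cardE card_npoly. Qed.

(** The exact prime number theorem of F[X]: for the trivial character the coefficients of the
    L-series are q^n, and the recursion then forces the value. *)
Lemma mangoldt_sum1 (C : idomainType) r :
  mangoldt_sum (fun _ : {poly F} => 1 : C) r.+1 = (#|F|%:R) ^+ r.+1.
Proof.
have lamE n : monic_sum (fun _ : {poly F} => 1 : C) n = #|F|%:R ^+ n.
  by rewrite /monic_sum big_const_seq count_predT size_monics iter_addr_0 natrX.
elim/ltn_ind: r => r IH.
have := @monic_sum_rec F C (fun _ => 1) erefl (fun _ _ _ _ => esym (mulr1 1)) r.+1.
rewrite lamE big_ord_recr /= subnn lamE expr0 mulr1.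
have -> : \sum_(i < r) mangoldt_sum (fun _ : {poly F} => 1 : C) i.+1 * monic_sum (fun _ : {poly F} => 1 : C) (r.+1 - i.+1)
   = r%:R * #|F|%:R ^+ r.+1.
  rewrite -[r in r%:R]card_ord -sumr_const mulr_suml; apply: eq_bigr => i _.
  by rewrite IH // lamE -exprD subnKC ?mul1r // ltnS ltnW.
by rewrite -natr1 mulrDl mul1r => /addrI <-.
Qed.
End CountMonics.

Section AdditiveCharacter.
Variables (F : finFieldType) (C : numClosedFieldType) (psi : F -> C).
Hypothesis psiD : forall x y, psi (x + y) = psi x * psi y.
Hypothesis psi0 : psi 0 = 1.
Hypothesis psi_nontrivial : exists x, psi x != 1.

Lemma char_mulrn x k : psi (x *+ k) = psi x ^+ k.
Proof. by elim: k => [|k IH]; rewrite ?mulr0n ?psi0 // mulrS psiD IH exprS. Qed.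

Lemma sum_char c : \sum_x psi (x * c) = if c == 0 then #|F|%:R else 0.
Proof.
case: eqP => [->|/eqP c0].
  by under eq_bigr do rewrite mulr0 psi0; rewrite sumr_const.
have [x0 px0] := psi_nontrivial.
apply/eqP; have : (psi x0 - 1) * \sum_x psi (x * c) == 0.
  rewrite mulrBl mul1r subr_eq0 mulr_sumr; apply/eqP.
  rewrite [RHS](reindex_inj (addrI (x0 / c))) /=; apply: eq_bigr => x _.
  by rewrite mulrDl divfK // psiD.
by rewrite mulf_eq0 subr_eq0 (negPf px0).
Qed.

Variables (e : F) (ys : seq F) (a : F -> F).
Hypothesis e0 : e != 0.

(** Like a Dirichlet character, it is 0 on the polynomials that share a root with the
    denominator. *)
Definition chi (c : F) (W : {poly F}) : C :=
  if no_pole ys W then psi (c * pf_trace e ys a W) else 0.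

Lemma chi1 c : chi c 1 = 1.
Proof.
rewrite /chi /no_pole; have -> : all (fun y => (1 : {poly F}).[y] != 0) ys.
  by apply/allP => y _; rewrite hornerC oner_neq0.
rewrite /pf_trace /nextcoef size_poly1 mulr1 coefX /= mulr0 oppr0 big1 ?subr0 ?mulr0 //.
by move=> y _; rewrite derivC horner0 mul0r mulr0.
Qed.

Lemma chiM c P Q : P \is monic -> Q \is monic -> chi c (P * Q) = chi c P * chi c Q.
Proof.
move=> mP mQ; rewrite /chi no_poleM.
case cP : (no_pole ys P); last by rewrite mul0r.
by case cQ : (no_pole ys Q); rewrite ?mulr0 // pf_traceM // mulrDr psiD.
Qed.

(** [pf_trace] sees a polynomial only modulo the square of the denominator and through its
    next-to-leading coefficient. Once n - 1 >= 2 [size ys], a multiple of that square has degree n -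
    1, so the latter can be changed alone. *)
Lemma monic_sum_chi_eq0 c n : c != 0 -> (2 * size ys < n)%N -> monic_sum (chi c) n = 0.
Proof.
move=> c0 nM.
(* Adding a multiple of E leaves the values and derivatives at the poles unchanged
   but shifts the next-to-leading coefficient. *)
pose E := pf_denom ys ^+ 2 * 'X^(n.-1 - 2 * size ys).
have mD : pf_denom ys \is monic := monic_prod_XsubC _ _ _.
have mE : E \is monic by rewrite monicMl ?monicXn // monic_exp.
have sE : size E = n.
  rewrite size_monicM ?monic_exp ?(monic_neq0 (monicXn _ _)) //.
  rewrite size_polyXn expr2 size_monicM ?(monic_neq0 mD) //.
  rewrite size_pf_denom; move: nM; lia.
have D0 y : y \in ys -> (pf_denom ys).[y] = 0.
  by move=> yys; apply/rootP; rewrite root_prod_XsubC.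
have Ey y : y \in ys -> E.[y] = 0.
  by move=> yys; rewrite hornerM horner_exp D0 // expr0n mul0r.
have E'y y : y \in ys -> E^`().[y] = 0.
  by move=> yys; rewrite derivM expr2 derivM !hornerE D0 // !(mul0r, mulr0, addr0).
have [x0 px0] := psi_nontrivial.
(* Chosen so that adding [s *: E] raises c times the trace by exactly [x0]. *)
pose s := - (x0 / (c * e)).
have shift P : P \in monics F n -> P + s *: E \in monics F n.
  rewrite !mem_monics => /andP[mP /eqP sP].
  have lt : (size (s *: E) < size P)%N.
    by apply: leq_ltn_trans (size_scale_leq _ _) _; rewrite sE sP.
  by rewrite monicE lead_coefDl // (eqP mP) size_polyDl // sP !eqxx.
have perm : perm_eq [seq P + s *: E | P <- monics F n] (monics F n).
  have inj : injective (fun P => P + s *: E) by apply: addIr.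
  have us : uniq [seq P + s *: E | P <- monics F n] by rewrite map_inj_uniq ?monics_uniq.
  apply: uniq_perm => //; first exact: monics_uniq.
  have sub : {subset [seq P + s *: E | P <- monics F n] <= monics F n}.
    by move=> _ /mapP[P Pn ->]; apply: shift.
  by have [] := uniq_min_size us sub; rewrite ?size_map.
have chiS P : P \in monics F n -> chi c (P + s *: E) = psi x0 * chi c P.
  move=> Pn; have := shift P Pn; move: Pn; rewrite !mem_monics => /andP[_ /eqP sP] /andP[_ /eqP sP'].
  have hy y : y \in ys -> (P + s *: E).[y] = P.[y].
    by move=> yys; rewrite hornerD hornerZ Ey // mulr0 addr0.
  have hy' y : y \in ys -> (P + s *: E)^`().[y] = P^`().[y].
    by move=> yys; rewrite derivD derivZ hornerD hornerZ E'y // mulr0 addr0.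
  rewrite /chi; have -> : no_pole ys (P + s *: E) = no_pole ys P.
    by apply: eq_in_all => y yys; rewrite hy.
  case: ifP => _; last by rewrite mulr0.
  rewrite -psiD; congr psi; rewrite /pf_trace.
  have -> : nextcoef (P + s *: E) = nextcoef P + s.
    have n0 : (n == 0)%N = false by case: (n) nM.
    rewrite /nextcoef sP' sP /= !coefXM n0 coefD coefZ; congr (_ + _).
    by rewrite -[X in E`_X.-1]sE -lead_coefE (eqP mE) mulr1.
  have -> : \sum_(y <- ys) a y * ((P + s *: E)^`().[y] / (P + s *: E).[y]) =
     \sum_(y <- ys) a y * (P^`().[y] / P.[y]).
    by apply: eq_big_seq => y yys; rewrite hy // hy'.
  by rewrite /s; field; rewrite c0 e0.
apply/eqP; have : (psi x0 - 1) * monic_sum (chi c) n == 0.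
  rewrite mulrBl mul1r subr_eq0 -[X in _ == X](perm_big _ perm) big_map mulr_sumr.
  by apply/eqP; apply: eq_big_seq => P /chiS.
by rewrite mulf_eq0 subr_eq0 (negPf px0).
Qed.
End AdditiveCharacter.

Section IrreducibleList.
Variable F : finFieldType.
Local Notation q := #|F|.

(** The minimal polynomials of the elements of the extension of degree r, each standing for
    [(size W).-1] elements. *)
Definition irrdvd (r : nat) : seq {poly F} :=
  flatten [seq irrs F d | d <- index_iota 1 r.+1 & (d %| r)%N].

Lemma mem_irrdvd r W : W \in irrdvd r ->
  W \in irrs F (size W).-1 /\ ((size W).-1 %| r)%N.
Proof.
case/flattenP => s /mapP[d]; rewrite mem_filter => /andP[dr _] -> Wd.
by rewrite (irrs_size Wd).
Qed.

Lemma irrdvd_uniq r : uniq (irrdvd r).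
Proof.
rewrite /irrdvd; have : uniq [seq d <- index_iota 1 r.+1 | (d %| r)%N].
  by rewrite filter_uniq // iota_uniq.
elim: [seq d <- _ | _] => [//|d s IH] /= /andP[ds us].
rewrite cat_uniq irrs_uniq IH // andbT; apply/hasPn => W /flattenP[t /mapP[d' d's ->]] Wd'.
apply: contra ds => Wd; have := irrs_size Wd; rewrite (irrs_size Wd') => -[<-].
exact: d's.
Qed.

Lemma mangoldt_sum_irrdvd (C : comNzRingType) (f : {poly F} -> C) r :
  mangoldt_sum f r = \sum_(W <- irrdvd r) (size W).-1%:R * f W ^+ (r %/ (size W).-1).
Proof.
rewrite /irrdvd big_flatten big_map big_filter /mangoldt_sum; apply: eq_bigr => d _.
by apply: eq_big_seq => W Wd; rewrite (irrs_size Wd).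
Qed.

Lemma sum_deg_irrdvd r : (\sum_(W <- irrdvd r.+1) (size W).-1 = q ^ r.+1)%N.
Proof.
apply/eqP; rewrite -(eqr_nat rat) natr_sum natrX -(mangoldt_sum1 _ rat) mangoldt_sum_irrdvd.
by apply/eqP; apply: eq_bigr => W _; rewrite expr1n mulr1.
Qed.
End IrreducibleList.

(** Upper bounds become two-sided: [N0] counts the points of trace 0, [N1] those of the other
    traces, [Nb] the poles. As the other q - 1 traces cannot exceed their share by much, trace 0
    cannot fall far below its own. *)
Lemma weil_numeric (q A B K M N0 N1 Nb Q : nat) : (0 < q)%N -> (0 < B)%N ->
  (N0 + N1 + Nb = Q)%N -> (N1 <= q.-1 * (A + K * B))%N -> (N0 <= A + K * B)%N ->
  (Nb <= M)%N -> Q = (q * A)%N ->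
  (q * N0 + Nb <= Q + q * (M + q * K) * B)%N /\
  (Q <= q * N0 + Nb + q * (M + q * K) * B)%N.
Proof.
case: q => [//|q] _; case: B => [//|B] _ /= h1 h2 h3 h4 QE; split.
  have : (q.+1 * N0 <= q.+1 * (A + K * B.+1))%N by rewrite leq_mul2l h3 orbT.
  rewrite QE; nia.
have h5 : (A <= N0 + q * (K * B.+1) + M)%N by nia.
have : (q.+1 * A <= q.+1 * (N0 + q * (K * B.+1) + M))%N by rewrite leq_mul2l h5 orbT.
rewrite QE; nia.
Qed.

Section Weil.
Variables (F : finFieldType) (C : numClosedFieldType) (psi : F -> C).
Local Notation q := #|F|.
Hypothesis archiC : forall x y : C, 1 < x -> 0 <= y -> exists n, y < x ^+ n.
Hypothesis psiD : forall x y, psi (x + y) = psi x * psi y.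
Hypothesis psi0 : psi 0 = 1.
Hypothesis psi_nontrivial : exists x, psi x != 1.
Variables (e : F) (ys : seq F) (a : F -> F).
Hypothesis e0 : e != 0.

(** [tau r W] is the trace of f at a root of [W], taken from the extension of degree r; [N r b] is
    the number of elements of that extension, poles excluded, at which it equals b, and [Nbad r] the
    number of poles. *)
Let tau r (W : {poly F}) := pf_trace e ys a W *+ (r %/ (size W).-1).
Let cop (W : {poly F}) := no_pole ys W.
Let N r b := (\sum_(W <- irrdvd F r | cop W && (tau r W == b)) (size W).-1)%N.
Let Nbad r := (\sum_(W <- irrdvd F r | ~~ cop W) (size W).-1)%N.

Lemma pole_count_le r : (Nbad r <= size ys)%N.
Proof.
rewrite /Nbad -big_filter -[size ys]/((size ys).+1.-1) -(size_pf_denom ys).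
apply: sum_irr_degrees; first exact: pf_denom_neq0.
  by rewrite filter_uniq // irrdvd_uniq.
move=> W; rewrite mem_filter => /andP[cW /mem_irrdvd[Wd _]].
by exists (size W).-1 => //; rewrite (dvd_pf_denom ys Wd).
Qed.

Lemma sum_trace_count r : (\sum_b N r.+1 b + Nbad r.+1 = q ^ r.+1)%N.
Proof.
rewrite -sum_deg_irrdvd (bigID cop) /=; congr (_ + _)%N.
rewrite /N; under eq_bigr do rewrite big_mkcondr.
rewrite exchange_big /=; apply: eq_bigr => W _.
by rewrite -big_mkcond /= (big_pred1 (tau r.+1 W)) // => b; rewrite /= eq_sym.
Qed.

Lemma trace_count_le : exists K, forall n b, (N (n.+1 + n.+1) b <= q ^ n.+1 * q ^ n + K * q ^ n.+1)%N.
Proof.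
have [K KP] := @stepanov F (pf_denom ys) (pf_num e ys a) (pf_denom_neq0 ys) (size_pf_num ys a e0).
exists K => n b; rewrite /N -big_filter; apply: KP => [|W].
  by rewrite filter_uniq // irrdvd_uniq.
rewrite mem_filter => /andP[/andP[cW /eqP tW] /mem_irrdvd[Wd dr]].
exists (size W).-1 => //; split=> //; first by rewrite (dvd_pf_denom ys Wd) negbK.
move=> L z rz; have := pf_trace_irr e a ((n.+1 + n.+1) %/ (size W).-1) Wd cW rz.
rewrite mulnC divnK // -/(tau _ W) tW.
by move=> h; apply: etrans h _.
Qed.

(** Orthogonality in [c] leaves the elements of trace 0. Hence the point counts control the sum over
    all [c], not a single [c]. *)
Lemma sum_mangoldt_chi r :
  \sum_c mangoldt_sum (chi psi e ys a c) r.+1 = (q * N r.+1 0)%:R.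
Proof.
under eq_bigr do rewrite mangoldt_sum_irrdvd.
rewrite exchange_big /= /N natrM natr_sum mulr_sumr [RHS]big_mkcond /=.
apply: eq_big_seq => W /mem_irrdvd[Wd dr].
rewrite -mulr_sumr.
have k0 : (0 < r.+1 %/ (size W).-1)%N.
  by rewrite divn_gt0 ?(irrs_gt0 Wd) // dvdn_leq.
rewrite /chi /cop; case cW : (no_pole ys W) => /=; last first.
  by rewrite big1 ?mulr0 // => c _; rewrite expr0n eqn0Ngt k0.
under eq_bigr do rewrite -(char_mulrn psiD psi0) -mulrnAr -/(tau r.+1 W).
rewrite (sum_char psiD psi0 psi_nontrivial); case: eqP => _; last by rewrite mulr0.
by rewrite mulrC.
Qed.

Lemma mangoldt_sum_chi0 r : mangoldt_sum (chi psi e ys a 0) r.+1 + (Nbad r.+1)%:R = (q ^ r.+1)%:R.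
Proof.
rewrite -sum_deg_irrdvd mangoldt_sum_irrdvd /Nbad [in RHS](bigID cop) natrD; congr (_ + _).
rewrite natr_sum [RHS]big_mkcond /=; apply: eq_big_seq => W /mem_irrdvd[Wd dr].
have k0 : (0 < r.+1 %/ (size W).-1)%N.
  by rewrite divn_gt0 ?(irrs_gt0 Wd) // dvdn_leq.
rewrite /chi /cop; case cW : (no_pole ys W); first by rewrite mul0r psi0 expr1n mulr1.
by rewrite expr0n eqn0Ngt k0 mulr0.
Qed.

Lemma sum_mangoldt_chi_bound : exists K : nat, forall n,
  `|\sum_(c | c != 0) mangoldt_sum (chi psi e ys a c) (n.+1 + n.+1)| <= K%:R * q%:R ^+ n.+1.
Proof.
have [K KP] := trace_count_le; exists (q * (size ys + q * K))%N => n.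
rewrite addSn; set r := (n + n.+1)%N.
have := sum_mangoldt_chi r; rewrite (bigD1 0) //= => S1.
have S2 := mangoldt_sum_chi0 r.
have -> : \sum_(c | c != 0) mangoldt_sum (chi psi e ys a c) r.+1 =
    (q * N r.+1 0 + Nbad r.+1)%:R - (q ^ r.+1)%:R.
  by rewrite natrD -S1 -S2; ring.
have q0 : (0 < q)%N := ltnW (card_field_gt1 F).
have hN b : (N r.+1 b <= q ^ n.+1 * q ^ n + K * q ^ n.+1)%N by have := KP n b; rewrite addSn.
have hB := pole_count_le r.+1.
have hS := sum_trace_count r; rewrite (bigD1 0) //= in hS.
have hS2 : (\sum_(b | b != 0%R) N r.+1 b <= q.-1 * (q ^ n.+1 * q ^ n + K * q ^ n.+1))%N.
  have -> : q.-1 = #|[pred b : F | b != 0]| by rewrite -(cardC1 (0 : F)); apply: eq_card.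
  by rewrite -sum_nat_const; apply: leq_sum => b _; apply: hN.
have Q : (q ^ r.+1 = q * (q ^ n.+1 * q ^ n))%N by rewrite -expnD -expnS /r addnC.
have B0 : (0 < q ^ n.+1)%N := card_expn_gt0 F n.+1.
have [u1 u2] := weil_numeric q0 B0 hS hS2 (hN 0) hB Q.
rewrite -natrX -natrM; have [le|/ltnW le] := leqP (q ^ r.+1) (q * N r.+1 0 + Nbad r.+1).
  by rewrite -natrB // normr_nat ler_nat leq_subLR.
by rewrite distrC -natrB // normr_nat ler_nat leq_subLR.
Qed.

Theorem weil_bound :
  `|\sum_(x | x \notin ys) psi (e * x + \sum_(y <- ys) a y / (x - y))|
    <= (2 * size ys)%:R * sqrtC q%:R.
Proof.
have [K KP] := sum_mangoldt_chi_bound.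
(* A list is needed for every [c] in order to apply [choice]; c = 0 gets the empty one. *)
have roots c : exists s : seq C, c != 0 -> (size s <= 2 * size ys)%N /\
    forall r, mangoldt_sum (chi psi e ys a c) r.+1 = - \sum_(w <- s) w ^+ r.+1.
  have [->|c0] := eqVneq c 0; first by exists [::].
  have monic_sum0 := monic_sum0 (chi1 psi0 e ys a c).
  have lamN n : (2 * size ys < n)%N -> monic_sum (chi psi e ys a c) n = 0.
    exact: (monic_sum_chi_eq0 psiD psi_nontrivial).
  have rec := monic_sum_rec (chi1 psi0 e ys a c) (chiM psiD e ys a c).
  by have [s s1 s2] := newton_roots monic_sum0 lamN rec; exists s.
have [s sP] := choice roots.
have q0 : (0 : C) < q%:R by rewrite ltr0n (ltnW (card_field_gt1 F)).
(* The inverse roots for all c <> 0 together, squared: the n-th power sum of [S] is up to sign the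
   sum over c <> 0 in degree 2 n, exactly what has been bounded. Each single root inherits the
   bound. *)
pose S := [seq w ^+ 2 | w <- flatten [seq s c | c <- enum F & c != 0]].
have bound w : w \in s 1 -> `|w| <= sqrtC q%:R.
  move=> ws; have := @power_sum_bound C archiC S K%:R q%:R q0.
  have wS : w ^+ 2 \in S.
    apply/map_f/flattenP; exists (s 1) => //; apply: map_f.
    by rewrite mem_filter oner_neq0 mem_enum.
  move=> /(_ _ _ wS) h; have sq0 : 0 <= sqrtC q%:R :> C by rewrite sqrtC_ge0 ltW.
  rewrite -ler_sqr ?nnegrE //.
  rewrite sqrtCK -normrX; apply: h => n n0.
  have := KP n.-1; rewrite prednK //.
  suff -> : \sum_(x <- S) x ^+ n = - \sum_(c | c != 0) mangoldt_sum (chi psi e ys a c) (n + n).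
    by rewrite normrN.
  rewrite big_map big_flatten big_map big_filter big_enum_cond -sumrN; apply: eq_bigr => c c0.
  have -> : (n + n = (n + n).-1.+1)%N by rewrite prednK // addn_gt0 n0.
  rewrite (sP c c0).2 opprK prednK ?addn_gt0 ?n0 //; apply: eq_bigr => x _.
  by rewrite -exprM mul2n addnn.
have [sz vs] := sP 1 (oner_neq0 _).
(* In degree 1 the irreducible polynomials are the X - x, and [chi] discards the poles. *)
have -> : \sum_(x | x \notin ys) psi (e * x + \sum_(y <- ys) a y / (x - y)) =
    mangoldt_sum (chi psi e ys a 1) 1.
  rewrite mangoldt_sum_irrdvd.
  have pe : perm_eq (irrdvd F 1) [seq 'X - x%:P | x <- enum F].
    apply: uniq_perm; first exact: irrdvd_uniq.
      by rewrite map_inj_uniq ?enum_uniq // => x y /addrI/oppr_inj/polyC_inj.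
    move=> W; apply/idP/mapP => [/mem_irrdvd[Wd]|[x _ ->]].
      rewrite dvdn1 => /eqP d1; rewrite d1 in Wd.
      have sW := irrs_size Wd; have mW := irrs_monic Wd.
      exists (- W`_0); rewrite ?mem_enum // polyCN opprK.
      apply/polyP => i; rewrite coefD coefX coefC.
      case: i => [|[|i]]; rewrite ?add0r ?addr0 //=.
        by rewrite -(eqP mW) lead_coefE sW.
      by rewrite nth_default // sW.
    rewrite /irrdvd /= /index_iota /= cats0 mem_filter mem_monics monicXsubC size_XsubC eqxx.
    by rewrite !andbT; apply/irreducibleP/irredp_XsubC.
  rewrite (perm_big _ pe) big_map big_enum /= big_mkcond /=; apply: eq_bigr => x _.
  rewrite size_XsubC mul1r divnn expr1 /chi.
  have -> : no_pole ys ('X - x%:P) = (x \notin ys).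
    rewrite /no_pole -[RHS]negbK -has_pred1 -all_predC negbK.
    apply: eq_all => y; rewrite /= hornerXsubC subr_eq0 //.
  case: ifP => _ //; rewrite mul1r /pf_trace; congr psi.
  congr (_ + _).
    by rewrite /nextcoef size_XsubC coefXM /= coefB coefX coefC sub0r mulrN opprK.
  rewrite -sumrN; apply: eq_bigr => y _.
  by rewrite derivXsubC hornerXsubC hornerC mul1r -mulrN -invrN opprB.
rewrite vs normrN; apply: le_trans (ler_norm_sum _ _ _) _.
apply: (@le_trans _ _ (\sum_(w <- s 1) sqrtC q%:R)).
  rewrite big_seq [leRHS]big_seq; apply: ler_sum => w ws.
  by rewrite expr1 bound.
rewrite big_const_seq count_predT iter_addr_0 -[leLHS]mulr_natl.
by rewrite ler_wpM2r ?sqrtC_ge0 ?(ltW q0) // ler_nat.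
Qed.
End Weil.

(** * Character sums over inverses *)

Section InversiveSum.
Variables (F : finFieldType) (C : numClosedFieldType) (psi : F -> C).
Local Notation q := #|F|.
Hypothesis archiC : forall x y : C, 1 < x -> 0 <= y -> exists n, y < x ^+ n.
Hypothesis psiD : forall x y, psi (x + y) = psi x * psi y.
Hypothesis norm_psi : forall x, `|psi x| = 1.
Hypothesis psi_nontrivial : exists x, psi x != 1.

(** Weil's bound with [#|u|.-1] finite poles gives the factor 2 [#|u|.-1]. At t = 0 and at these
    poles the summand may differ from the value of the rational function, which costs at most 2 +
    [#|u|.-1] more; as sqrt q >= 1, the total factor stays below 4 [#|u|]. *)
Lemma inversive_sum_bound (I : finType) (v h : I -> F) (u : {set I}) :
  injective v -> (exists i, h i != 0) -> (forall i, i \notin u -> h i = 0) ->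
  `|\sum_x psi (\sum_i h i * (x + v i)^-1)| <= (4 * #|u|)%:R * sqrtC q%:R.
Proof.
move=> vinj [i0 hi0] hu.
have psi0 : psi 0 = 1.
  have p0 : psi 0 != 0 by rewrite -normr_eq0 norm_psi oner_neq0.
  by apply: (mulfI p0); rewrite -psiD addr0 mulr1.
have i0u : i0 \in u by apply: contraNT hi0 => /hu ->.
(* The change of variable t = 1 / (x + v i0) moves one pole to infinity. *)
pose w i := v i - v i0.
have w0 i : i != i0 -> w i != 0 by rewrite subr_eq0 (inj_eq vinj).
pose J := enum (u :\ i0).
pose Y i := - (w i)^-1.
have Jne i : i \in J -> i != i0 by rewrite mem_enum !inE => /andP[].
pose ys := map Y J.
(* Partial fractions: 1 / (t^-1 + w) = t / (1 + w t) = 1 / w + (Y / w) / (t - Y) with Y = - 1 / w.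
   The constants h / w are collected in [cst]. *)
pose b i := h i * Y i / w i.
pose a y := if [pick i | (i \in J) && (Y i == y)] is Some i then b i else 0.
have Yinj i j : Y i = Y j -> i = j.
  by move=> /oppr_inj/invr_inj/addIr/vinj.
have aY i : i \in J -> a (Y i) = b i.
  move=> iJ; rewrite /a; case: pickP => [j /andP[_ /eqP/Yinj ->]//|/(_ i)].
  by rewrite iJ eqxx.
pose cst := \sum_(i <- J) h i / w i.
pose E t := psi cst * psi (h i0 * t + \sum_(y <- ys) a y / (t - y)).
pose G t := psi (\sum_i h i * (t^-1 + w i)^-1).
have -> : \sum_x psi (\sum_i h i * (x + v i)^-1) = \sum_t G t.
  (* As 0^-1 = 0, inversion permutes all of [F], including 0. *)
  rewrite (reindex_inj (h := fun t : F => t^-1 - v i0)) /=; last first.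
    by move=> x y /addIr/invr_inj.
  apply: eq_bigr => t _; rewrite /G; congr psi; apply: eq_bigr => i _.
  by rewrite /w addrA addrAC.
have GE t : t != 0 -> t \notin ys -> G t = E t.
  move=> t0 tys; rewrite /G /E -psiD; congr psi.
  rewrite (bigID (mem u)) /= [X in _ + X]big1 ?addr0; last by move=> i /hu ->; rewrite mul0r.
  rewrite (bigD1 i0) //= /w subrr addr0 invrK addrCA; congr (_ + _).
  rewrite big_map -big_split /= /J big_enum /=.
  have -> : \sum_(i in u :\ i0) (h i / w i + a (Y i) / (t - Y i)) =
     \sum_(i in u :\ i0) (h i / w i + b i / (t - Y i)).
    by apply: eq_bigr => i iu; rewrite aY // mem_enum.
  apply: eq_big => [i|i /andP[iu ii0]]; first by rewrite !inE andbC.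
  have wi := w0 i ii0; rewrite -/(w i).
  have tY : t - Y i != 0.
    rewrite subr_eq0; apply: contra tys => /eqP ->; apply: map_f.
    by rewrite mem_enum !inE ii0.
  have tw : t * w i + 1 != 0.
    have -> : t * w i + 1 = (t - Y i) * w i by rewrite /Y opprK mulrDl mulVf.
    by rewrite mulf_neq0.
  rewrite /b /Y; field.
  by rewrite wi t0 tw.
have split : \sum_t G t = \sum_(t | t \notin ys) E t + ((G 0 - E 0) + \sum_(t | t \in ys) G t).
  have ys0 : 0 \notin ys.
    apply/mapP => -[i /Jne/w0 wi /eqP]; rewrite eq_sym oppr_eq0 invr_eq0.
    by apply/negP.
  rewrite (bigID (mem ys)) /= addrC addrA; congr (_ + _).
  rewrite (bigD1 0) // [in RHS](bigD1 0) //= addrAC addrCA subrr addr0; congr (_ + _).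
  by apply: eq_bigr => t /andP[tys t0]; apply: GE.
have sys : (size ys = #|u|.-1)%N by rewrite size_map -cardE (cardsD1 i0 u) i0u.
have u0 : (0 < #|u|)%N by rewrite (cardsD1 i0) i0u.
rewrite split; apply: le_trans (ler_normD _ _) _.
have q1 : 1 <= sqrtC q%:R :> C.
  rewrite -[leLHS]sqrtC1 ler_sqrtC ?qualifE /= ?ler01 ?ler0n //.
  by rewrite ler1n (ltnW (finNzRing_gt1 F)).
have le1 : `|\sum_(t | t \notin ys) E t| <= (2 * #|u|.-1)%:R * sqrtC q%:R.
  rewrite -mulr_sumr normrM norm_psi mul1r -sys.
  exact: weil_bound.
have le2 : `|(G 0 - E 0) + \sum_(t | t \in ys) G t| <= (2 + #|u|.-1)%:R.
  rewrite natrD; apply: le_trans (ler_normD _ _) _; apply: lerD.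
    apply: le_trans (ler_normB _ _) _.
    by rewrite /G /E normrM !norm_psi mulr1.
  apply: le_trans (ler_norm_sum _ _ _) _.
  under eq_bigr do rewrite norm_psi.
  by rewrite sumr_const ler_nat -sys card_size.
apply: le_trans (lerD le1 le2) _.
have -> : (4 * #|u|)%:R * sqrtC q%:R = (2 * #|u|.-1)%:R * sqrtC q%:R + (2 + #|u|.-1)%:R * sqrtC q%:R
   + (2 * #|u| - #|u|.-1)%:R * sqrtC q%:R :> C.
  by rewrite -!mulrDl -!natrD; congr (_%:R * _); lia.
rewrite -addrA lerD2l -[leLHS]addr0; apply: lerD.
  by rewrite -[leLHS]mulr1 ler_wpM2l ?ler0n.
by rewrite mulr_ge0 ?ler0n // (le_trans ler01).
Qed.
End InversiveSum.

(** * Fourier analysis of digital boxes *)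

Section FourierCount.
Variables (F : finFieldType) (C : numClosedFieldType) (psi : F -> C).
Local Notation q := #|F|.
Hypothesis psiD : forall x y, psi (x + y) = psi x * psi y.
Hypothesis psi0 : psi 0 = 1.
Hypothesis norm_psi : forall x, `|psi x| = 1.
Hypothesis psi_nontrivial : exists x, psi x != 1.

Definition fourier_coef (B : pred F) (h : F) : C := \sum_(x | B x) psi (h * x).

Lemma fourier_coef0 B : fourier_coef B 0 = #|B|%:R.
Proof. by rewrite /fourier_coef; under eq_bigr do rewrite mul0r psi0; rewrite sumr_const. Qed.

Lemma fourier_coef_all h : fourier_coef predT h = if h == 0 then q%:R else 0.
Proof.
by rewrite -(sum_char psiD psi0 psi_nontrivial); apply: eq_bigr => x _; rewrite mulrC.
Qed.

Lemma eq_fourier_coef B B' : B =1 B' -> fourier_coef B =1 fourier_coef B'.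
Proof. by move=> e h; apply: eq_bigl. Qed.

Lemma fourier_inversion B x0 : \sum_h fourier_coef B h * psi (- (h * x0)) = (q * B x0)%:R.
Proof.
rewrite /fourier_coef; under eq_bigr do rewrite mulr_suml.
rewrite exchange_big /=.
transitivity (\sum_(x | B x) (if x == x0 then q%:R else 0 : C)).
  apply: eq_bigr => x _; rewrite -subr_eq0 -(sum_char psiD psi0 psi_nontrivial).
  by apply: eq_bigr => h _; rewrite -psiD mulrBr.
rewrite -big_mkcondr /=; case Bx : (B x0).
  by rewrite (big_pred1 x0) ?muln1 // => x /=; case: eqP => [->|]; rewrite ?Bx ?andbF.
by rewrite big1 ?muln0 // => x /andP[Bx' /eqP xE]; rewrite xE Bx in Bx'.
Qed.

(** Each indicator is replaced by its Fourier expansion and the product is multiplied out. The zero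
    frequency gives the expected count. A frequency that is nonzero at some i outside [u] has
    coefficient 0, because there [B i] is everything; so [W] has to bound only the frequencies
    supported in [u]. *)
Lemma fourier_count (I U : finType) (B : I -> pred F) (z : U -> I -> F)
    (u : {set I}) (W : C) : 0 <= W ->
  (forall i, i \notin u -> B i =1 predT) ->
  (forall h : I -> F, (exists i, h i != 0) -> (forall i, i \notin u -> h i = 0) ->
     `|\sum_n psi (\sum_i h i * z n i)| <= W) ->
  `|q%:R ^+ #|I| * #|[pred n | [forall i, B i (z n i)]]|%:R - #|U|%:R * \prod_i #|B i|%:R|
    <= W * \prod_i \sum_h `|fourier_coef (B i) h|.
Proof.
move=> W0 hB hW.
pose S (h : {ffun I -> F}) := \sum_n psi (\sum_i (- h i) * z n i).
have -> : q%:R ^+ #|I| * #|[pred n | [forall i, B i (z n i)]]|%:R =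
    \sum_(h : {ffun I -> F}) (\prod_i fourier_coef (B i) (h i)) * S h.
  transitivity (\sum_n \prod_i (q * B i (z n i))%:R : C).
    transitivity (\sum_n (if [forall i, B i (z n i)] then q%:R ^+ #|I| else 0) : C).
      by rewrite -big_mkcond /= sumr_const mulr_natr.
    apply: eq_bigr => n _; rewrite -natr_prod.
    case: ifP => [/forallP Bn|/negbT]; last first.
      by rewrite negb_forall => /existsP[i /negbTE Bi]; rewrite (bigD1 i) //= Bi muln0 mul0n.
    rewrite (eq_bigr (fun _ => q)) ?prod_nat_const ?natrX // => i _.
    by rewrite Bn muln1.
  under eq_bigr => n _ do under eq_bigr do rewrite -fourier_inversion.
  under eq_bigr => n _ do rewrite bigA_distr_bigA.
  rewrite exchange_big /=; apply: eq_bigr => h _.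
  rewrite /S mulr_sumr; apply: eq_bigr => n _; rewrite big_split /=; congr (_ * _).
  rewrite (big_morph psi psiD psi0); apply: eq_bigr => i _; by rewrite mulNr.
pose h0 : {ffun I -> F} := [ffun=> 0].
have S0 : (\prod_i fourier_coef (B i) (h0 i)) * S h0 = #|U|%:R * \prod_i #|B i|%:R.
  rewrite mulrC; congr (_ * _); last by apply: eq_bigr => i _; rewrite ffunE fourier_coef0.
  rewrite /S (eq_bigr (fun _ => 1)) ?sumr_const // => n _.
  by rewrite big1 ?psi0 // => i _; rewrite ffunE oppr0 mul0r.
rewrite (bigD1 h0) //= S0 addrC addrK.
apply: le_trans (ler_norm_sum _ _ _) _.
rewrite bigA_distr_bigA mulr_sumr [leRHS](bigD1 h0) //=.
apply: (@le_trans _ _ (\sum_(h | h != h0) W * \prod_i `|fourier_coef (B i) (h i)|)); last first.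
  by rewrite lerDr mulr_ge0 // prodr_ge0.
apply: ler_sum => h hne; rewrite normrM normr_prod mulrC.
have [i /andP[iu hi]|hu] := pickP (fun i => (i \notin u) && (h i != 0)).
  by rewrite (bigD1 i) //= (eq_fourier_coef (hB i iu)) fourier_coef_all (negbTE hi) normr0 !mul0r !mulr0.
apply: ler_wpM2r; first by rewrite prodr_ge0.
apply: hW.
  apply: contrapT => no; case/eqP: hne; apply/ffunP => i; rewrite ffunE.
  by apply/eqP; apply: contrapT => /negP hi; apply: no; exists i; rewrite oppr_eq0.
by move=> i iu; have := hu i; rewrite iu /= => /negbFE/eqP ->; rewrite oppr0.
Qed.
End FourierCount.

(** * Expansions in base p *)

Section DigitOrder.
Variable p : nat.
Hypothesis p0 : (0 < p)%N.

Definition radix_value (k : nat) (d : nat -> nat) := (\sum_(j < k) d j * p ^ (k.-1 - j))%N.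

Lemma radix_valueS k d : radix_value k.+1 d = (p * radix_value k d + d k)%N.
Proof.
rewrite /radix_value big_ord_recr /= subnn muln1 big_distrr /=; congr (_ + _)%N.
apply: eq_bigr => j _; rewrite mulnCA -expnS; congr (_ * p ^ _)%N.
by have := ltn_ord j; lia.
Qed.

Definition radix_digit k A j := ((A %/ p ^ (k.-1 - j)) %% p)%N.

(** The comparison is decided at the first differing digit j. At most one j qualifies, so the
    condition is a sum of products of one-digit conditions, the form in which character sums factor.
    The equality test is carried along for the induction. *)
Lemma radix_value_lexicographic k A d : (forall j, d j < p)%N -> (A < p ^ k)%N ->
  ((radix_value k d == A) = [forall i : 'I_k, d i == radix_digit k A i]) /\
  ((radix_value k d < A)%N = \sum_(j < k) (\prod_(i < k | (i < j)%N) (d i == radix_digit k A i) * (d j < radix_digit k A j)) :> nat)%N.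
Proof.
move=> dp; elim: k A => [|k IH] A.
  rewrite expn0 ltnS leqn0 => /eqP ->; rewrite /radix_value !big_ord0; split=> //.
  by rewrite eqxx; apply/esym/forallP => -[].
rewrite expnSr => Ak.
have Ak' : (A %/ p < p ^ k)%N by rewrite ltn_divLR.
have [IH1 IH2] := IH _ Ak'.
have ad (j : 'I_k) : radix_digit k.+1 A j = radix_digit k (A %/ p) j.
  rewrite /radix_digit -divnMA -expnS; congr ((_ %/ p ^ _) %% _)%N.
  by have := ltn_ord j; lia.
have ad' : radix_digit k.+1 A k = (A %% p)%N by rewrite /radix_digit subnn divn1.
have dk := dp k; rewrite radix_valueS.
have e1 : ((p * radix_value k d + d k)%N == A) = (radix_value k d == A %/ p)%N && (d k == A %% p)%N.
  apply/eqP/andP => [<-|[/eqP -> /eqP ->]].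
    by rewrite ![(p * _)%N]mulnC divnMDl // divn_small // addn0 modnMDl modn_small.
  by rewrite mulnC -divn_eq.
have e2 : (p * radix_value k d + d k < A)%N = (radix_value k d < A %/ p)%N || (radix_value k d == A %/ p)%N && (d k < A %% p)%N.
  have AE := divn_eq A p; have Am : (A %% p < p)%N by rewrite ltn_mod.
  move: AE Am; set a := (A %/ p)%N; set b := (A %% p)%N => AE Am.
  rewrite AE [(a * p)%N]mulnC; case: (ltngtP (radix_value k d) a) => h /=.
  - have : (p * (radix_value k d).+1 <= p * a)%N by rewrite leq_mul2l h orbT.
    rewrite mulnS; lia.
  - have : (p * a.+1 <= p * radix_value k d)%N by rewrite leq_mul2l h orbT.
    rewrite mulnS; lia.
  - by rewrite h ltn_add2l.
have fE : [forall i : 'I_k.+1, d i == radix_digit k.+1 A i] =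
    [forall i : 'I_k, d i == radix_digit k (A %/ p) i] && (d k == A %% p)%N.
  apply/forallP/andP => [h|[/forallP h1 h2] i].
    split; first by apply/forallP => i; have := h (widen_ord (leqnSn k) i); rewrite /= ad.
    by have := h ord_max; rewrite /= ad'.
  have [ik|ki] := ltnP i k; first by have := h1 (Ordinal ik); rewrite /= -(ad (Ordinal ik)).
  have -> : (i : nat) = k by apply/eqP; rewrite eqn_leq ki -ltnS ltn_ord.
  by rewrite ad'.
split; first by rewrite e1 IH1 fE.
rewrite e2 big_ord_recr /= ad'.
have -> : (\prod_(i < k.+1 | (i < k)%N) (d i == radix_digit k.+1 A i) = (radix_value k d == A %/ p)%N :> nat)%N.
  rewrite big_mkcond big_ord_recr /= ltnn muln1 IH1.
  rewrite (eq_bigr (fun i : 'I_k => (d i == radix_digit k (A %/ p) i : nat))); last first.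
    by move=> i _; rewrite /= ltn_ord ad.
  case: forallP => [h|/forallP]; first by rewrite big1 // => i _; rewrite h.
  by rewrite negb_forall => /existsP[i /negbTE hi]; rewrite (bigD1 i) //= hi mul0n.
have -> : (\sum_(i < k) \prod_(i0 < k.+1 | (i0 < i)%N) (d i0 == radix_digit k.+1 A i0) * (d i < radix_digit k.+1 A i)
    = (radix_value k d < A %/ p)%N :> nat)%N.
  rewrite IH2; apply: eq_bigr => j _; rewrite ad; congr (_ * _)%N.
  rewrite big_mkcond big_ord_recr /= [in LHS]ltnNge (ltnW (ltn_ord j)) /= muln1.
  by rewrite [RHS]big_mkcond /=; apply: eq_bigr => i _; rewrite ad.
by case: (ltngtP (radix_value k d) (A %/ p)%N) => //= h; rewrite ?mul0n ?mul1n.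
Qed.
End DigitOrder.

Section DigitSums.
Variables (p : nat) (C : numClosedFieldType) (omega : 'F_p -> C) (Lam : C).
Hypothesis p_pr : prime p.
Hypothesis omegaD : forall x y, omega (x + y) = omega x * omega y.
Hypothesis omega0 : omega 0 = 1.
Hypothesis norm_omega : forall x, `|omega x| = 1.
Hypothesis omega_nontrivial : exists x, omega x != 1.
Hypothesis Lam_bound : forall A : nat, (A < p)%N ->
  \sum_l `|\sum_(x : 'F_p | (x < A)%N) omega (l * x)| <= Lam.

Definition digit_fun k (d : {ffun 'I_k -> 'F_p}) (j : nat) : nat :=
  if insub j is Some i then d i else 0%N.

Lemma digit_funE k (d : {ffun 'I_k -> 'F_p}) (i : 'I_k) : digit_fun d i = d i.
Proof. by rewrite /digit_fun valK. Qed.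

Lemma Fp_lt (x : 'F_p) : (x < p)%N.
Proof. by have := ltn_ord x; rewrite [X in (_ < X)%N -> _]Fp_cast. Qed.

Lemma digit_fun_lt k (d : {ffun 'I_k -> 'F_p}) j : (digit_fun d j < p)%N.
Proof. by rewrite /digit_fun; case: insub => [i|]; rewrite ?Fp_lt ?prime_gt0. Qed.

(** For a fixed first differing digit j the sum factors. Summed over the frequencies, a digit before
    j is prescribed and gives at most p; a digit after j is free, so only frequency 0 survives,
    again giving p; digit j gives [Lam]. There are k choices of j. *)
Lemma digit_sum k A : (A < p ^ k)%N ->
  \sum_(l : {ffun 'I_k -> 'F_p})
    `|\sum_(d : {ffun 'I_k -> 'F_p} | (radix_value p k (digit_fun d) < A)%N) \prod_j omega (l j * d j)|
  <= (k * p ^ k.-1)%:R * Lam.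
Proof.
move=> Ak; have p0 := prime_gt0 p_pr.
pose a := radix_digit p k A.
pose phi (j i : 'I_k) (x : 'F_p) : bool :=
  if (i < j)%N then (x : nat) == a i else if i == j then (x < a j)%N else true.
have a_lt j : (a j < p)%N by rewrite /a /radix_digit ltn_mod.
have ind (d : {ffun 'I_k -> 'F_p}) :
    (radix_value p k (digit_fun d) < A)%N = (\sum_j \prod_i phi j i (d i))%N :> nat.
  have [_ ->] := radix_value_lexicographic p0 (digit_fun_lt d) Ak; apply: eq_bigr => j _.
  rewrite [in RHS](bigD1 j) //= /phi ltnn eqxx digit_funE mulnC; congr (_ * _)%N.
  rewrite [RHS](bigID (fun i : 'I_k => (i < j)%N)) /= [X in (_ * X)%N]big1 ?muln1.
    apply: eq_big => [i|i ij]; last by rewrite ij digit_funE.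
    by case: ltnP => [h|]; rewrite ?andbF // andbT -val_eqE /= ltn_eqF.
  by move=> i /andP[/negbTE -> /negbTE ->].
pose Phi j i l := \sum_x (phi j i x)%:R * omega (l * x).
have step l : \sum_(d : {ffun 'I_k -> 'F_p} | (radix_value p k (digit_fun d) < A)%N) \prod_j omega (l j * d j)
    = \sum_j \prod_i Phi j i (l i).
  transitivity (\sum_(d : {ffun 'I_k -> 'F_p}) \sum_j \prod_i ((phi j i (d i))%:R * omega (l i * d i))).
    rewrite big_mkcond /=; apply: eq_bigr => d _.
    transitivity ((radix_value p k (digit_fun d) < A)%N%:R * \prod_j omega (l j * d j)).
      by case: ifP => _; rewrite ?mul1r ?mul0r.
    rewrite ind natr_sum mulr_suml; apply: eq_bigr => j _.
    by rewrite natr_prod -big_split.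
  by rewrite exchange_big /=; apply: eq_bigr => j _; rewrite bigA_distr_bigA.
under eq_bigr do rewrite step.
apply: (@le_trans _ _ (\sum_(l : {ffun 'I_k -> 'F_p}) \sum_j \prod_i `|Phi j i (l i)|)).
  apply: ler_sum => l _; apply: le_trans (ler_norm_sum _ _ _) _.
  by apply: ler_sum => j _; rewrite normr_prod.
rewrite exchange_big /=.
under eq_bigr => j _ do rewrite -(bigA_distr_bigA (fun i x => `|Phi j i x|)).
have -> : (k * p ^ k.-1)%:R * Lam = \sum_(j < k) p%:R ^+ k.-1 * Lam.
  by rewrite sumr_const card_ord natrM natrX -mulrA mulr_natl.
apply: ler_sum => j _; rewrite (bigD1 j) //= mulrC.
have cp : #|'F_p| = p by apply: card_Fp.
have le1 i : i != j -> \sum_x `|Phi j i x| <= p%:R.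
  move=> ij; rewrite /Phi /phi (negbTE ij); case: ltnP => _.
    rewrite -[X in X%:R]cp -sum1_card natr_sum; apply: ler_sum => l _.
    apply: le_trans (ler_norm_sum _ _ _) _.
    under eq_bigr do rewrite normrM norm_omega mulr1 normr_nat.
    rewrite -natr_sum ler_nat.
    have [x0|no] := pickP (fun x : 'F_p => (x : nat) == a i).
      move=> /eqP x0E; rewrite (bigD1 x0) //= -x0E eqxx big1 // => x xx0.
      by rewrite val_eqE (negbTE xx0).
    by rewrite big1 // => x _; rewrite no.
  under eq_bigr do under eq_bigr do rewrite mul1r mulrC.
  under eq_bigr do rewrite (sum_char omegaD omega0 omega_nontrivial).
  rewrite (bigD1 0) //= ?eqxx normr_nat cp big1 ?addr0 // => l /negbTE ->.
  by rewrite normr0.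
have lej : \sum_x `|Phi j j x| <= Lam.
  apply: le_trans (Lam_bound (a_lt j)); rewrite le_eqVlt; apply/orP; left; apply/eqP.
  apply: eq_bigr => l _; congr `|_|; rewrite /Phi /phi ltnn eqxx [RHS]big_mkcond /=.
  by apply: eq_bigr => x _; case: ifP => _; rewrite ?mul1r ?mul0r.
apply: ler_pM => //; first by rewrite prodr_ge0 // => i _; rewrite sumr_ge0.
  by rewrite sumr_ge0.
have -> : p%:R ^+ k.-1 = \prod_(i < k | i != j) (p%:R : C).
  by rewrite prodr_const cardC1 card_ord.
by apply: ler_prod => i ij; rewrite le1 // sumr_ge0.
Qed.
End DigitSums.

Section BasisDigits.
Variables (p k : nat) (F : finFieldType) (charF : p \in [pchar F]).
Variable beta : k.+1.-tuple (pPrimeCharType charF).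
Hypotheses (p_pr : prime p) (cardF : #|F| = (p ^ k.+1)%N) (betaP : basis_of fullv beta).
Variables (C : numClosedFieldType) (omega : 'F_p -> C) (Lam : C).
Hypothesis omegaD : forall x y, omega (x + y) = omega x * omega y.
Hypothesis omega0 : omega 0 = 1.
Hypothesis norm_omega : forall x, `|omega x| = 1.
Hypothesis omega_nontrivial : exists x, omega x != 1.
Hypothesis Lam_bound : forall A : nat, (A < p)%N ->
  \sum_l `|\sum_(x : 'F_p | (x < A)%N) omega (l * x)| <= Lam.
Local Notation V := (pPrimeCharType charF).

(** Any nonzero linear form over F_p can replace the trace in a nontrivial character; a coordinate
    is at hand. *)
Definition basis_char (z : F) : C := omega (coord beta ord0 (z : V)).

Lemma basis_charD x y : basis_char (x + y) = basis_char x * basis_char y.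
Proof.
rewrite /basis_char -omegaD; congr omega.
exact: (linearD (coord beta ord0) (x : V) (y : V)).
Qed.

Lemma norm_basis_char x : `|basis_char x| = 1.
Proof. exact: norm_omega. Qed.

Lemma basis_coord (z : V) : z = \sum_j coord beta j z *: beta`_j.
Proof. exact: (coord_basis betaP (memvf z)). Qed.

Lemma coord_beta0 (a : 'F_p) : coord beta ord0 (a *: beta`_0) = a.
Proof.
rewrite linearZ /= (coord_free ord0 ord0) ?eqxx ?mulr1 //.
exact: basis_free betaP.
Qed.

Lemma basis_char_nontrivial : exists x, basis_char x != 1.
Proof.
have [x ox] := omega_nontrivial.
by exists (x *: beta`_0 : V); rewrite /basis_char coord_beta0.
Qed.

Lemma basis_char0 : basis_char 0 = 1.
Proof. by rewrite /basis_char (linear0 (coord beta ord0)). Qed.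

(** The coordinates of [h] in the basis dual to [beta] for the form sending (h, z) to the coordinate
    of index 0 of h z. *)
Definition dual_coord (h : F) : {ffun 'I_k.+1 -> 'F_p} :=
  [ffun j : 'I_k.+1 => coord beta ord0 ((h : V) * beta`_j : V)].

Definition digits (z : F) : {ffun 'I_k.+1 -> 'F_p} := [ffun j : 'I_k.+1 => coord beta j (z : V)].

Lemma coord_mul (h z : V) :
  coord beta ord0 (h * z) = \sum_j dual_coord h j * digits z j.
Proof.
rewrite {1}(basis_coord z) mulr_sumr linear_sum; apply: eq_bigr => j _.
by rewrite -scalerAr linearZ /= /dual_coord /digits !ffunE mulrC.
Qed.

Lemma basis_char_mul (h z : F) :
  basis_char (h * z) = \prod_j omega (dual_coord h j * digits z j).
Proof.
by rewrite -(big_morph omega omegaD omega0) -coord_mul.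
Qed.

Lemma card_digits : (#|{: {ffun 'I_k.+1 -> 'F_p}}| <= #|F|)%N.
Proof. by rewrite card_ffun card_Fp // card_ord cardF. Qed.

Lemma digits_bij : bijective digits.
Proof.
apply: inj_card_bij card_digits => x y /ffunP e.
rewrite [x]basis_coord [y]basis_coord; apply: eq_bigr => j _.
by have := e j; rewrite !ffunE => ->.
Qed.

(** The form is nondegenerate: h <> 0 pairs to 1 with h^-1 times the basis vector of index 0. *)
Lemma dual_coord_bij : bijective dual_coord.
Proof.
apply: inj_card_bij card_digits => x y /ffunP e.
apply/eqP; rewrite -subr_eq0; apply/negP => /negP nz.
have h : coord beta ord0 ((x - y : V) * ((x - y)^-1 * beta`_0 : V)) = 0.
  rewrite mulrBl linearB /= !coord_mul -sumrB big1 // => j _.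
  by rewrite (e j) subrr.
have := coord_beta0 1; rewrite scale1r => h1.
move: h; rewrite mulrA divff // mul1r h1 => /eqP.
by rewrite oner_eq0.
Qed.

(** q times a coordinate of the digital point; intervals [0, alpha) become initial segments of
    integers. *)
Definition digit_value (z : F) : nat := (\sum_j coord beta j (z : V) * p ^ (k - j))%N.

Lemma sum_fourier_coef_digits A : (A < p ^ k.+1)%N ->
  \sum_h `|fourier_coef basis_char (fun z => (digit_value z < A)%N) h| <= (k.+1 * p ^ k)%:R * Lam.
Proof.
move=> Ak.
have := digit_sum p_pr omegaD omega0 norm_omega omega_nontrivial Lam_bound Ak.
rewrite (reindex _ (onW_bij _ dual_coord_bij)) /=; apply: le_trans.
rewrite le_eqVlt; apply/orP; left; apply/eqP; apply: eq_bigr => h _; congr `|_|.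
rewrite [RHS](reindex _ (onW_bij _ digits_bij)) /fourier_coef /=.
apply: eq_big => [z|z _]; last exact: basis_char_mul.
congr (_ < _)%N; apply: eq_bigr => j _; rewrite digit_funE ffunE //.
Qed.
End BasisDigits.

(** * Roots of unity *)

Section LnBounds.
Variable R : realType.

Lemma ln_ge1BV (x : R) : 0 < x -> 1 - x^-1 <= ln x.
Proof.
move=> x0; have := @le_ln1Dx R (x^-1 - 1).
rewrite [1 + _]addrC subrK lnV ?posrE // ltrBrDr addNr invr_gt0 x0 => /(_ isT).
by rewrite lerNl opprB.
Qed.

Lemma harmonic_le_ln n : \sum_(l < n.+1) (l.+1%:R)^-1 <= 1 + ln (n.+1%:R : R).
Proof.
elim: n => [|n IH]; first by rewrite big_ord1 ln1 addr0 invr1.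
rewrite big_ord_recr /=; apply: le_trans (lerD IH (lexx _)) _.
rewrite -addrA lerD2l.
have := @ln_ge1BV (n.+2%:R / n.+1%:R) ltac:(by rewrite divr_gt0 // ltr0n).
rewrite ln_div ?posrE ?ltr0n // invf_div => h.
rewrite addrC -lerBrDr; apply: le_trans h.
have n2 : n.+2%:R != 0 :> R by rewrite pnatr_eq0.
rewrite le_eqVlt; apply/orP; left; apply/eqP.
by rewrite -[X in X - _](divff n2) -mulrBl -natrB // subSnn div1r.
Qed.

(** With the harmonic sum at most 1 + ln (p / 2), the claim reduces to 5 / 3 <= ln (2 p), which
    holds from ln 10 on; p = 3 is checked by itself. *)
Lemma digit_numeric p : prime p -> odd p ->
  1 + 3 / 2 * \sum_(l < p./2) (l.+1%:R)^-1 <= 3 * ln (p%:R : R).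
Proof.
move=> pr op.
(* Near 1 the bound 1 - 1 / x is accurate, so the logarithms of 2, 3 and 10 are assembled from such
   factors. *)
have L43 : (1 / 4 : R) <= ln (4 / 3).
  by apply: le_trans (@ln_ge1BV (4 / 3) _); lra.
have L32 : (1 / 3 : R) <= ln (3 / 2).
  by apply: le_trans (@ln_ge1BV (3 / 2) _); lra.
have L54 : (1 / 5 : R) <= ln (5 / 4).
  by apply: le_trans (@ln_ge1BV (5 / 4) _); lra.
have L2 : ln (4 / 3) + ln (3 / 2) = ln 2 :> R.
  by rewrite -lnM ?posrE; [congr ln; lra|lra|lra].
have L3 : ln 2 + ln (3 / 2) = ln 3 :> R.
  by rewrite -lnM ?posrE; [congr ln; lra|lra|lra].
have L10 : ln 2 + ln 2 + ln 2 + ln (5 / 4) = ln 10 :> R.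
  by rewrite -!lnM ?posrE; [congr ln; lra|lra..].
have [p5|p5] := leqP 5 p; last first.
  have -> : p = 3%N by case: p p5 pr op => [|[|[|[|[|]]]]].
  rewrite big_ord1 invr1; lra.
have pE := odd_double_half p; rewrite op /= in pE.
case pn : (p./2) => [|n]; first by move: p5; rewrite -pE pn.
have hn := harmonic_le_ln n.
have pp := prime_gt0 pr.
have p0 : (0 : R) < p%:R by rewrite ltr0n; lia.
have h1 : ln 2 + ln n.+1%:R <= ln (p%:R : R).
  rewrite -lnM ?posrE ?ltr0n // ler_ln ?posrE ?mulr_gt0 ?ltr0n //.
  by rewrite -natrM ler_nat -pE pn; lia.
have h2 : ln 10 <= ln 2 + ln (p%:R : R).
  rewrite -lnM ?posrE ?ltr0n // ler_ln ?posrE ?mulr_gt0 ?ltr0n //.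
  by rewrite -natrM ler_nat; lia.
lra.
Qed.
End LnBounds.

Section RootsOfUnity.
Variable R : realType.
Local Open Scope complex_scope.

Definition cis (t : R) : R[i] := cos t +i* sin t.

Lemma cisD s t : cis (s + t) = cis s * cis t.
Proof. by rewrite /cis cosD sinD; simpc; congr (_ +i* _); rewrite addrC. Qed.

Lemma cis0 : cis 0 = 1.
Proof. by rewrite /cis cos0 sin0. Qed.

Lemma cisMn t n : cis (t *+ n) = cis t ^+ n.
Proof. by elim: n => [|n IH]; rewrite ?mulr0n ?cis0 // mulrS cisD IH exprS. Qed.

Lemma norm_cis t : `|cis t| = 1.
Proof. by rewrite normc_def /= cos2Dsin2 sqrtr1. Qed.

Lemma cis_2pi : cis (pi *+ 2) = 1.
Proof. by rewrite /cis cos2pi -[pi *+ 2]add0r sinD2pi sin0. Qed.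

Lemma norm_expr_sub1 (x : R[i]) n : `|x| = 1 -> `|x ^+ n - 1| <= n%:R * `|x - 1|.
Proof.
move=> x1; rewrite subrX1 normrM mulrC ler_wpM2r //.
apply: le_trans (ler_norm_sum _ _ _) _.
by under eq_bigr do rewrite normrX x1 expr1n; rewrite sumr_const card_ord.
Qed.

Variable p : nat.
Hypothesis p_pr : prime p.

Definition zeta : R[i] := cis (pi *+ 2 / p%:R).

Lemma zeta_p : zeta ^+ p = 1.
Proof.
rewrite /zeta -cisMn -[_ *+ p]mulr_natr divfK ?cis_2pi //.
by rewrite pnatr_eq0 -lt0n prime_gt0.
Qed.

Lemma norm_zeta : `|zeta| = 1.
Proof. exact: norm_cis. Qed.

Lemma norm_zetaX n : `|zeta ^+ n| = 1.
Proof. by rewrite normrX norm_zeta expr1n. Qed.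

(** On the left half of the unit circle the distance to 1 is at least sqrt 2, for which 4 / 3 is a
    rational lower bound. *)
Lemma norm_sub1_ge (x : R[i]) : `|x| = 1 -> complex.Re x <= 0 -> 4 / 3 <= `|x - 1|.
Proof.
move=> x1 rx; rewrite -[leLHS]ger0_norm ?divr_ge0 // -ler_sqr ?nnegrE ?normr_ge0 //.
have : (complex.Re x ^+ 2 + complex.Im x ^+ 2)%:C = 1 :> R[i] by rewrite add_Re2_Im2 x1 expr1n.
case => e; rewrite -[X in _ <= X]add_Re2_Im2.
have -> : `|4 / 3 : R[i]| ^+ 2 = (16 / 9)%:C.
  by rewrite ger0_norm ?divr_ge0 // rmorphM fmorphV !rmorph_nat; field.
rewrite lecR; case: x x1 rx e => a b /= _ a0 e; rewrite subr0; nra.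
Qed.

(** Stands in for a lower bound of the sine: |x^j - 1| <= j |x - 1| on the unit circle, and j is
    such that x^j lies in the left half plane. *)
Lemma zeta_lower l : (0 < l)%N -> (2 * l <= p)%N ->
  4 / 3 <= (p %/ (2 * l))%:R * `|zeta ^+ l - 1|.
Proof.
move=> l0 lp; set j := (p %/ (2 * l))%N.
apply: le_trans (norm_expr_sub1 j (norm_zetaX l)).
rewrite -exprM; apply: norm_sub1_ge; first exact: norm_zetaX.
rewrite /zeta -cisMn /cis /=.
have p0 : (0 : R) < p%:R by rewrite ltr0n prime_gt0.
have j0 : (0 < j)%N by rewrite divn_gt0 ?muln_gt0.
(* j turns the angle 2 pi l / p into one between pi / 2 and pi. *)
have h1 : (2 * (l * j) <= p)%N by rewrite mulnA mulnC leq_trunc_div.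
have h2 : (p <= 4 * (l * j))%N.
  have := ltn_ceil p (_ : 0 < 2 * l)%N; rewrite muln_gt0 l0 -/j => /(_ isT).
  have : (l <= l * j)%N by rewrite leq_pmulr.
  nia.
set t := _ *+ _.
have tE : t = pi * ((2 * (l * j))%:R / p%:R).
  rewrite /t -mulr_natr natrM -mulr_natr; ring.
have t1 : t <= pi.
  by rewrite tE ler_piMr ?pi_ge0 // ler_pdivrMr // mul1r ler_nat.
have t2 : pi / 2 <= t.
  rewrite tE ler_pM2l ?pi_gt0 // ler_pdivlMr // mulrC ler_pdivrMr //.
  by rewrite -natrM ler_nat; lia.
have -> : t = pi - (pi - t) by rewrite opprB addrC subrK.
rewrite cosB cospi sinpi mul0r addr0 mulN1r oppr_le0.
apply: cos_ge0_pihalf; have := pi_gt0 R; lra.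
Qed.

Definition omega (x : 'F_p) : R[i] := zeta ^+ x.

Lemma omegaD x y : omega (x + y) = omega x * omega y.
Proof.
rewrite /omega -exprD /= -[RHS](expr_mod _ zeta_p); congr (_ ^+ (_ %% _)).
exact: Fp_cast.
Qed.

Lemma omega0 : omega 0 = 1.
Proof. exact: expr0. Qed.

Lemma norm_omega x : `|omega x| = 1.
Proof. exact: norm_zetaX. Qed.

Lemma omegaM l x : omega (l * x) = (zeta ^+ l) ^+ x.
Proof.
rewrite /omega -exprM /= -[RHS](expr_mod _ zeta_p); congr (_ ^+ (_ %% _)).
exact: Fp_cast.
Qed.

Lemma omega_nontrivial : exists x, omega x != 1.
Proof.
exists 1; rewrite /omega; have p2 := prime_gt1 p_pr.
have -> : nat_of_ord (1 : 'F_p) = 1%N by rewrite /= modn_small ?Fp_cast.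
rewrite expr1; apply/negP => /eqP z1.
have := zeta_lower (ltn0Sn 0) p2; rewrite expr1 z1 subrr normr0 mulr0.
by rewrite lt_geF // divr_gt0.
Qed.

Let geo A n := `|\sum_(i < A) (zeta ^+ n) ^+ i|.

Lemma geo_le A n : geo A n <= A%:R.
Proof.
apply: le_trans (ler_norm_sum _ _ _) _.
under eq_bigr do rewrite -exprM norm_zetaX.
by rewrite sumr_const card_ord.
Qed.

Lemma geo_le_inv A l : (0 < l)%N -> (2 * l <= p)%N ->
  `|zeta ^+ l - 1| * geo A l <= 2.
Proof.
move=> l0 lp; rewrite /geo -normrM -subrX1; apply: le_trans (ler_normB _ _) _.
by rewrite -exprM norm_zetaX normr1.
Qed.

Lemma geo_bound A l : (0 < l)%N -> (2 * l <= p)%N -> geo A l <= 3 / 4 * (p%:R / l%:R).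
Proof.
move=> l0 lp; have h1 := zeta_lower l0 lp; have h2 := geo_le_inv A l0 lp.
set j := (p %/ (2 * l))%N in h1.
have h3 : 4 / 3 * geo A l <= j%:R * 2.
  apply: le_trans (ler_wpM2r (normr_ge0 _) h1) _.
  by rewrite -mulrA ler_wpM2l ?ler0n.
have h4 : j%:R <= p%:R / (2 * l)%:R :> R[i].
  rewrite ler_pdivlMr ?ltr0n ?muln_gt0 // -natrM ler_nat; exact: leq_trunc_div.
have -> : geo A l = 3 / 4 * (4 / 3 * geo A l) by field.
rewrite ler_wpM2l ?divr_ge0 //; apply: le_trans h3 _.
apply: le_trans (ler_wpM2r _ h4) _ => //.
have ln0 : l%:R != 0 :> R[i] by rewrite pnatr_eq0 -lt0n.
rewrite natrM le_eqVlt; apply/orP; left; apply/eqP; by field.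
Qed.

(** The two sums are conjugate; reversing the summation shows that they differ by the factor zeta^(l
    (A - 1)), of modulus 1. *)
Lemma geo_sym A l : (l <= p)%N -> geo A (p - l) = geo A l.
Proof.
move=> lp; rewrite /geo.
case: A => [|A]; first by rewrite !big_ord0.
have zz : zeta ^+ (p - l) * zeta ^+ l = 1 by rewrite -exprD subnK // zeta_p.
rewrite -[LHS]mulr1 -[X in _ * X = _](norm_zetaX (l * A)) -normrM mulr_suml; congr `|_|.
rewrite (reindex_inj rev_ord_inj) /=; apply: eq_bigr => i _.
have -> : (l * A = l * (A.+1 - i.+1) + l * i)%N.
  by rewrite -mulnDr subSS subnK // -ltnS.
by rewrite exprD mulrA exprM -exprMn zz expr1n mul1r exprM.
Qed.

(** For odd p, l = 0 contributes at most p, and each pair l, p - l at most 2 (3 / 4) p / l, which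
    [digit_numeric] sums. For p = 2 the trivial bound is enough. *)
Lemma omega_sum_bound A : (A < p)%N ->
  \sum_l `|\sum_(x : 'F_p | (x < A)%N) omega (l * x)| <= (p%:R * (3 * ln p%:R))%:C.
Proof.
move=> Ap.
have cP : (Zp_trunc (pdiv p)).+2 = p by apply: Fp_cast.
have inner (l : 'F_p) : `|\sum_(x : 'F_p | (x < A)%N) omega (l * x)| = geo A l.
  rewrite /geo; have AP : (A <= (Zp_trunc (pdiv p)).+2)%N by rewrite cP ltnW.
  rewrite (big_ord_widen _ (fun i => (zeta ^+ l) ^+ i) AP) /=; congr `|_|.
  by apply: eq_bigr => x _; rewrite omegaM.
under eq_bigr do rewrite inner.
rewrite -(big_mkord xpredT (geo A)) cP big_mkord.
have p1 := prime_gt1 p_pr.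
have [op|ep] := boolP (odd p); last first.
  have p2 : p = 2%N by case/even_prime: p_pr => // op; rewrite op in ep.
  apply: (@le_trans _ _ (\sum_(i < p) A%:R)); first by apply: ler_sum => i _; apply: geo_le.
  rewrite sumr_const card_ord -[leLHS]mulr_natl rmorphM rmorph_nat /=.
  rewrite ler_wpM2l ?ler0n // -(rmorph_nat (real_complex R)) lecR.
  have : (A%:R : R) <= 1 by rewrite lern1; lia.
  have := @ln_ge1BV R 2 ltac:(lra); rewrite p2; lra.
have pE := odd_double_half p; rewrite op /= -addnn in pE.
have -> : \sum_(i < p) geo A i = geo A 0 + (\sum_(i < p./2) geo A i.+1 + \sum_(i < p./2) geo A i.+1).
  rewrite -(big_mkord xpredT (geo A)) -{1}pE big_mkord big_ord_recl; congr (_ + _).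
  rewrite big_split_ord /=; congr (_ + _).
  rewrite (reindex_inj rev_ord_inj) /=; apply: eq_bigr => i _.
  rewrite /bump /= -geo_sym; last by have := ltn_ord i; lia.
  by congr (geo A _); have := ltn_ord i; lia.
have h0 : geo A 0 <= p%:R by apply: le_trans (geo_le _ _) _; rewrite ler_nat ltnW.
have h1 : \sum_(i < p./2) geo A i.+1 <= (p%:R * (3 / 4 * \sum_(i < p./2) (i.+1%:R)^-1))%:C.
  rewrite !mulr_sumr rmorph_sum; apply: ler_sum => i _ /=.
  apply: le_trans (geo_bound A _ _) _ => //; first by have := ltn_ord i; lia.
  rewrite !rmorphM fmorphV !rmorph_nat fmorphV rmorph_nat /=.
  by rewrite le_eqVlt; apply/orP; left; apply/eqP; ring.
apply: le_trans (lerD h0 (lerD h1 h1)) _.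
rewrite -(rmorph_nat (real_complex R)) -!rmorphD lecR /=.
have := digit_numeric R p_pr op.
have p0 : (0 : R) <= p%:R by rewrite ler0n.
set H := \sum_(l < p./2) _ => dn.
have -> : p%:R + (p%:R * (3 / 4 * H) + p%:R * (3 / 4 * H)) = p%:R * (1 + 3 / 2 * H) by field.
by rewrite ler_wpM2l.
Qed.
End RootsOfUnity.

(** * The local discrepancy *)

Section Complex.
Variable R : realType.
Local Open Scope complex_scope.

Lemma expr_unbounded (x y : R) : 1 < x -> exists n, y < x ^+ n.
Proof.
move=> x1; have d0 : 0 < x - 1 by rewrite subr_gt0.
have bern n : 1 + n%:R * (x - 1) <= x ^+ n.
  elim: n => [|n IH]; first by rewrite mul0r addr0.
  rewrite exprS; apply: le_trans (ler_wpM2l (ltW (lt_trans ltr01 x1)) IH).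
  have n0 : 0 <= n%:R * (x - 1) * (x - 1) by rewrite !mulr_ge0 ?ler0n // ltW.
  rewrite -natr1; nra.
have [n hn] : exists n : nat, y / (x - 1) < n%:R.
  exists (Num.bound `|y / (x - 1)|).
  exact: le_lt_trans (ler_norm _) (archi_boundP (normr_ge0 _)).
exists n; apply: lt_le_trans (bern n).
by rewrite ltr_pdivrMr // in hn; lra.
Qed.

Lemma complex_expr_unbounded (x y : R[i]) : 1 < x -> 0 <= y -> exists n, y < x ^+ n.
Proof.
move=> x1 y0; have xr : x \is Num.real by apply: gtr0_real (lt_trans ltr01 x1).
have yr : y \is Num.real by apply: ger0_real.
move: xr x1 => /complex_realP[a ->]; move: yr y0 => /complex_realP[b ->] _.
rewrite -[1]/(1%:C) ltcR => a1; have [n hn] := expr_unbounded b a1.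
by exists n; rewrite -rmorphXn ltcR.
Qed.

Lemma norm_real_complex (x : R) : `|x%:C| = `|x|%:C.
Proof. by rewrite normc_def /= expr0n addr0 sqrtr_sqr. Qed.

Lemma sqrtC_nat (n : nat) : sqrtC (n%:R : R[i]) = (Num.sqrt (n%:R : R))%:C.
Proof.
apply: (@pexpIrn _ 2) => //; rewrite ?qualifE /= ?sqrtC_ge0 ?ler0n ?ler0c ?sqrtr_ge0 //.
by rewrite sqrtCK -rmorphXn sqr_sqrtr ?ler0n // rmorph_nat.
Qed.
End Complex.

Section ProductDifference.
Variable R : realType.
Lemma prod_diff_le (I : finType) (x y : I -> R) :
  (forall i, 0 <= x i <= 1) -> (forall i, 0 <= y i <= 1) ->
  `|\prod_i x i - \prod_i y i| <= \sum_i `|x i - y i|.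
Proof.
move=> hx hy.
suff [h _ _] : [/\ `|\prod_i x i - \prod_i y i| <= \sum_i `|x i - y i|,
   0 <= \prod_i x i <= 1 & 0 <= \prod_i y i <= 1] by [].
rewrite -!big_enum /=; elim: (enum I) => [|i s [IH hX hY]].
  by rewrite !big_nil subrr normr0 ler01; split; rewrite ?lexx.
rewrite !big_cons; move: (\prod_(j <- s) x j) (\prod_(j <- s) y j) IH hX hY => X Y IH hX hY.
have hxi := hx i; have hyi := hy i; split.
- have -> : x i * X - y i * Y = (x i - y i) * X + y i * (X - Y) by ring.
  apply: le_trans (ler_normD _ _) _; rewrite !normrM; apply: lerD.
    by rewrite ler_piMr // ger0_norm; case/andP: hX.
  apply: le_trans IH; rewrite ler_piMl // ger0_norm; by case/andP: hyi.
- by case/andP: hxi => h1 h2; case/andP: hX => h3 h4; rewrite mulr_ge0 // mulr_ile1.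
- by case/andP: hyi => h1 h2; case/andP: hY => h3 h4; rewrite mulr_ge0 // mulr_ile1.
Qed.

(** [A] is the ceiling of [x]. With x = alpha q, a point N / q lies below alpha exactly when N < A:
    rounding changes the volume of a box but not its count. *)
Lemma nat_threshold (x : R) (n : nat) : 0 <= x <= n%:R ->
  exists A, [/\ (A <= n)%N, forall N, (N < A)%N = (N%:R < x) & x <= A%:R <= x + 1].
Proof.
move=> /andP[x0 xn].
have ex : exists A, x <= A%:R by exists n.
case: (ex_minnP ex) => A xA Amin; exists A; split; first exact: Amin.
  move=> N; apply/idP/idP => [NA|Nx].
    by rewrite ltNge; apply/negP => /Amin; rewrite leqNgt NA.
  by rewrite -(ltr_nat R); apply: lt_le_trans xA.
rewrite xA /=; case: A xA Amin => [|A] _ Amin; first by rewrite addr_ge0.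
rewrite -natr1 lerD2r leNgt; apply/negP => /ltW /Amin.
by rewrite ltnn.
Qed.
End ProductDifference.

Section CoreDiscrepancy.
Variables (R : realType) (p k : nat) (F : finFieldType) (charF : p \in [pchar F]).
Variable beta : k.+1.-tuple (pPrimeCharType charF).
Hypotheses (p_pr : prime p) (cardF : #|F| = (p ^ k.+1)%N) (betaP : basis_of fullv beta).
Local Notation q := #|F|.
Local Notation N := (digit_value beta).

Lemma digit_valueE z : N z = radix_value p k.+1 (digit_fun (digits beta z)).
Proof. by apply: eq_bigr => j _; rewrite digit_funE ffunE. Qed.

Lemma digit_value_lt z : (N z < q)%N.
Proof.
rewrite digit_valueE cardF; have := digit_fun_lt p_pr (digits beta z).
move: (digit_fun _) => d dp; elim: k.+1 => [|n IH]; first by rewrite /radix_value big_ord0.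
rewrite (radix_valueS (prime_gt0 p_pr)) expnS; have := dp n.
have : (p * (radix_value p n d).+1 <= p * p ^ n)%N by rewrite leq_mul2l IH orbT.
rewrite mulnS; lia.
Qed.

Lemma digit_value_inj : injective N.
Proof.
move=> x y e; apply: (bij_inj (digits_bij p_pr cardF betaP)).
have := digit_value_lt x; rewrite cardF => lt.
have p0 := prime_gt0 p_pr.
have [hx _] := radix_value_lexicographic p0 (digit_fun_lt p_pr (digits beta x)) lt.
have [hy _] := radix_value_lexicographic p0 (digit_fun_lt p_pr (digits beta y)) lt.
rewrite -digit_valueE eqxx in hx; rewrite -digit_valueE e eqxx in hy.
apply/ffunP => j; apply: val_inj => /=.
move/esym/forallP/(_ j)/eqP: hx; move/esym/forallP/(_ j)/eqP: hy.
by rewrite !digit_funE e => -> ->.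
Qed.

Lemma card_digit_value A : (A <= q)%N -> #|[pred z | (N z < A)%N]| = A.
Proof.
move=> Aq; pose f (z : F) : 'I_q := Ordinal (digit_value_lt z).
have finj : injective f by move=> x y /(congr1 val)/digit_value_inj.
have [g fg gf] := inj_card_bij finj (eq_leq (card_ord q)).
pose h (i : 'I_A) := g (widen_ord Aq i).
have hinj : injective h by move=> i j /(can_inj gf)/(congr1 val)/= ij; apply: val_inj.
rewrite -[RHS](card_ord A) -(card_codom hinj); apply: eq_card => z; rewrite !inE.
apply/idP/codomP => [zA|[i ->]].
  by exists (Ordinal zA); rewrite /h -[LHS]fg; congr g; exact: val_inj.
by have := congr1 val (gf (widen_ord Aq i)) => /= ->.
Qed.

Lemma digital_coordE (s : nat) (I : finType) (z : I -> 'rV[F]_s) n i :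
  digital_point_set R beta z n 0 i = (N (z n 0 i))%:R / q%:R.
Proof.
rewrite mxE /digit_value natr_sum mulr_suml; apply: eq_bigr => j _; rewrite /digit.
have p0 : p%:R != 0 :> R by rewrite pnatr_eq0 -lt0n prime_gt0.
rewrite natrM -mulrA cardF; congr (_ * _).
have -> : (p ^ k.+1 = p ^ ((k - j) + j.+1))%N.
  by congr (_ ^ _)%N; have := ltn_ord j; lia.
by rewrite expnD natrM !natrX invfM mulrA divff ?mul1r // expf_neq0.
Qed.

Let X : R := 3 * ln q%:R.

(** Allows the trivial bound q of a full interval and the rounding error to be absorbed into powers
    of [X]. *)
Lemma ln_card_ge1 : 1 <= X.
Proof.
have q2 : (2 <= q)%N := finNzRing_gt1 F.
have : (ln 2 : R) <= ln q%:R by rewrite ler_ln ?posrE ?ltr0n ?ler_nat //; lia.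
by have := @ln_ge1BV R 2 ltac:(lra); rewrite /X; lra.
Qed.

Local Open Scope complex_scope.
Let psi : F -> R[i] := basis_char beta (@omega R p).

(** With 3 p ln p for one digit, all the digits give 3 q ln q, because ln q is the number of digits
    times ln p. The value A = q has one digit too many and is the full set. *)
Lemma sum_fourier_coef_le A : (A <= q)%N ->
  \sum_h `|fourier_coef psi (fun z => (N z < A)%N) h| <= (q%:R * X)%:C.
Proof.
rewrite leq_eqVlt => /orP[/eqP ->|Aq].
  have e : (fun z => (N z < q)%N) =1 predT by move=> z; rewrite digit_value_lt.
  under eq_bigr do rewrite (eq_fourier_coef psi e).
  rewrite (eq_bigr (fun h : F => (if h == 0 then q%:R else 0))); last first.
    move=> h _; rewrite fourier_coef_all.
    - by case: ifP => _; rewrite ?normr_nat ?normr0.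
    - exact: basis_charD (omegaD R p_pr).
    - exact: basis_char0 (omega0 R p).
    - exact: basis_char_nontrivial betaP _ _ (omega_nontrivial R p_pr).
  rewrite -big_mkcond big_pred1_eq -(rmorph_nat (real_complex R)) lecR.
  by rewrite ler_peMr ?ler0n ?ln_card_ge1.
rewrite cardF in Aq.
have := sum_fourier_coef_digits p_pr cardF betaP (omegaD R p_pr) (omega0 R p) (norm_omega R (p:=p))
   (omega_nontrivial R p_pr) (fun A => omega_sum_bound R p_pr (A:=A)) Aq.
move=> h; apply: le_trans h _; rewrite -(rmorph_nat (real_complex R)) -rmorphM lecR.
rewrite /X cardF natrX lnXn ?ltr0n ?prime_gt0 // natrM natrX exprSr.
by rewrite -[_ *+ _]mulr_natl le_eqVlt; apply/orP; left; apply/eqP; ring.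
Qed.

(** In the constant 5, 4 comes from the character sums and 1 from rounding the sides up to multiples
    of 1 / q, which moves the volume by at most [#|u|] / q. Outside [u] the threshold is q, so
    nothing is rounded there. *)
Lemma core_discrepancy (s : nat) (v : 'I_s -> F) (u : {set 'I_s}) (alpha : 'rV[R]_s) :
  injective v -> (forall i, 0 <= alpha 0 i <= 1) ->
  `|local_discrepancy (explicit_inversive_points R beta v) (pad1 u alpha)|
    <= 5 * #|u|%:R * X ^+ #|u| / Num.sqrt q%:R.
Proof.
move=> vinj halpha; pose a i := pad1 u alpha 0 i; pose m := #|u|.
have q1 : (1 < q)%N := finNzRing_gt1 F.
have q0 : (0 : R) < q%:R by rewrite ltr0n ltnW.
have qn0 : q%:R != 0 :> R by rewrite gt_eqF.
have ha i : 0 <= a i <= 1 by rewrite /a mxE; case: ifP => _; rewrite ?halpha ?ler01 ?lexx.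
have hau i : i \notin u -> a i = 1 by move=> iu; rewrite /a mxE (negbTE iu).
have thr i : exists A, [/\ (A <= q)%N, forall n, (n < A)%N = (n%:R < a i * q%:R) &
    a i * q%:R <= A%:R <= a i * q%:R + 1].
  apply: nat_threshold; case/andP: (ha i) => h1 h2.
  by rewrite mulr_ge0 ?ler0n //= ler_piMl ?ler0n.
have [A AP] := choice thr.
have Aq i : (A i <= q)%N by have [] := AP i.
have AN i n : (n < A i)%N = (n%:R < a i * q%:R) by have [_ + _] := AP i; apply.
have Au i : i \notin u -> A i = q.
  move=> iu; apply/eqP; rewrite eqn_leq Aq /=; have [_ _ /andP[+ _]] := AP i.
  by rewrite (hau i iu) mul1r ler_nat.
pose z n i := (n + v i)^-1 : F.
pose cnt := #|[pred n | [forall i, (N (z n i) < A i)%N]]|.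
have ldE : local_discrepancy (explicit_inversive_points R beta v) (pad1 u alpha) =
    cnt%:R / q%:R - \prod_i a i.
  rewrite /local_discrepancy; congr (_%:R / _ - _); apply: eq_card => n; rewrite !inE.
  apply: eq_forallb => i; rewrite /explicit_inversive_points digital_coordE mxE AN.
  by rewrite divr_ge0 ?ler0n //= ltr_pdivrMr.
pose B i (x : F) := (N x < A i)%N.
have psiD : forall x y, psi (x + y) = psi x * psi y by exact: basis_charD (omegaD R p_pr).
have psi0 : psi 0 = 1 by exact: basis_char0 (omega0 R p).
have psi1 : forall x, `|psi x| = 1 by exact: norm_basis_char (norm_omega R (p:=p)).
have psin : exists x, psi x != 1 by exact: basis_char_nontrivial betaP _ _ (omega_nontrivial R p_pr).
pose W : R := (4 * m)%:R * Num.sqrt q%:R.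
have WE : W%:C = (4 * m)%:R * sqrtC q%:R by rewrite /W rmorphM rmorph_nat sqrtC_nat.
have W0 : 0 <= W%:C by rewrite ler0c /W mulr_ge0 ?ler0n ?sqrtr_ge0.
have := @fourier_count F _ psi psiD psi0 psin 'I_s F B z u W%:C W0.
have hB i : i \notin u -> B i =1 predT.
  by move=> iu x; rewrite /B Au // digit_value_lt.
have hW h : (exists i, h i != 0) -> (forall i, i \notin u -> h i = 0) ->
    `|\sum_n psi (\sum_i h i * z n i)| <= W%:C.
  by move=> h1 h2; rewrite WE; apply: inversive_sum_bound => //; apply: complex_expr_unbounded.
move=> /(_ hB hW); rewrite card_ord -/cnt.
have -> : \prod_i #|B i|%:R = (\prod_i (A i)%:R : R)%:C.
  rewrite rmorph_prod; apply: eq_bigr => i _.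
  by rewrite card_digit_value // rmorph_nat.
rewrite -!(rmorph_nat (real_complex R)) -rmorphXn -!rmorphM -rmorphB norm_real_complex => h.
have X1 := ln_card_ge1; have X0 : 0 <= X by apply: le_trans X1.
have hprod : \prod_i \sum_h `|fourier_coef psi (B i) h| <= (q%:R ^+ s * X ^+ m : R)%:C.
  have -> : q%:R ^+ s * X ^+ m = \prod_(i < s) (if i \in u then q%:R * X else q%:R).
    rewrite (bigID (mem u)) /= (eq_bigr (fun _ => q%:R * X)); last by move=> i ->.
    rewrite prodr_const (eq_bigr (fun _ => q%:R)); last by move=> i /negbTE ->.
    rewrite prodr_const [(q%:R * X) ^+ _]exprMn mulrAC -exprD; congr (_ ^+ _ * _).
    by rewrite -[LHS](card_ord s) -(cardC (mem u)).
  rewrite rmorph_prod; apply: ler_prod => i _; rewrite sumr_ge0 //=.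
  case: ifP => iu; first exact: sum_fourier_coef_le.
  under eq_bigr do rewrite (eq_fourier_coef psi (hB i (negbT iu))) (fourier_coef_all psiD psi0 psin).
  rewrite (bigD1 0) //= eqxx normr_nat big1 ?addr0 ?rmorph_nat //.
  by move=> h' /negbTE ->; rewrite normr0.
have h2 : `|q%:R ^+ s * cnt%:R - q%:R * \prod_i (A i)%:R| <= W * (q%:R ^+ s * X ^+ m).
  rewrite -lecR; apply: le_trans h _.
  rewrite (rmorphM (real_complex R) W); exact: (ler_wpM2l W0 hprod).
have E1 : cnt%:R / q%:R - \prod_i ((A i)%:R / q%:R) =
    (q%:R ^+ s * cnt%:R - q%:R * \prod_i (A i)%:R) / (q%:R ^+ s * q%:R) :> R.
  rewrite prodf_div prodr_const card_ord; field.
  by rewrite qn0 expf_neq0.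
have sq0 : 0 < Num.sqrt q%:R :> R by rewrite sqrtr_gt0.
have sq2 : q%:R = Num.sqrt q%:R * Num.sqrt q%:R :> R by rewrite -expr2 sqr_sqrtr ?ler0n.
have le1 : `|cnt%:R / q%:R - \prod_i ((A i)%:R / q%:R)| <= 4 * m%:R * X ^+ m / Num.sqrt q%:R.
  rewrite E1 normrM normfV [X in _ / X]ger0_norm ?mulr_ge0 ?exprn_ge0 ?ler0n //.
  rewrite ler_pdivrMr ?mulr_gt0 ?exprn_gt0 //; apply: le_trans h2 _.
  rewrite le_eqVlt; apply/orP; left; apply/eqP; rewrite /W natrM [X in _ = _ * (_ * X)]sq2.
  by field; rewrite gt_eqF.
have le2 : `|\prod_i ((A i)%:R / q%:R) - \prod_i a i| <= m%:R / q%:R :> R.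
  have hAq i : 0 <= ((A i)%:R / q%:R : R) <= 1.
    by rewrite divr_ge0 ?ler0n //= ler_pdivrMr // mul1r ler_nat.
  apply: le_trans (prod_diff_le hAq ha) _.
  rewrite (bigID (mem u)) /= [X in _ + X]big1 ?addr0; last first.
    by move=> i iu; rewrite Au // hau // divff // subrr normr0.
  apply: (@le_trans _ _ (\sum_(i in u) q%:R^-1)); last by rewrite sumr_const -[leLHS]mulr_natl.
  apply: ler_sum => i _; have [_ _ /andP[h3 h4]] := AP i.
  have -> : (A i)%:R / q%:R - a i = ((A i)%:R - a i * q%:R) / q%:R by field.
  rewrite normrM [X in _ * X]ger0_norm ?invr_ge0 ?ler0n // ler_piMl ?invr_ge0 ?ler0n //.
  by rewrite ger0_norm ?subr_ge0 // lerBlDl.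
have Xm : 1 <= X ^+ m by rewrite exprn_ege1.
have sq1 : 1 <= Num.sqrt q%:R :> R by rewrite -[leLHS]sqrtr1 ler_wsqrtr // ler1n ltnW.
have le3 : m%:R / q%:R <= m%:R * X ^+ m / Num.sqrt q%:R.
  rewrite -mulrA ler_wpM2l ?ler0n //; apply: (@le_trans _ _ (1 / Num.sqrt q%:R)).
    by rewrite div1r lef_pV2 ?posrE // [leRHS]sq2 ler_peMr // ltW.
  by rewrite ler_wpM2r // invr_ge0 ltW.
rewrite ldE -(subrKA (\prod_i ((A i)%:R / q%:R))).
apply: le_trans (ler_normD _ _) _; apply: le_trans (lerD le1 (le_trans le2 le3)) _.
rewrite le_eqVlt; apply/orP; left; apply/eqP; rewrite -/m; field.
by rewrite gt_eqF.
Qed.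
End CoreDiscrepancy.

(** * The weights *)

Section WeightProducts.
Variable R : realType.

(** The factors with index at most Y multiply to some Y^n / n!, a term of the exponential series;
    the others are 1. *)
Lemma prod_max_le_expR (Y : R) (s : nat) : 0 <= Y ->
  \prod_(i < s) Num.max 1 (Y / i.+1%:R) <= expR Y.
Proof.
move=> Y0.
have expge n : Y ^+ n / n`!%:R <= expR Y.
  case: n => [|n]; first by rewrite expr0 fact0 invr1 mulr1 -expR0 ler_expR.
  by apply: le_trans (expR_ge1Dxn n Y0); rewrite lerDr.
suff [h1 h2] : (s%:R <= Y -> \prod_(i < s) Num.max 1 (Y / i.+1%:R) = Y ^+ s / s`!%:R) /\
   \prod_(i < s) Num.max 1 (Y / i.+1%:R) <= expR Y by [].
elim: s => [|s [IH1 IH2]].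
  rewrite big_ord0; split=> [_|]; first by rewrite expr0 fact0 invr1 mulr1.
  by rewrite -expR0 ler_expR.
have full : s.+1%:R <= Y -> \prod_(i < s.+1) Num.max 1 (Y / i.+1%:R) = Y ^+ s.+1 / s.+1`!%:R.
  move=> sY; rewrite big_ord_recr /= IH1; last by rewrite (le_trans _ sY) // ler_nat.
  rewrite max_r; last by rewrite ler_pdivlMr ?ltr0n // mul1r.
  by rewrite factS natrM exprSr invfM mulrACA [in RHS]mulrC mulrA mulrACA [in RHS]mulrC; ring.
split=> //; have [sY|Ys] := lerP s.+1%:R Y; first by rewrite full // expge.
by rewrite big_ord_recr /= max_l ?mulr1 // ler_pdivrMr ?ltr0n // mul1r ltW.
Qed.

Lemma prod_if_lt_le (M : R) (J s : nat) : 1 <= M ->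
  \prod_(i < s) (if (i < J)%N then M else 1) <= M ^+ J.
Proof.
move=> M1.
have -> : \prod_(i < s) (if (i < J)%N then M else 1) = M ^+ (minn s J).
  elim: s => [|s IH]; first by rewrite big_ord0 min0n.
  rewrite big_ord_recr /= IH; have [h|] := boolP (s < J)%N.
    by rewrite (minn_idPl (ltnW h)) (minn_idPl h) exprSr.
  rewrite -leqNgt => h.
  by rewrite (minn_idPr h) (minn_idPr (leqW h)) mulr1.
by apply: ler_weXn2l => //; exact: geq_minr.
Qed.

Lemma bernoulli_div (eps : R) n : 0 < eps -> n%:R <= (1 + eps) ^+ n / eps.
Proof.
move=> e0; rewrite ler_pdivlMr //.
suff : 1 + n%:R * eps <= (1 + eps) ^+ n by apply: le_trans; rewrite lerDr.
elim: n => [|n IH]; first by rewrite mul0r addr0.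
rewrite exprS; apply: le_trans (ler_wpM2l (_ : 0 <= 1 + eps) IH); last by lra.
have : 0 <= n%:R * eps * eps by rewrite !mulr_ge0 ?ler0n // ltW.
rewrite -natr1; nra.
Qed.

Lemma ln_le_powR (a x : R) : 0 < a -> 0 < x -> ln x <= a^-1 * x `^ a.
Proof.
move=> a0 x0; rewrite mulrC ler_pdivlMr // mulrC -ln_powR; apply: ltW.
by apply: ln_sublinear; apply: powR_gt0.
Qed.

Variable gamma : nat -> R.
Hypothesis gamma_ge0 : forall j : nat, (1 <= j)%N -> 0 <= gamma j.
Hypothesis gamma_noninc : forall j : nat, (1 <= j)%N -> gamma j.+1 <= gamma j.

Lemma gamma_le_first j : gamma j.+1 <= gamma 1%N.
Proof. by elim: j => [//|j IH]; apply: le_trans IH; apply: gamma_noninc. Qed.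

(** [theta] is the midpoint of [d] and the supremum of a tail. It is positive even when the limsup
    is 0, so that one can divide by it. *)
Lemma eventually_le (d : R) :
  (limn_esup (fun j : nat => (j%:R * gamma j)%:E) < d%:E)%E ->
  exists2 theta : R, 0 < theta < d & exists J : nat,
    forall j : nat, (J <= j)%N -> j%:R * gamma j <= theta.
Proof.
rewrite /limn_esup /limf_esup => /ereal_inf_lt[_ [V [J _ JV] <-]] lt.
have le j : (J <= j)%N ->
    ((j%:R * gamma j)%:E <= ereal_sup [set (j%:R * gamma j)%:E | j in V])%E.
  by move=> Jj; apply: ereal_sup_ubound; exists j => //; apply: JV.
have pos j : 0 <= j%:R * gamma j.
  by case: j => [|j]; rewrite ?mul0r // mulr_ge0 ?ler0n ?gamma_ge0.
move: lt le; case: (ereal_sup _) => [s||] // lt le; last first.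
  by have := le J (leqnn J).
rewrite lte_fin in lt; have s0 : 0 <= s.
  by apply: le_trans (pos J) _; rewrite -lee_fin le.
exists ((s + d) / 2); first by apply/andP; split; lra.
exists J => j /le; rewrite lee_fin => h; apply: le_trans h _; lra.
Qed.

(** Replacing each factor by its maximum with 1 bounds the product over [u] by one over all
    coordinates, and that one is bounded independently of s. *)
Lemma weight_product_bound (d : R) : 0 < d ->
  (limn_esup (fun j : nat => (j%:R * gamma j)%:E) < (d / 3)%:E)%E ->
  exists2 c : R, 0 < c & forall (q s : nat) (u : {set 'I_s}), (1 < q)%N ->
    #|u|%:R * \prod_(j in u) (gamma j.+1 * (3 * ln q%:R)) <= c * q%:R `^ d.
Proof.
move=> d0 /eventually_le[theta /andP[t0 td] [J hJ]].
(* Makes (1 + eps) 3 theta the midpoint [d'] of 3 theta and d; the remaining [eta] is kept for the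
   powers of ln q. *)
pose eps : R := (d - 3 * theta) / (6 * theta).
have e0 : 0 < eps by rewrite divr_gt0 //; lra.
pose d' : R := (d + 3 * theta) / 2.
have d'E : (1 + eps) * (3 * theta) = d' by rewrite /eps /d'; field; rewrite gt_eqF.
have d'0 : 0 < d' by rewrite /d'; lra.
pose eta : R := d - d'.
have eta0 : 0 < eta by rewrite /eta /d'; lra.
(* J factors q^a stay within q^eta; the successor avoids dividing by 0. *)
pose a : R := eta / J.+1%:R.
have a0 : 0 < a by rewrite divr_gt0 ?ltr0n.
have g0 : 0 <= gamma 1%N by apply: gamma_ge0.
pose K : R := (1 + eps) * gamma 1%N * 3.
have K0 : 0 <= K by rewrite !mulr_ge0 //; lra.
have Ka : 0 < 1 + K / a by rewrite ltr_pwDl // divr_ge0 // ltW.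
exists (eps^-1 * (1 + K / a) ^+ J) => [|q s u q1].
  by rewrite mulr_gt0 ?invr_gt0 ?exprn_gt0.
have q0 : (0 : R) < q%:R by rewrite ltr0n; lia.
have q1' : (1 : R) <= q%:R by rewrite ler1n; lia.
have ln0 : 0 <= ln q%:R :> R by apply: ln_ge0.
pose t (i : nat) : R := (1 + eps) * (gamma i.+1 * (3 * ln q%:R)).
have tpos i : 0 <= t i by rewrite /t !mulr_ge0 ?gamma_ge0 //; lra.
pose Y : R := d' * ln q%:R.
have Y0 : 0 <= Y by rewrite mulr_ge0 // ltW.
pose M : R := Num.max 1 (K * ln q%:R).
have M1 : 1 <= M by rewrite le_max lexx.
(* Bernoulli's inequality absorbs the factor #|u|; the indices below J only
   contribute a power of ln q, and the others a factor (Y / j). *)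
have step1 : #|u|%:R * \prod_(j in u) (gamma j.+1 * (3 * ln q%:R)) <=
    eps^-1 * \prod_(j in u) t j.
  have -> : \prod_(j in u) t j = (1 + eps) ^+ #|u| * \prod_(j in u) (gamma j.+1 * (3 * ln q%:R)).
    by rewrite -prodr_const -big_split.
  rewrite mulrA ler_wpM2r //.
    by rewrite prodr_ge0 // => i _; rewrite !mulr_ge0 ?gamma_ge0 //; lra.
  by rewrite mulrC; apply: bernoulli_div.
have tmax (i : nat) : Num.max 1 (t i) <= (if (i < J)%N then M else 1) * Num.max 1 (Y / i.+1%:R).
  case: ltnP => iJ.
    apply: (@le_trans _ _ M); last by rewrite ler_peMr ?(le_trans ler01) // le_max lexx.
    rewrite /M ge_max !le_max lexx /=; apply/orP; right.
    rewrite /t /K -!mulrA ler_wpM2l; [|lra|].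
      by [].
    by rewrite ler_wpM2r ?gamma_le_first // mulr_ge0.
  rewrite mul1r ge_max !le_max lexx /=; apply/orP; right.
  rewrite ler_pdivlMr ?ltr0n //.
  have := hJ i.+1 (leqW iJ) => h.
  have -> : t i * i.+1%:R = (1 + eps) * (3 * ln q%:R) * (i.+1%:R * gamma i.+1) by rewrite /t; ring.
  have -> : Y = (1 + eps) * (3 * ln q%:R) * theta by rewrite /Y -d'E; ring.
  by rewrite ler_wpM2l // !mulr_ge0 //; lra.
have step2 : \prod_(j in u) t j <= M ^+ J * expR Y.
  apply: (@le_trans _ _ (\prod_(j < s) Num.max 1 (t j))).
    rewrite [leRHS](bigID (mem u)) /= -[leLHS]mulr1; apply: ler_pM => //.
    - by rewrite prodr_ge0.
    - by apply: ler_prod => i _; rewrite tpos /= le_max lexx orbT.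
    - apply: (big_ind (fun x : R => 1 <= x)) => // [x y|i _]; first exact: mulr_ege1.
      by rewrite le_max lexx.
  apply: (@le_trans _ _ (\prod_(i < s) ((if (i < J)%N then M else 1) * Num.max 1 (Y / i.+1%:R)))).
    by apply: ler_prod => i _; rewrite tmax andbT le_max ler01.
  rewrite big_split /=; apply: ler_pM.
  - by rewrite prodr_ge0 // => i _; case: ifP => _; rewrite ?ler01 // (le_trans ler01).
  - by rewrite prodr_ge0 // => i _; rewrite le_max ler01.
  - exact: prod_if_lt_le.
  - exact: prod_max_le_expR.
have qa1 : 1 <= q%:R `^ a :> R by rewrite -[leLHS](powRr0 q%:R) ler_powR // ltW.
have Mle : M <= (1 + K / a) * q%:R `^ a.
  rewrite /M ge_max; apply/andP; split.
    by apply: le_trans qa1 _; rewrite ler_peMl ?powR_ge0 // lerDl divr_ge0 // ltW.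
  apply: (@le_trans _ _ (K * (a^-1 * q%:R `^ a))).
    by rewrite ler_wpM2l // ln_le_powR.
  by rewrite mulrA ler_wpM2r ?powR_ge0 // lerDr.
have MJ : M ^+ J <= (1 + K / a) ^+ J * q%:R `^ eta.
  apply: le_trans (lerXn2r J _ _ Mle) _; rewrite ?nnegrE ?(le_trans ler01 M1) //.
    by rewrite mulr_ge0 ?powR_ge0 // ltW.
  rewrite exprMn ler_wpM2l ?exprn_ge0 ?(ltW Ka) //.
  rewrite -powR_mulrn ?powR_ge0 // -powRrM ler_powR //.
  rewrite /a mulrAC ler_pdivrMr ?ltr0n // ler_wpM2l ?(ltW eta0) // ler_nat.
  exact: leqnSn.
have EY : expR Y = q%:R `^ d'.
  by rewrite /powR gt_eqF.
apply: le_trans step1 _; rewrite -mulrA ler_wpM2l ?invr_ge0 ?(ltW e0) //.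
apply: le_trans step2 _; rewrite EY.
apply: le_trans (ler_wpM2r (powR_ge0 _ _) MJ) _.
rewrite -mulrA -powRD; last by apply/implyP => _; rewrite gt_eqF.
by rewrite /eta subrK.
Qed.
End WeightProducts.

Lemma inversive_discrepancy (R : realType) (gamma : nat -> R)
    (gamma_ge0 : forall j : nat, (1 <= j)%N -> 0 <= gamma j)
    (gamma_noninc : forall j : nat, (1 <= j)%N -> gamma j.+1 <= gamma j) (d : R) :
  0 < d -> (limn_esup (fun j : nat => (j%:R * gamma j)%:E) < (d / 3)%:E)%E ->
  exists c : R, 0 < c /\ inversive_discrepancy_bound gamma d c.
Proof.
move=> d0 hlim.
have [c c0 cP] := weight_product_bound gamma_ge0 gamma_noninc d0 hlim.
exists (5 * c); split; first by rewrite mulr_gt0.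
move=> p k F charF beta s v p_pr k0 cardF betaP _ vinj.
case: k k0 beta cardF betaP => [//|k] _ beta cardF betaP.
have q1 : (1 < #|F|)%N := finNzRing_gt1 F.
have q0 : (0 : R) < #|F|%:R by rewrite ltr0n; lia.
rewrite -cardF; set B := 5 * c / #|F|%:R `^ (1 / 2 - d).
have B0 : 0 <= B by rewrite divr_ge0 ?powR_ge0 // mulr_ge0 // ltW.
rewrite /weighted_star_discrepancy; apply: bigmax_le => // u _.
have w0 : 0 <= product_weight gamma u.
  by rewrite prodr_ge0 // => j _; apply: gamma_ge0.
pose E : R := 5 * #|u|%:R * (3 * ln #|F|%:R) ^+ #|u| / Num.sqrt #|F|%:R.
apply: (le_trans (ler_wpM2l w0 (ge_sup (x := E) _ _))).
- by eexists; exists (const_mx 0) => // i; rewrite mxE lexx ler01.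
- by move=> _ [alpha ha <-]; exact: (core_discrepancy p_pr cardF betaP u vinj ha).
have -> : product_weight gamma u * E = 5 * (#|u|%:R *
    \prod_(j in u) (gamma j.+1 * (3 * ln #|F|%:R))) / Num.sqrt #|F|%:R.
  by rewrite big_split /= prodr_const /E /product_weight; ring.
have -> : B = 5 * (c * #|F|%:R `^ d) / Num.sqrt #|F|%:R.
  rewrite /B powRB; last by apply/implyP => _; rewrite gt_eqF.
  rewrite div1r powR12_sqrt ?ler0n // invf_div; ring.
rewrite ler_wpM2r ?invr_ge0 ?sqrtr_ge0 // ler_wpM2l //.
exact: cP.
Qed.

Theorem theorem2 (R : realType) (gamma : nat -> R)
    (gamma_ge0 : forall j : nat, (1 <= j)%N -> 0 <= gamma j)
    (gamma_noninc : forall j : nat, (1 <= j)%N -> gamma j.+1 <= gamma j) :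
  (forall delta : R, 0 <= delta -> delta < 1 / 2 ->
     (limn_esup (fun j : nat => (j%:R * gamma j)%:E) < (delta / 3)%:E)%E ->
     exists c : R, 0 < c /\ inversive_discrepancy_bound gamma delta c) /\
  (limn_esup (fun j : nat => (j%:R * gamma j)%:E) = 0%:E ->
   forall delta : R, 0 < delta ->
     exists c : R, 0 < c /\ inversive_discrepancy_bound gamma delta c).
Proof.
split=> [delta _ _ h|h delta d0].
  (* For nonnegative weights the limsup is nonnegative, so its strict bound forces delta > 0. *)
  have [theta /andP[t0 td] _] := eventually_le gamma_ge0 h.
  by apply: inversive_discrepancy => //; lra.
by apply: inversive_discrepancy => //; rewrite h lte_fin divr_gt0.
Qed.
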